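(* Let $T$ be a locally finite tree where every vertex has degree $\geq 3$. Let $G$ be a closed noncompact subgroup of $\mathrm{Aut}(T)$ with Tits' Property (P) and transitive action on $\partial T$. Let $\mathbb{K}\in\{\mathbb{R},\mathbb{C},\mathbb{H}\}$, and let $(\pi,H)$ be a continuous irreducible representation of $G$ to a $\mathbb{K}$-Hilbert space. If $\pi$ preserves a continuous strongly nondegenerate sesquilinear form of finite index $p\geq 0$, then $p=0$ or $p=1$. Moreover, if $p=1$, then the representation $(\pi,H)$ is isomorphic to the tensor product with $\mathbb{K}$ of a real representation.
   Context: $\mathrm{Aut}(T)$ carries the topology of pointwise convergence. $\partial T$ is the set of infinite injective paths $(x_n)_{n\in\mathbb{N}}$ of vertices, two paths $(x_n)$, $(y_n)$ being identified if there is $t\in\mathbb{Z}$ with $x_n=y_{n+t}$ for all large $n$. For a subtree $S$ of $T$, $G(S)$ is the subgroup of $G$ fixing every point of $S$. Every edge $e$ divides $T$ into two subtrees $T_e^{(1)},T_e^{(2)}$ whose union is $T$ and whose intersection is $e$ with its two endpoints. The closed subgroup $G$ has Tits' Property (P) (independence property) if $G(e)=G(T_e^{(1)})G(T_e^{(2)})$ for every edge $e$. $\mathbb{H}$ denotes the quaternions; quaternionic vector spaces are right vector spaces. A continuous representation of $G$ on a $\mathbb{K}$-Hilbert space $H$ is a homomorphism $\pi$ from $G$ to the invertible bounded $\mathbb{K}$-linear operators of $H$ with $g\mapsto\pi(g)v$ continuous for every $v\in H$. It is irreducible if $H\neq\{0\}$ and the only closed $G$-invariant $\mathbb{K}$-subspaces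 are $\{0\}$ and $H$. Sesquilinear forms $B$ are Hermitian, $B(w,v)=\overline{B(v,w)}$ (symmetric bilinear if $\mathbb{K}=\mathbb{R}$). $\pi$ preserves $B$ if $B(\pi(g)v,\pi(g)w)=B(v,w)$ for all $g,v,w$. A continuous form $B$ is strongly nondegenerate if there is a $B$-orthogonal decomposition $H=H_+\oplus H_-$ with $B$ positive definite on $H_+$ and negative definite on $H_-$, such that the positive definite form obtained from $B$ by changing its sign on $H_-$ defines a complete norm on $H$. The index of $B$ is the maximal $\mathbb{K}$-dimension of a negative definite subspace. *)

(* Defs.v *)
From HB Require Import structures.
From mathcomp Require Import all_boot all_order all_algebra.
From mathcomp Require Import all_classical all_reals all_analysis.
From mathcomp Require Import complex ring lra.

Set Implicit Arguments.
Unset Strict Implicit.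
Unset Printing Implicit Defensive.

Import Order.TTheory GRing.Theory Num.Theory.
Import numFieldNormedType.Exports.

Local Open Scope classical_set_scope.
Local Open Scope ring_scope.


(* A tree is given by its set of vertices and its adjacency relation. *)
Record tree := Tree {
  vertex :> choiceType;
  adj : rel vertex;
  adj_sym : symmetric adj;
  adj_irr : irreflexive adj;
  tree_nonempty : inhabited vertex;
  tree_connected : forall x y : vertex,
    exists2 p : seq vertex, path adj x p & last x p = y;
  (* closed walks of length at most 2 without repetition are not circuits:
     they are the empty one and the back-and-forth along an edge *)
  tree_acyclic : forall c : seq vertex, ucycle adj c -> (size c <= 2)%N }.

Definition neighbors (T : tree) (x : T) : set T := [set y | adj x y].

Definition locally_finite (T : tree) := forall x : T, finite_set (neighbors x).

Record aut (T : tree) := Aut {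
  aut_fun :> T -> T;
  aut_inv : T -> T;
  aut_funK : cancel aut_fun aut_inv;
  aut_invK : cancel aut_inv aut_fun;
  aut_adj : forall x y, adj (aut_fun x) (aut_fun y) = adj x y }.

HB.instance Definition _ (T : tree) := gen_eqMixin (aut T).
HB.instance Definition _ (T : tree) := gen_choiceMixin (aut T).

Section AutGroup.
Variable T : tree.
Implicit Types g h : aut T.

Lemma aut_eqP g h : g =1 h -> g = h.
Proof.
case: g h => [f f' fK f'K fa] [e e' eK e'K ea] /= fe.
have {}fe : f = e by apply/funext.
subst e; have fe' : f' = e'.
  by apply/funext => x; rewrite -{1}(e'K x) fK.
subst e'; congr Aut; exact: Prop_irrelevance.
Qed.

Definition aut_one : aut T :=
  @Aut T id id (fun=> erefl) (fun=> erefl) (fun _ _ => erefl).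

Lemma aut_inv_adj g x y : adj (aut_inv g x) (aut_inv g y) = adj x y.
Proof. by rewrite -(aut_adj g) !aut_invK. Qed.

Definition aut_opp g : aut T :=
  Aut (aut_invK g) (aut_funK g) (@aut_inv_adj g).

Lemma aut_mul_adj g h x y : adj (g (h x)) (g (h y)) = adj x y.
Proof. by rewrite !aut_adj. Qed.

Definition aut_mul g h : aut T :=
  @Aut T (g \o h) (aut_inv h \o aut_inv g)
    (can_comp (aut_funK g) (aut_funK h)) (can_comp (aut_invK h) (aut_invK g))
    (@aut_mul_adj g h).

Lemma aut_mulA : associative aut_mul.
Proof. by move=> g h k; apply: aut_eqP. Qed.
Lemma aut_mul1 : left_id aut_one aut_mul.
Proof. by move=> g; apply: aut_eqP. Qed.
Lemma aut_mulr1 : right_id aut_one aut_mul.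
Proof. by move=> g; apply: aut_eqP. Qed.
Lemma aut_mulV : left_inverse aut_one aut_opp aut_mul.
Proof. by move=> g; apply: aut_eqP => x /=; rewrite aut_funK. Qed.
Lemma aut_mulrV : right_inverse aut_one aut_opp aut_mul.
Proof. by move=> g; apply: aut_eqP => x /=; rewrite aut_invK. Qed.

HB.instance Definition _ := isGroup.Build (aut T)
  aut_mulA aut_mul1 aut_mulr1 aut_mulV aut_mulrV.

End AutGroup.

(* The topology of pointwise convergence, the set of vertices being discrete. *)
HB.instance Definition _ (T : tree) := Topological.copy (aut T)
  (initial_topology (fun g : aut T => (g : T -> T) : {ptws T -> discrete_topology T})).

Definition subgroup (T : tree) (G : set (aut T)) :=
  [/\ G 1%g,
      forall g h, G g -> G h -> G (g * h)%g &
      forall g, G g -> G (g^-1)%g].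

Definition is_ray (T : tree) (x : nat -> T) :=
  injective x /\ forall n, adj (x n) (x n.+1).

(* [n%:Z + t] is nonnegative for all large [n]. *)
Definition ray_equiv (T : tree) (x y : nat -> T) :=
  exists t : int, \forall n \near \oo, x n = y `|(n%:Z + t)%R|%N.

Definition boundary_transitive (T : tree) (G : set (aut T)) :=
  forall x y : nat -> T, is_ray x -> is_ray y ->
    exists2 g, G g & ray_equiv (g \o x) y.

(* Fixing every point of a subtree is fixing each of its vertices. *)
Definition fixator (T : tree) (G : set (aut T)) (S : set T) : set (aut T) :=
  [set g | G g /\ forall x, S x -> g x = x].

Definition adj_minus (T : tree) (a b : T) : rel T := fun x y =>
  adj x y && ~~ ((x == a) && (y == b) || (x == b) && (y == a)).

(* Of the two subtrees determined by the edge [{a, b}], the one on the side of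
   [a]: the component of [a] once the edge is deleted, together with the edge. *)
Definition half_tree (T : tree) (a b : T) : set T :=
  [set x | exists2 p : seq T, path (adj_minus a b) a p & last a p = x]
  `|` [set b].

Definition Tits_property_P (T : tree) (G : set (aut T)) :=
  forall a b : T, adj a b ->
    fixator G [set a; b] =
    [set (g * h)%g | g in fixator G (half_tree a b)
                   & h in fixator G (half_tree b a)].


Record quaternion (R : Type) := Quat { qa : R; qb : R; qc : R; qd : R }.

Section QuaternionRing.
Variable R : realType.
Local Notation H := (quaternion R).

Definition quat_tuple (x : H) := (qa x, qb x, qc x, qd x).
Definition tuple_quat (t : R * R * R * R) : H :=
  let: (a, b, c, d) := t in Quat a b c d.
Lemma quat_tupleK : cancel quat_tuple tuple_quat. Proof. by case. Qed.

HB.instance Definition _ := Choice.copy H (can_type quat_tupleK).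

Definition quat_add (x y : H) :=
  Quat (qa x + qa y) (qb x + qb y) (qc x + qc y) (qd x + qd y).
Definition quat_opp (x : H) := Quat (- qa x) (- qb x) (- qc x) (- qd x).
Definition quat_zero : H := Quat 0 0 0 0.
Definition quat_one : H := Quat 1 0 0 0.

Definition quat_mul (x y : H) :=
  let: Quat a b c d := x in let: Quat a' b' c' d' := y in
  Quat (a * a' - b * b' - c * c' - d * d')
       (a * b' + b * a' + c * d' - d * c')
       (a * c' - b * d' + c * a' + d * b')
       (a * d' + b * c' - c * b' + d * a').

Lemma quat_addA : associative quat_add.
Proof. by move=> [????] [????] [????]; rewrite /quat_add /=; congr Quat; ring. Qed.
Lemma quat_addC : commutative quat_add.
Proof. by move=> [????] [????]; rewrite /quat_add /=; congr Quat; ring. Qed.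
Lemma quat_add0 : left_id quat_zero quat_add.
Proof. by move=> [????]; rewrite /quat_add /=; congr Quat; ring. Qed.
Lemma quat_addN : left_inverse quat_zero quat_opp quat_add.
Proof. by move=> [????]; rewrite /quat_add /=; congr Quat; ring. Qed.

HB.instance Definition _ := GRing.isZmodule.Build H
  quat_addA quat_addC quat_add0 quat_addN.

Lemma quat_mulA : associative quat_mul.
Proof. by move=> [????] [????] [????] /=; congr Quat; ring. Qed.
Lemma quat_mul1 : left_id quat_one quat_mul.
Proof. by move=> [????] /=; congr Quat; ring. Qed.
Lemma quat_mulr1 : right_id quat_one quat_mul.
Proof. by move=> [????] /=; congr Quat; ring. Qed.
Lemma quat_mulDl : left_distributive quat_mul quat_add.
Proof. by move=> [????] [????] [????]; rewrite /quat_add /=; congr Quat; ring. Qed.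
Lemma quat_mulDr : right_distributive quat_mul quat_add.
Proof. by move=> [????] [????] [????]; rewrite /quat_add /=; congr Quat; ring. Qed.
Lemma quat_1_neq0 : quat_one != quat_zero.
Proof. by apply/eqP => -[] /eqP; rewrite oner_eq0. Qed.

HB.instance Definition _ := GRing.Zmodule_isNzRing.Build H
  quat_mulA quat_mul1 quat_mulr1 quat_mulDl quat_mulDr quat_1_neq0.

Definition quat_conj (x : H) : H := Quat (qa x) (- qb x) (- qc x) (- qd x).

End QuaternionRing.

Inductive scalar_kind := Reals | Complexes | Quaternions.

Definition scalars (R : realType) (k : scalar_kind) : nzRingType :=
  match k with
  | Reals => R
  | Complexes => R[i]
  | Quaternions => quaternion R
  end.

Definition sdim (k : scalar_kind) : nat :=
  match k with Reals => 1 | Complexes => 2 | Quaternions => 4 end.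

Section Scalars.
Variable R : realType.

Definition sconj (k : scalar_kind) : scalars R k -> scalars R k :=
  match k return scalars R k -> scalars R k with
  | Reals => fun a => a
  | Complexes => @conjc R
  | Quaternions => @quat_conj R
  end.

Definition sreal (k : scalar_kind) : R -> scalars R k :=
  match k return R -> scalars R k with
  | Reals => fun r => r
  | Complexes => fun r => Complex r 0
  | Quaternions => fun r => Quat r 0 0 0
  end.

Definition sre (k : scalar_kind) : scalars R k -> R :=
  match k return scalars R k -> R with
  | Reals => fun a => a
  | Complexes => @complex.Re R
  | Quaternions => @qa R
  end.

(* Coordinates in the usual real basis (1), (1, i) or (1, i, j, k). *)
Definition scoord (k : scalar_kind) : scalars R k -> 'I_(sdim k) -> R :=
  match k return scalars R k -> 'I_(sdim k) -> R with
  | Reals => fun a _ => a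
  | Complexes => fun a i => [:: complex.Re a; complex.Im a]`_i
  | Quaternions => fun a i => [:: qa a; qb a; qc a; qd a]`_i
  end.

Definition sbasis (k : scalar_kind) : 'I_(sdim k) -> scalars R k :=
  match k return 'I_(sdim k) -> scalars R k with
  | Reals => fun=> 1
  | Complexes => fun i => [:: Complex 1 0; Complex 0 1]`_i
  | Quaternions => fun i =>
      [:: Quat 1 0 0 0; Quat 0 1 0 0; Quat 0 0 1 0; Quat 0 0 0 1]`_i
  end.

End Scalars.


(* A K-Hilbert space is a real Banach space with a right K-vector space
   structure extending multiplication by real scalars, whose norm comes from a
   K-valued inner product, conjugate-linear in the first variable and linear in
   the second one. *)
HB.mixin Record CompleteNormedModule_isHilbert (R : realType) (k : scalar_kind)
    H of CompleteNormedModule R H := {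
  ract : H -> scalars R k -> H;
  ractDl : forall v w a, ract (v + w) a = ract v a + ract w a;
  ractDr : forall v a b, ract v (a + b) = ract v a + ract v b;
  ractA : forall v a b, ract v (a * b) = ract (ract v a) b;
  ract_real : forall v (r : R), ract v (sreal k r) = r *: v;
  inner : H -> H -> scalars R k;
  innerDr : forall u v w, inner u (v + w) = inner u v + inner u w;
  inner_ractr : forall v w a, inner v (ract w a) = inner v w * a;
  inner_conj : forall v w, inner w v = sconj (inner v w);
  inner_norm : forall v, inner v v = sreal k (`|v| ^+ 2) }.

#[short(type="hilbertType")]
HB.structure Definition Hilbert (R : realType) (k : scalar_kind) :=
  { H of CompleteNormedModule R H & CompleteNormedModule_isHilbert R k H }.

Section ScalarTheory.
Variables (R : realType) (k : scalar_kind).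
Implicit Types (a b : scalars R k) (r s : R).

Lemma srealD r s : sreal k (r + s) = sreal k r + sreal k s.
Proof.
case: k => //=; first by rewrite [RHS]/GRing.add /=; congr Complex; rewrite addr0.
by rewrite [RHS]/GRing.add /= /quat_add /=; congr Quat; rewrite addr0.
Qed.

Lemma srealM r s : sreal k (r * s) = sreal k r * sreal k s.
Proof.
case: k => //=; first by rewrite [RHS]/GRing.mul /=; congr Complex; ring.
by rewrite [RHS]/GRing.mul /=; congr Quat; ring.
Qed.

Lemma sreal1 : sreal k (1 : R) = 1. Proof. by case: k. Qed.

Lemma sreal0 : sreal k (0 : R) = 0. Proof. by case: k. Qed.

Lemma sreal_comm r a : sreal k r * a = a * sreal k r.
Proof.
case: k a => /=; first by move=> a; rewrite mulrC.
  by move=> a; rewrite mulrC.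
by move=> [????]; rewrite /GRing.mul /=; congr Quat; ring.
Qed.

Lemma sconjD a b : sconj (a + b) = sconj a + sconj b.
Proof.
case: k a b => //=.
  by move=> [a1 a2] [b1 b2]; congr Complex; exact: opprD.
by move=> [a1 a2 a3 a4] [b1 b2 b3 b4]; congr Quat; exact: opprD.
Qed.

Lemma sconj0 : sconj (0 : scalars R k) = 0.
Proof. by apply: (@addrI _ (sconj 0)); rewrite -sconjD !addr0. Qed.

Lemma sconjM a b : sconj (a * b) = sconj b * sconj a.
Proof.
case: k a b => /=; first by move=> a b; rewrite mulrC.
  move=> [a1 a2] [b1 b2].
  rewrite -![Complex _ _ * Complex _ _]/(Complex _ _) /=.
  by congr Complex; ring.
move=> [a1 a2 a3 a4] [b1 b2 b3 b4].
rewrite -![Quat _ _ _ _ * Quat _ _ _ _]/(Quat _ _ _ _) /quat_conj /=.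
by congr Quat; ring.
Qed.

Lemma sconjK a : sconj (sconj a) = a.
Proof.
case: k a => //=; first by move=> [??] /=; rewrite opprK.
by move=> [????]; rewrite /quat_conj /= !opprK.
Qed.

Lemma sconj_real r : sconj (sreal k r) = sreal k r.
Proof. by case: k => //=; rewrite /quat_conj /= oppr0. Qed.

Lemma scoordD a b i : scoord (a + b) i = scoord a i + scoord b i.
Proof.
case: k a b i => //=; first by move=> [??] [??] [[|[|]] //= ?].
by move=> [????] [????] [[|[|[|[|]]]] //= ?].
Qed.

Lemma scoordM r a i : scoord (sreal k r * a) i = r * scoord a i.
Proof.
case: k a i => //=.
  by move=> [??] [[|[|]] //= ?]; ring.
by move=> [????] [[|[|[|[|]]]] //= ?]; ring.
Qed.

Lemma scoord_basis i j : scoord (sbasis R (k := k) i) j = (i == j)%:R.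
Proof.
case: k i j => /=; first by move=> i j; rewrite !ord1.
  by move=> [[|[|]] //= ?] [[|[|]] //= ?].
by move=> [[|[|[|[|]]]] //= ?] [[|[|[|[|]]]] //= ?].
Qed.

Lemma scoordE a : a = \sum_i sreal k (scoord a i) * sbasis R i.
Proof.
have cD (x y x' y' : R) : Complex x y + Complex x' y' = Complex (x + x') (y + y').
  by [].
have qD (x y z t x' y' z' t' : R) : Quat x y z t + Quat x' y' z' t' =
    Quat (x + x') (y + y') (z + z') (t + t') by [].
case: k a => /=; first by move=> a; rewrite big_ord1 mulr1.
  move=> [x y]; rewrite big_ord_recl big_ord1 /= mulr1.
  rewrite -![Complex _ _ * Complex _ _]/(Complex _ _) cD.
  by rewrite !(mulr0, mul0r, mulr1, add0r, addr0, subr0).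
move=> [x y z t]; rewrite !big_ord_recl big_ord0 /= mulr1 addr0.
rewrite -![Quat _ _ _ _ * Quat _ _ _ _]/(Quat _ _ _ _) !qD /=.
by rewrite !(mulr0, mul0r, mulr1, add0r, addr0, subr0, oppr0).
Qed.

Lemma scoord0 i : scoord (0 : scalars R k) i = 0.
Proof. by have := scoordM 0 0 i; rewrite mulr0 mul0r. Qed.

Lemma sconj_basisM i : sconj (sbasis R i) * sbasis R i = 1 :> scalars R k.
Proof.
pose simp := (mulr0, mul0r, mulr1, addr0, add0r, subr0, oppr0, mulrN, opprK, mulNr).
case: k i => /= [i|[[|[|]] //= ?]|[[|[|[|[|]]]] //= ?]]; first exact: mulr1.
- by rewrite -[LHS]/(Complex _ _) !simp.
- by rewrite -[LHS]/(Complex _ _) !simp.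
- by rewrite -[LHS]/(Quat _ _ _ _) !simp.
- by rewrite -[LHS]/(Quat _ _ _ _) !simp.
- by rewrite -[LHS]/(Quat _ _ _ _) !simp.
- by rewrite -[LHS]/(Quat _ _ _ _) !simp.
Qed.

Lemma sconj_basis_anti i j : j != i ->
  sconj (sbasis R i) * sbasis R j + sconj (sbasis R j) * sbasis R i = 0
  :> scalars R k.
Proof.
pose simp := (mulr0, mul0r, mulr1, addr0, add0r, subr0, oppr0, mulrN, opprK, mulNr,
  subrr, addNr).
case: k i j => /=.
- by move=> i j; rewrite !ord1.
- by move=> [[|[|]] //= ?] [[|[|]] //= ?] _;
    rewrite -[LHS]/(Complex (_ + _) (_ + _)) /= !simp.
- by move=> [[|[|[|[|]]]] //= ?] [[|[|[|[|]]]] //= ?] _;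
    rewrite -[LHS]/(Quat (_ + _) (_ + _) (_ + _) (_ + _)) /= !simp.
Qed.

Lemma scoord_sum n (F : 'I_n -> scalars R k) i :
  scoord (\sum_j F j) i = \sum_j scoord (F j) i.
Proof.
by apply: (big_morph (fun a => scoord a i)) => [a b|]; rewrite (scoordD, scoord0).
Qed.

End ScalarTheory.


(* As the basis [sbasis k] of K over R is finite, every element of the real
   tensor product of [H0] and K is [\sum_i f i (x) sbasis k i] for a unique
   family [f] of vectors of [H0], by which we represent it. *)
Definition tensor (R : realType) (k : scalar_kind)
  (H0 : hilbertType R Reals) : Type := {ffun 'I_(sdim k) -> H0}.

Section Tensor.
Variables (R : realType) (k : scalar_kind) (H0 : hilbertType R Reals).
Local Notation HK := (tensor k H0).
Implicit Types f g : HK.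

HB.instance Definition _ := GRing.Lmodule.copy HK {ffun 'I_(sdim k) -> H0}.

Definition pure_tensor (v : H0) (a : scalars R k) : HK :=
  [ffun i => scoord a i *: v].

Definition tensor_norm f : R := Num.sqrt (\sum_i `|f i| ^+ 2).

(* [(v (x) e_i) a = v (x) e_i a], with [e_i a = \sum_j (e_i a)_j e_j]. *)
Definition tensor_ract f (a : scalars R k) : HK :=
  [ffun j => \sum_i scoord (sbasis R i * a) j *: f i].

(* [<v (x) a, w (x) b> = conj(a) <v, w> b] *)
Definition tensor_inner f g : scalars R k :=
  \sum_i \sum_j sconj (sbasis R i) * sreal k (inner (f i) (g j)) * sbasis R j.

Lemma tensor_norm_sqr f : tensor_norm f ^+ 2 = \sum_i `|f i| ^+ 2.
Proof. by rewrite sqr_sqrtr// sumr_ge0 // => i _; rewrite sqr_ge0. Qed.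

Lemma tensor_norm_ge0 f : 0 <= tensor_norm f.
Proof. exact: sqrtr_ge0. Qed.

Lemma sum_cauchy_schwarz n (a b : 'I_n -> R) :
  (\sum_i a i * b i) ^+ 2 <= (\sum_i a i ^+ 2) * (\sum_i b i ^+ 2).
Proof.
have : 0 <= \sum_i \sum_j (a i * b j - a j * b i) ^+ 2.
  by apply: sumr_ge0 => i _; apply: sumr_ge0 => j _; rewrite sqr_ge0.
suff -> : \sum_i \sum_j (a i * b j - a j * b i) ^+ 2 =
    2 * ((\sum_i a i ^+ 2) * (\sum_i b i ^+ 2)) - 2 * (\sum_i a i * b i) ^+ 2.
  by lra.
have E (x y : 'I_n -> R) : \sum_i \sum_j x i * y j = (\sum_i x i) * (\sum_i y i).
  by rewrite big_distrl; apply: eq_bigr => i _; rewrite big_distrr.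
have -> : \sum_i \sum_j (a i * b j - a j * b i) ^+ 2 =
   \sum_i \sum_j ((a i ^+ 2 * b j ^+ 2 + b i ^+ 2 * a j ^+ 2)
                   - 2 * ((a i * b i) * (a j * b j))).
  by apply: eq_bigr => i _; apply: eq_bigr => j _; ring.
under eq_bigr do rewrite big_split /= big_split /=.
rewrite big_split big_split /= !E.
have -> : \sum_(i < n) \sum_(j < n) - (2 * (a i * b i * (a j * b j)))
   = - (2 * (\sum_(i < n) a i * b i) ^+ 2).
  under eq_bigr do rewrite sumrN -mulr_sumr.
  by rewrite sumrN -mulr_sumr E expr2.
by rewrite mulrC; ring.
Qed.

Lemma tensor_norm_triangle f g :
  tensor_norm (f + g) <= tensor_norm f + tensor_norm g.
Proof.
rewrite -(@ler_pXn2r _ 2) ?nnegrE ?addr_ge0 ?tensor_norm_ge0//.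
rewrite sqrrD !tensor_norm_sqr.
have CS : \sum_i `|f i| * `|g i| <= tensor_norm f * tensor_norm g.
  rewrite -(@ler_pXn2r _ 2) ?nnegrE ?mulr_ge0 ?tensor_norm_ge0//; last first.
    by apply: sumr_ge0 => i _; rewrite mulr_ge0.
  by rewrite exprMn !tensor_norm_sqr sum_cauchy_schwarz.
apply: (@le_trans _ _ (\sum_i (`|f i| + `|g i|) ^+ 2)).
  apply: ler_sum => i _; rewrite ffunE ler_pXn2r ?nnegrE ?addr_ge0//.
  exact: ler_normD.
under eq_bigr do rewrite sqrrD -mulr_natr.
rewrite !big_split /= -mulr_suml -[X in _ <= _ + X + _]mulr_natr.
by rewrite lerD2r lerD2l ler_pM2r.
Qed.

Lemma tensor_normZ (r : R) f : tensor_norm (r *: f) = `|r| * tensor_norm f.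
Proof.
rewrite -[`|r|]sqrtr_sqr -sqrtrM ?sqr_ge0// mulr_sumr; congr Num.sqrt.
by apply: eq_bigr => i _; rewrite ffunE normrZ exprMn real_normK ?num_real.
Qed.

Lemma tensor_norm_comp f i : `|f i| <= tensor_norm f.
Proof.
rewrite -(@ler_pXn2r _ 2) ?nnegrE ?tensor_norm_ge0// tensor_norm_sqr.
by rewrite (bigD1 i)//= lerDl sumr_ge0// => j _; rewrite sqr_ge0.
Qed.

Lemma tensor_norm0_eq0 f : tensor_norm f = 0 -> f = 0.
Proof.
move=> f0; apply/ffunP => i; rewrite ffunE; apply/eqP.
by rewrite -normr_le0 -f0 tensor_norm_comp.
Qed.

HB.instance Definition _ := Lmodule_isNormed.Build R HK
  tensor_norm_triangle tensor_normZ tensor_norm0_eq0.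

Lemma tensor_norm_le f (e : R) :
  (forall i, `|f i| <= e) -> `|f| <= (sdim k)%:R * e.
Proof.
move=> fe; have [i0] : inhabited 'I_(sdim k) by case: k => /=; exists; exact: ord0.
have e0 : 0 <= e := le_trans (normr_ge0 _) (fe i0).
rewrite -(@ler_pXn2r _ 2) ?nnegrE ?mulr_ge0// [_ ^+ 2]tensor_norm_sqr.
apply: (@le_trans _ _ (\sum_(i < sdim k) e ^+ 2)).
  by apply: ler_sum => i _; rewrite ler_pXn2r ?nnegrE.
rewrite sumr_const card_ord -[leLHS]mulr_natl exprMn ler_wpM2r ?sqr_ge0//.
by rewrite -natrX ler_nat; case: k.
Qed.

Lemma tensor_complete (F : set_system HK) : ProperFilter F -> cauchy F -> cvg F.
Proof.
move=> FF /cauchy_ballP Fc.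
have cvi i : cvg ((fun f : HK => f i) @ F).
  apply: cauchy_cvg; apply/cauchy_ballP => e e0.
  have [[A B] /= [FA FB] ABe] := Fc e e0.
  exists ((fun f : HK => f i) @` A, (fun f : HK => f i) @` B).
    by split; [apply: filterS FA|apply: filterS FB] => f Af; exists f.
  move=> [_ _] /= [[f Af <-] [g Bg <-]].
  have := ABe (f, g) (conj Af Bg); rewrite /= -!ball_normE /=.
  by apply: le_lt_trans; have := tensor_norm_comp (f - g) i; rewrite !ffunE.
apply/cvg_ex; exists [ffun i => lim ((fun f : HK => f i) @ F)].
apply/cvgrPdist_le => e e0.
have d0 : (0 : R) < (sdim k)%:R by case: k.
have : F [set g : HK | forall i,
    `|lim ((fun f : HK => f i) @ F) - g i| <= e / (sdim k)%:R].
  apply: filter_forall => i.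
  have /cvgrPdist_le := cvi i; apply; exact: divr_gt0.
apply: filterS => f fe.
have -> : e = (sdim k)%:R * (e / (sdim k)%:R) by rewrite mulrC divfK// gt_eqF.
by apply: tensor_norm_le => i; rewrite !ffunE.
Qed.

HB.instance Definition _ := Uniform_isComplete.Build HK tensor_complete.

Implicit Types (v w : H0) (a b : scalars R k).

Lemma real_innerC v w : inner w v = inner v w :> R.
Proof. exact: (inner_conj v w). Qed.

Lemma real_innerDr u v w : inner u (v + w) = inner u v + inner u w :> R.
Proof. exact: (innerDr u v w). Qed.

Lemma real_innerZr v (r : R) w : inner v (r *: w) = r * inner v w :> R.
Proof. by rewrite -ract_real; have := inner_ractr v w r; rewrite [RHS]mulrC => <-. Qed.

Lemma real_inner_norm v : inner v v = `|v| ^+ 2 :> R.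
Proof. exact: (inner_norm v). Qed.

Lemma real_inner_sumr n v (F : 'I_n -> H0) :
  inner v (\sum_i F i) = \sum_i inner v (F i) :> R.
Proof.
apply: (big_morph (fun w => inner v w : R)) => [x y|]; first exact: real_innerDr.
by have := real_innerZr v 0 0; rewrite scale0r mul0r.
Qed.

Lemma tensor_ractDl f g a :
  tensor_ract (f + g) a = tensor_ract f a + tensor_ract g a.
Proof.
apply/ffunP => j; rewrite !ffunE -big_split; apply: eq_bigr => i _.
by rewrite ffunE scalerDr.
Qed.

Lemma tensor_ractDr f a b :
  tensor_ract f (a + b) = tensor_ract f a + tensor_ract f b.
Proof.
apply/ffunP => j; rewrite !ffunE -big_split; apply: eq_bigr => i _.
by rewrite mulrDr scoordD scalerDl.
Qed.

Lemma tensor_ractA f a b :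
  tensor_ract f (a * b) = tensor_ract (tensor_ract f a) b.
Proof.
apply/ffunP => j; rewrite !ffunE.
under [RHS]eq_bigr do rewrite ffunE scaler_sumr.
rewrite exchange_big /=; apply: eq_bigr => i _.
under eq_bigr do rewrite scalerA mulrC -scoordM.
rewrite -scaler_suml -scoord_sum; congr (scoord _ j *: _).
rewrite mulrA {1}[sbasis R i * a]scoordE mulr_suml.
by apply: eq_bigr => l _; rewrite mulrA.
Qed.

Lemma tensor_ract_real f (r : R) : tensor_ract f (sreal k r) = r *: f.
Proof.
apply/ffunP => j; rewrite !ffunE (bigD1 j)//= big1 ?addr0 => [|i ij].
  by rewrite -sreal_comm scoordM scoord_basis eqxx mulr1.
by rewrite -sreal_comm scoordM scoord_basis (negbTE ij) mulr0 scale0r.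
Qed.

Lemma tensor_innerDr f g g' :
  tensor_inner f (g + g') = tensor_inner f g + tensor_inner f g'.
Proof.
rewrite -big_split; apply: eq_bigr => i _; rewrite -big_split /=.
by apply: eq_bigr => j _; rewrite ffunE real_innerDr srealD mulrDr mulrDl.
Qed.

Lemma sreal_sum n (F : 'I_n -> R) :
  sreal k (\sum_i F i) = \sum_i sreal k (F i).
Proof. by apply: (big_morph (sreal k)) => [x y|]; rewrite (srealD, sreal0). Qed.

Lemma tensor_inner_ractr f g a :
  tensor_inner f (tensor_ract g a) = tensor_inner f g * a.
Proof.
rewrite mulr_suml; apply: eq_bigr => i _; rewrite mulr_suml.
under eq_bigr do rewrite ffunE real_inner_sumr sreal_sum mulr_sumr mulr_suml.
rewrite exchange_big /=; apply: eq_bigr => l _.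
rewrite -[RHS]mulrA [in RHS](scoordE (sbasis R l * a)) mulr_sumr.
apply: eq_bigr => j _.
by rewrite real_innerZr srealM !mulrA; congr (_ * _); rewrite -!mulrA sreal_comm.
Qed.

Lemma tensor_inner_conj f g : tensor_inner g f = sconj (tensor_inner f g).
Proof.
have sconj_sum n (F : 'I_n -> scalars R k) :
    sconj (\sum_i F i) = \sum_i sconj (F i).
  by apply: (big_morph (@sconj R k)) => [x y|]; rewrite (sconjD, sconj0).
rewrite [RHS]sconj_sum; under [RHS]eq_bigr do rewrite sconj_sum.
rewrite exchange_big; apply: eq_bigr => i _; apply: eq_bigr => j _.
by rewrite !sconjM sconjK sconj_real real_innerC mulrA.
Qed.

Lemma tensor_inner_swap f : tensor_inner f f + tensor_inner f f =
  \sum_i \sum_j sreal k (inner (f i) (f j)) * (sconj (sbasis R i) * sbasis R j) +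
  \sum_i \sum_j sreal k (inner (f j) (f i)) * (sconj (sbasis R j) * sbasis R i).
Proof.
have E : tensor_inner f f = \sum_i \sum_j
    sreal k (inner (f i) (f j)) * (sconj (sbasis R i) * sbasis R j).
  by apply: eq_bigr => i _; apply: eq_bigr => j _; rewrite mulrA sreal_comm.
by rewrite {1}E; congr (_ + _); rewrite E exchange_big.
Qed.

Lemma tensor_inner_norm f : tensor_inner f f = sreal k (`|f| ^+ 2).
Proof.
rewrite [`|f| ^+ 2]tensor_norm_sqr sreal_sum.
set S := tensor_inner f f.
have S2 : S + S = \sum_i (sreal k (`|f i| ^+ 2) + sreal k (`|f i| ^+ 2)).
  rewrite tensor_inner_swap -big_split; apply: eq_bigr => i _.
  rewrite -big_split (bigD1 i)//= big1 => [|j ji].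
    by rewrite addr0 -real_inner_norm sconj_basisM mulr1.
  by rewrite real_innerC -mulrDr sconj_basis_anti ?mulr0.
have half (x y : scalars R k) : x + x = y + y -> x = y.
  move=> xy; rewrite -[x]mul1r -[y]mul1r -sreal1.
  have -> : (1 : R) = 2^-1 + 2^-1 by lra.
  by rewrite srealD !mulrDl -!mulrDr xy.
by apply: half; rewrite S2 big_split.
Qed.

Lemma pure_tensor_ract v a b :
  tensor_ract (pure_tensor v a) b = pure_tensor v (a * b).
Proof.
apply/ffunP => j; rewrite !ffunE [in RHS](scoordE a) mulr_suml scoord_sum.
rewrite scaler_suml; apply: eq_bigr => i _.
by rewrite ffunE scalerA -mulrA scoordM mulrC.
Qed.

Lemma tensor_inner_pure v w a b :
  tensor_inner (pure_tensor v a) (pure_tensor w b) =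
  sconj a * sreal k (inner v w) * b.
Proof.
have sconj_sum n (F : 'I_n -> scalars R k) :
    sconj (\sum_i F i) = \sum_i sconj (F i).
  by apply: (big_morph (@sconj R k)) => [x y|]; rewrite (sconjD, sconj0).
rewrite [in RHS](scoordE a) [in RHS](scoordE b) sconj_sum !mulr_suml.
apply: eq_bigr => i _; rewrite mulr_sumr; apply: eq_bigr => j _.
rewrite !ffunE real_innerZr real_innerC real_innerZr real_innerC !srealM.
rewrite sconjM sconj_real !mulrA; congr (_ * _); rewrite -!mulrA; congr (_ * _).
by rewrite sreal_comm -mulrA.
Qed.

HB.instance Definition _ := CompleteNormedModule_isHilbert.Build R k HK
  tensor_ractDl tensor_ractDr tensor_ractA tensor_ract_real
  tensor_innerDr tensor_inner_ractr tensor_inner_conj tensor_inner_norm.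

End Tensor.


Section Representations.
Variables (T : tree) (G : set (aut T)) (R : realType) (k : scalar_kind).

Definition k_linear (H H' : hilbertType R k) (f : H -> H') :=
  (forall v w, f (v + w) = f v + f w) /\
  (forall v a, f (ract v a) = ract (f v) a).

Definition bounded_map (H H' : hilbertType R k) (f : H -> H') :=
  exists M : R, forall v, `|f v| <= M * `|v|.

Variable H : hilbertType R k.

Definition k_subspace (W : set H) :=
  [/\ W 0, forall v w, W v -> W w -> W (v + w) &
      forall v a, W v -> W (ract v a)].

(* The values of [pi] outside [G] are irrelevant. Each [pi g] is invertible
   with bounded inverse [pi g^-1]. *)
Record continuous_rep (pi : aut T -> H -> H) : Prop := ContinuousRep {
  rep_linear : forall g, G g -> k_linear (pi g);
  rep_bounded : forall g, G g -> bounded_map (pi g);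
  rep_one : forall v, pi 1%g v = v;
  rep_mul : forall g h, G g -> G h -> forall v, pi (g * h)%g v = pi g (pi h v);
  rep_continuous : forall v, {within G, continuous (fun g => pi g v)} }.

Definition irreducible_rep (pi : aut T -> H -> H) :=
  (exists v : H, v != 0) /\
  forall W : set H, k_subspace W -> closed W ->
    (forall g v, G g -> W v -> W (pi g v)) -> W = [set 0] \/ W = setT.

Definition rep_isomorphic (H' : hilbertType R k)
    (pi : aut T -> H -> H) (pi' : aut T -> H' -> H') :=
  exists (f : H -> H') (f' : H' -> H),
    [/\ k_linear f, bounded_map f, bounded_map f', cancel f f' & cancel f' f] /\
    forall g v, G g -> f (pi g v) = pi' g (f v).

Definition sesquilinear_form (B : H -> H -> scalars R k) :=
  [/\ forall u v w, B (u + v) w = B u w + B v w,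
      forall u v w, B u (v + w) = B u v + B u w,
      forall v w a, B (ract v a) w = sconj a * B v w &
      forall v w a, B v (ract w a) = B v w * a].

Definition hermitian_form (B : H -> H -> scalars R k) :=
  forall v w, B w v = sconj (B v w).

(* K carries the product topology of its real coordinates. *)
Definition continuous_form (B : H -> H -> scalars R k) :=
  forall i, continuous (fun vw : H * H => scoord (B vw.1 vw.2) i : R).

Definition preserves_form (pi : aut T -> H -> H) (B : H -> H -> scalars R k) :=
  forall g v w, G g -> B (pi g v) (pi g w) = B v w.

(* For a Hermitian form, [B v v] is real. *)
Definition positive_definite_on (B : H -> H -> scalars R k) (W : set H) :=
  forall v, W v -> v != 0 -> 0 < sre (B v v).

Definition negative_definite_on (B : H -> H -> scalars R k) (W : set H) :=
  forall v, W v -> v != 0 -> sre (B v v) < 0.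

Definition complete_norm (N : H -> R) :=
  forall u : nat -> H,
    (forall e, 0 < e -> exists n0, forall m n,
       (n0 <= m)%N -> (n0 <= n)%N -> N (u m - u n) < e) ->
    exists l, N (u n - l) @[n --> \oo] --> 0.

(* [pr_p] and [pr_m] are the projections of [H] onto [Hp] and [Hm]. *)
Definition strongly_nondegenerate (B : H -> H -> scalars R k) :=
  exists (Hp Hm : set H) (pr_p pr_m : H -> H),
    [/\ k_subspace Hp, k_subspace Hm,
        (forall v, [/\ Hp (pr_p v), Hm (pr_m v) & v = pr_p v + pr_m v]),
        Hp `&` Hm = [set 0] &
        (forall v w, Hp v -> Hm w -> B v w = 0)] /\
    [/\ positive_definite_on B Hp,
        negative_definite_on B Hm &
        complete_norm (fun v =>
          Num.sqrt (sre (B (pr_p v) (pr_p v) - B (pr_m v) (pr_m v))))].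

Definition has_dim (W : set H) (n : nat) :=
  exists e : 'I_n -> H,
    (forall c : 'I_n -> scalars R k,
       \sum_i ract (e i) (c i) = 0 -> forall i, c i = 0) /\
    W = [set v | exists c : 'I_n -> scalars R k, v = \sum_i ract (e i) (c i)].

Definition form_index (B : H -> H -> scalars R k) (p : nat) :=
  (exists W, [/\ k_subspace W, negative_definite_on B W & has_dim W p]) /\
  forall W, k_subspace W -> negative_definite_on B W ->
    exists2 n, (n <= p)%N & has_dim W n.

End Representations.

Definition tensor_rep (T : tree) (R : realType) (k : scalar_kind)
    (H0 : hilbertType R Reals) (pi0 : aut T -> H0 -> H0) :
    aut T -> tensor k H0 -> tensor k H0 :=
  fun g f => [ffun i => pi0 g (f i)].

Lemma tensor_rep_pure (T : tree) (G : set (aut T)) (R : realType)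
    (k : scalar_kind) (H0 : hilbertType R Reals) (pi0 : aut T -> H0 -> H0) g
    (v : H0) (a : scalars R k) : continuous_rep G pi0 -> G g ->
  tensor_rep pi0 g (pure_tensor v a) = pure_tensor (pi0 g v) a.
Proof.
move=> pi0G Gg; apply/ffunP => i; rewrite !ffunE.
by rewrite -!ract_real; have [_] := rep_linear pi0G Gg; exact.
Qed.

Lemma tensor_rep_continuous (T : tree) (G : set (aut T)) (R : realType)
    (k : scalar_kind) (H0 : hilbertType R Reals) (pi0 : aut T -> H0 -> H0) :
  subgroup G -> continuous_rep G pi0 ->
  continuous_rep G (tensor_rep (k := k) pi0).
Proof.
move=> sG pi0G.
have d0 : (0 : R) < (sdim k)%:R by case: k.
have piZ g (r : R) v : G g -> pi0 g (r *: v) = r *: pi0 g v.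
  by move=> Gg; rewrite -!ract_real; have [_] := rep_linear pi0G Gg; exact.
have piD g v w : G g -> pi0 g (v + w) = pi0 g v + pi0 g w.
  by move=> Gg; have [+ _] := rep_linear pi0G Gg; exact.
have pi0z g : G g -> pi0 g 0 = 0.
  by move=> Gg; have := piZ g 0 0 Gg; rewrite !scale0r.
have piS g n (F : 'I_n -> H0) : G g -> pi0 g (\sum_i F i) = \sum_i pi0 g (F i).
  move=> Gg; apply: (big_morph (pi0 g)) => [v w|]; by rewrite (piD, pi0z).
split.
- move=> g Gg; split => [f f'|f a]; apply/ffunP => i; rewrite !ffunE ?piD//.
  by rewrite piS//; apply: eq_bigr => j _; rewrite piZ// ffunE.
- move=> g Gg; have [M piM] := rep_bounded pi0G Gg.
  exists ((sdim k)%:R * `|M|) => f; rewrite -mulrA; apply: tensor_norm_le => i.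
  rewrite ffunE (le_trans (piM _))//.
  apply: (@le_trans _ _ (`|M| * `|f i|)); first by rewrite ler_wpM2r// ler_norm.
  by rewrite ler_wpM2l// tensor_norm_comp.
- by move=> f; apply/ffunP => i; rewrite ffunE (rep_one pi0G).
- by move=> g h Gg Gh f; apply/ffunP => i; rewrite !ffunE (rep_mul pi0G).
- move=> f g; apply/cvgrPdist_le => e e0.
  have : \forall h \near (g : subspace G), forall i,
      `|pi0 g (f i) - pi0 h (f i)| <= e / (sdim k)%:R.
    apply: filter_forall => i.
    have /cvgrPdist_le := @rep_continuous _ _ _ _ _ _ pi0G (f i) g; apply; exact: divr_gt0.
  apply: filterS => h fe.
  have -> : e = (sdim k)%:R * (e / (sdim k)%:R) by rewrite mulrC divfK// gt_eqF.
  by apply: tensor_norm_le => i; rewrite !ffunE.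
Qed.

(* Main.v *)
(* By transitivity on the boundary, far edges of rays are good: [G] contains
   elements moving any geodesic through them to any other one; this propagates
   to all edges by compactness and makes each vertex stabilizer transitive on
   spheres and doubly transitive on neighbors.

   Let [b] be the real part of [B]. A vector orthogonal to the vectors fixed by
   the fixator of a half tree has [b v v >= 0], as otherwise pushing supports
   into the half tree yields infinitely many orthogonal negative translates.
   Property (P) extends this to the fixator of an edge, and 2-transitivity on
   neighbors to vertex stabilizers [K]: all the negativity of [b] is in [H^K].
   The averaged operators [T_g] on [H^K] are self-adjoint, since [K g K]
   contains [g^-1], and commute; as [b (T_g u) (T_g u) <= b u u], a Schur
   type argument on the extremal value shows that [T_g ^ 2], and then [T_g],
   is a real scalar. By irreducibility [H^K] is then a line, so that [p <= 1].

   If [p = 1], let [v] span [H^K]. Since the [T_g] are real scalars, the values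
   of [B] on the orbit of [v] are real, and the vectors whose pairing with this
   orbit is real form the wanted real subspace. Its coordinates are bounded
   because, by Baire's theorem, the norm of [H] is dominated by the norm
   deduced from [B]. *)
Require Import Defs.
From HB Require Import structures.
From mathcomp Require Import all_boot all_order all_algebra.
From mathcomp Require Import all_classical all_reals all_analysis.
From mathcomp Require Import complex ring lra zify.

Set Implicit Arguments.
Unset Strict Implicit.
Unset Printing Implicit Defensive.

Import Order.TTheory GRing.Theory Num.Theory.
Import numFieldNormedType.Exports.

Local Open Scope classical_set_scope.
Local Open Scope ring_scope.

(** * Trees, rays and the action of [G] *)

(** The form is indefinite and the operators [pi g] need not be isometric for the norm of [H], so
    neither orthogonal complements nor the spectral theorem apply directly. What survives is
    averaging over compact subgroups: it yields [b]-self-adjoint projections onto the fixed vectors,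
    along which [b] splits as in Pythagoras' theorem. Finite index enters twice: infinitely many
    orthogonal negative translates cannot exist, and a maximal negative family can be moved into any
    dense subspace, where finitely many estimates control all the negativity. As K may be
    noncommutative, most arguments run over the reals with [b], and [B] is recovered from the values
    of [b] on multiples by the basis of K. *)

Section Geodesics.
Variable T : tree.
Implicit Types (x y a b c d w : T) (s t p q : seq T).

Definition geod s := sorted (@adj T) s && uniq s.

Lemma adjC x y : adj x y = adj y x. Proof. exact: adj_sym. Qed.

Lemma adj_neq x y : adj x y -> x != y.
Proof. by apply: contraTneq => ->; rewrite adj_irr. Qed.

Lemma geod_catl s t : geod (s ++ t) -> geod s.
Proof.
by move=> /andP[st]; rewrite cat_uniq => /andP[us _]; rewrite /geod (cat_sorted2 st).1.
Qed.

Lemma geod_catr s t : geod (s ++ t) -> geod t.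
Proof.
move=> /andP[st]; rewrite cat_uniq => /and3P[_ _ ut].
by rewrite /geod (cat_sorted2 st).2.
Qed.

Lemma geod_rev s : geod (rev s) = geod s.
Proof.
rewrite /geod rev_uniq rev_sorted; congr andb.
by apply: eq_sorted => x y; exact: adjC.
Qed.

Lemma geod_map (g : aut T) s : geod (map g s) = geod s.
Proof.
rewrite /geod map_inj_uniq; last exact: can_inj (aut_funK g).
by rewrite sorted_map; congr andb; apply: eq_sorted => x y /=; rewrite aut_adj.
Qed.

Lemma geod1 x : geod [:: x]. Proof. by []. Qed.

Lemma geod2 x y : geod [:: x; y] = adj x y.
Proof.
rewrite /geod /= inE !andbT andb_idr//; exact: adj_neq.
Qed.

(** In a tree, not backtracking suffices: were [w] already in [s], the portion from [w] to [b]
    closed by the edge [b w] would be a circuit of length at least 3. *)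
Lemma geod_extend s a b w : geod (s ++ [:: a; b]) -> adj b w -> w != a ->
  geod (s ++ [:: a; b; w]).
Proof.
move=> /andP[ss us] bw wa.
have sw : sorted (@adj T) ((s ++ [:: a; b]) ++ [:: w]).
  rewrite -catA /= sorted_cat_cons /= bw.
  by move: ss; rewrite sorted_cat_cons /= => /andP[-> /andP[->]].
rewrite /geod -[[:: a; b; w]]/([:: a; b] ++ [:: w]) catA sw cats1 rcons_uniq us andbT.
rewrite mem_cat !inE !negb_or wa (eq_sym w) (adj_neq bw) !andbT.
apply/negP => /splitPr s12; case: s12 ss us sw => s1 s2 ss us sw.
have uc : uniq (w :: s2 ++ [:: a; b]).
  by move: us; rewrite -catA cat_uniq => /and3P[].
have : ucycle (@adj T) (w :: s2 ++ [:: a; b]).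
  rewrite /ucycle uc andbT.
  by move: sw; rewrite -!catA => /cat_sorted2[_] /=; rewrite -!cats1 -!catA.
by move=> /tree_acyclic; rewrite /= size_cat /= addn2.
Qed.

(** A common edge rules out backtracking at the junction, so [geod_extend] applies once for each
    vertex of [t]. *)
Lemma geod_glue_edge s a b t : geod (s ++ [:: a; b]) -> geod [:: a, b & t] ->
  geod (s ++ [:: a, b & t]).
Proof.
elim: t s a b => [//|w t IH] s a b sab abt.
rewrite -[[:: a, b, w & t]]/([:: a] ++ [:: b, w & t]) catA; apply: IH.
  rewrite -catA; apply: geod_extend => //.
    by move: abt => /andP[/= /and3P[]].
  by rewrite eq_sym; move: abt => /andP[_ /=]; rewrite !inE !negb_or => /andP[/and3P[_ ->]].
exact: (@geod_catr [:: a]).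
Qed.

Lemma geod_glue s u a w t : geod (s ++ [:: u; a]) -> geod [:: a, w & t] -> u != w ->
  geod (s ++ [:: u, a, w & t]).
Proof.
move=> sua awt uw.
have aw : adj a w by move: awt => /andP[/andP[]].
have := @geod_glue_edge (s ++ [:: u]) a w t; rewrite -!catA /=; apply => //.
by apply: geod_extend; rewrite // eq_sym.
Qed.

(** Where the two geodesics first diverge, the reversal of one glued to the other would be a
    geodesic visiting the common end twice. *)
Lemma geod_unique x p q : geod (x :: p) -> geod (x :: q) ->
  last x p = last x q -> p = q.
Proof.
elim: p x q => [|z p IH] x [|w q] //=.
- move=> _ /andP[_] /andP[+ _] xq.
  by rewrite xq -[last w q]/(last w q) mem_last.
- move=> /andP[_] /andP[+ _] _ xq.
  by rewrite -xq mem_last.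
move=> xp xq e.
have [zw|zw] := eqVneq z w.
  rewrite -zw in xq e *; congr cons; apply: (IH z) => //.
    exact: (@geod_catr [:: x]).
  exact: (@geod_catr [:: x]).
have : geod (rev p ++ [:: z, x, w & q]).
  apply: geod_glue => //; rewrite -geod_rev rev_cat revK //.
move=> /andP[_]; rewrite -[[:: z, x, w & q]]/([:: z] ++ [:: x] ++ (w :: q)).
rewrite catA cats1 -rev_cons cat_uniq => /and3P[_ /hasPn h _].
have := h (last w q); rewrite mem_rev -{2}e mem_last inE mem_last orbT => /(_ isT).
by [].
Qed.

Lemma geod_exists x y : exists2 p, geod (x :: p) & last x p = y.
Proof.
have [p xp <-] := tree_connected x y.
by have [p' xp' up' _] := shortenP xp; exists p' => //; apply/andP.
Qed.

End Geodesics.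

(** * Extension of geodesics to rays, and compactness *)

Section Rays.
Variable T : tree.
Hypothesis T_degree : forall x : T, (`I_3 #<= neighbors x)%card.
Implicit Types (x y a b c d w : T) (s t p q : seq T).

Lemma third_neighbor x a b : exists w, [/\ adj x w, w != a & w != b].
Proof.
have /card_leP[f] := T_degree x.
pose e i (i3 : (i < 3)%N) : set_type `I_3 := exist _ i (mem_set i3).
pose f' i := if pselect (i < 3)%N is left i3 then val (f (e i i3)) else x.
have fN i : (i < 3)%N -> adj x (f' i).
  by move=> i3; rewrite /f'; case: pselect => // ?; exact: (set_valP (f (e i _))).
have fI i j : (i < 3)%N -> (j < 3)%N -> f' i = f' j -> i = j.
  move=> i3 j3; rewrite /f'; case: pselect => // i3'; case: pselect => // j3'.
  by move=> /val_inj /(@inj _ _ _ f) => /(_ (mem_set I) (mem_set I)) [].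
move: f' fN fI => {}f fN fI.
pose ok i := (f i != a) && (f i != b).
suff [i i3 /andP[ia ib]] : exists2 i, (i < 3)%N & ok i.
  by exists (f i); split => //; exact: fN.
have ne i j : (i < 3)%N -> (j < 3)%N -> i != j -> f i != f j.
  by move=> i3 j3; apply: contra_neq; exact: fI.
have [f01 f02 f12] : [/\ f 0%N != f 1%N, f 0%N != f 2%N & f 1%N != f 2%N].
  by split; exact: ne.
have [/orP h0|] := boolP ((f 0%N == a) || (f 0%N == b)); last first.
  by rewrite negb_or => ?; exists 0%N.
have [/orP h1|] := boolP ((f 1%N == a) || (f 1%N == b)); last first.
  by rewrite negb_or => ?; exists 1%N.
exists 2%N => //; rewrite /ok.
by move: h0 h1 f01 f02 f12 => [] /eqP-> [] /eqP->; rewrite ?eqxx// => _ ++;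
  rewrite ![_ == f 2%N]eq_sym => -> ->.
Qed.

Lemma geod_longer x p : geod (x :: p) -> exists w, geod (x :: rcons p w).
Proof.
case/lastP: p => [_|p b]; first by have [w [xw _ _]] := third_neighbor x x x; exists w; rewrite geod2.
case/lastP: p => [|p a].
  have [w [bw wx _]] := third_neighbor b x x => xb; exists w.
  exact: (@geod_extend _ [::]).
have [w [bw wx _]] := third_neighbor b a a => xb; exists w.
move: xb; rewrite -!cats1 -!catA /= -!cat_cons => xb; exact: geod_extend.
Qed.

Lemma geod_long x p n : geod (x :: p) -> exists2 q, geod (x :: p ++ q) & size q = n.
Proof.
move=> xp; elim: n => [|n [q xq <-]]; first by exists [::]; rewrite ?cats0.
have [w xw] := geod_longer xq; exists (rcons q w); rewrite ?size_rcons//.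
by rewrite -rcons_cat.
Qed.

Lemma ray_geod (r : nat -> T) n : is_ray r -> geod (mkseq r n).
Proof.
move=> [ri ra]; apply/andP; split; last by rewrite mkseq_uniq.
apply/(sortedP (r 0%N)) => i; rewrite size_mkseq => im.
by rewrite !nth_mkseq//; exact: ltnW.
Qed.

Lemma geod_ray (r : nat -> T) : (forall n, geod (mkseq r n)) -> is_ray r.
Proof.
move=> rg; split => [i j ij|n].
  have /andP[_] := rg (maxn i j).+1.
  move=> /(nth_uniq (r 0%N)) => /(_ i j); rewrite size_mkseq !ltnS leq_maxl leq_maxr.
  by rewrite !nth_mkseq ?ltnS ?leq_maxl ?leq_maxr// ij eqxx => /(_ isT isT)/esym/eqP.
have /andP[/(sortedP (r 0%N)) + _] := rg n.+2.
by move=> /(_ n); rewrite size_mkseq !nth_mkseq//; exact.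
Qed.

Lemma ray_of_chain x p0 (P : nat -> seq T -> Prop) : geod (x :: p0) ->
  (forall n p, geod (x :: p) -> exists2 q, geod (x :: p ++ q) & P n (p ++ q)) ->
  exists r, [/\ is_ray r, (forall i, (i <= size p0)%N -> r i = nth x (x :: p0) i) &
    forall n, exists p m, mkseq r m.+1 = x :: p /\ P n p].
Proof.
move=> xp0 step.
have {}step (np : nat * seq T) : exists pw : seq T * T, geod (x :: np.2) ->
    geod (x :: rcons (np.2 ++ pw.1) pw.2) /\ P np.1 (np.2 ++ pw.1).
  have [xp|nxp] := pselect (geod (x :: np.2)); last by exists ([::], x).
  have [q xq Pq] := step np.1 _ xp.
  by have [w xw] := geod_longer xq; exists (q, w).
have [f fP] := choice step.
(* The additional vertex makes every stage strictly longer, so that the [i]-th vertex of the ray is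
   settled at stage [i]. *)
pose fix c n := if n is m.+1 then rcons (c m ++ (f (m, c m)).1) (f (m, c m)).2 else p0.
have cg n : geod (x :: c n) by elim: n => //= n IH; exact: (fP (n, c n) IH).1.
have cS n : exists2 t, c n.+1 = c n ++ t & (0 < size t)%N.
  by exists (rcons (f (n, c n)).1 (f (n, c n)).2); rewrite ?size_rcons//= rcons_cat.
have cm n m : exists t, c (n + m)%N = c n ++ t.
  elim: m => [|m [t IH]]; first by exists [::]; rewrite addn0 cats0.
  by rewrite addnS; have [t' -> _] := cS (n + m)%N; rewrite IH; exists (t ++ t'); rewrite catA.
have cn n : (n <= size (c n))%N.
  elim: n => // n IH; have [t -> t0] := cS n; rewrite size_cat.
  by rewrite -addn1; exact: leq_add.
pose r i := nth x (x :: c i) i.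
have rE n i : (i <= size (c n))%N -> r i = nth x (x :: c n) i.
  move=> inn; rewrite /r; have [ilen|/ltnW nlei] := leqP i n.
    have [t] := cm i (n - i)%N; rewrite subnKC// => ->.
    by rewrite -cat_cons nth_cat /= ltnS cn.
  have [t] := cm n (i - n)%N; rewrite subnKC// => ->.
  by rewrite -cat_cons nth_cat /= ltnS inn.
have rpre n m : (m <= size (c n))%N -> mkseq r m.+1 = x :: take m (c n).
  move=> mn; apply: (@eq_from_nth _ x); rewrite size_mkseq /= ?size_takel//.
  move=> i im; rewrite nth_mkseq// (rE n); last exact: leq_trans mn.
  by case: i im => //= i im; rewrite nth_take.
exists r; split.
- apply: geod_ray => -[//|m]; rewrite (rpre m)//.
  have := cg m; rewrite -{1}(cat_take_drop m (c m)) -cat_cons; exact: geod_catl.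
- by move=> i; exact: (rE 0%N).
- move=> n; set p := c n ++ (f (n, c n)).1; exists p, (size p).
  split; last exact: (fP (n, c n) (cg n)).2.
  rewrite (rpre n.+1); last by rewrite /= size_rcons.
  by rewrite /= -cats1 take_size_cat.
Qed.

Lemma ray_extends x p : geod (x :: p) -> exists2 r, is_ray r &
  (forall i, (i <= size p)%N -> r i = nth x (x :: p) i).
Proof.
move=> xp; have [|r [? ? _]] := @ray_of_chain x p (fun=> xpredT) xp.
  by move=> _ q xq; exists [::]; rewrite ?cats0.
by exists r.
Qed.

Hypothesis T_lf : locally_finite T.

Lemma konig x (Q : seq T -> Prop) : (forall p q, Q (p ++ q) -> Q p) ->
  (forall p, Q p -> geod (x :: p)) -> (forall n, exists2 p, Q p & (n <= size p)%N) ->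
  exists r, [/\ is_ray r, r 0%N = x & forall n, exists2 p, mkseq r n.+1 = x :: p & Q p].
Proof.
move=> Qpre Qg Qlong.
(* This is the property kept along the construction: as [last x p] has finitely many neighbors, one
   of them inherits it. *)
pose E p := forall n, exists2 q, Q (p ++ q) & (n <= size q)%N.
have step p : exists w, E p -> E (rcons p w).
  have [Ep|] := pselect (E p); last by exists x.
  apply: contrapT => noE.
  have {}noE w : exists n, forall q, (n <= size q)%N -> ~ Q (rcons p w ++ q).
    apply: contrapT => nw; apply: noE; exists w => _ n.
    apply: contrapT => nq; apply: nw; exists n => q nlq Qq; apply: nq.
    by exists q.
  have [f fP] := choice noE.
  have /finite_seqP[s sE] := T_lf (last x p).
  have [[//|w q] Qq qs] := Ep (\max_(w <- s) f w).+1.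
  apply: (fP w q); last by rewrite cat_rcons.
  rewrite /= ltnS in qs; apply: leq_trans qs; apply: leq_bigmax_seq => //.
  have : neighbors (last x p) w.
    have /andP[+ _] := Qg _ Qq.
    by rewrite /= cat_path /= => /and3P[].
  by rewrite sE.
have [f fP] := choice step.
pose fix c n := if n is m.+1 then rcons (c m) (f (c m)) else [::].
have cE n : E (c n) by elim: n => [|n IH] /=; [exact: Qlong|exact: fP].
pose r i := if i is j.+1 then f (c j) else x.
have rc n : mkseq r n.+1 = x :: c n.
  by elim: n => // n IH; rewrite mkseqS IH.
have cQ n : Q (c n) by have [q /Qpre] := cE n 0%N.
exists r; split => //; last by move=> n; exists (c n).
by apply: geod_ray => -[//|n]; rewrite rc; exact: Qg.
Qed.

End Rays.

(** * Good edges: from boundary transitivity to transitivity on geodesics *)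

Section GoodEdges.
Variable T : tree.
Hypothesis T_degree : forall x : T, (`I_3 #<= neighbors x)%card.
Hypothesis T_lf : locally_finite T.
Variable G : set (aut T).
Hypothesis G_subgroup : subgroup G.
Hypothesis G_transitive : boundary_transitive G.
Implicit Types (x y a b c d w : T) (s t p q : seq T) (g h : aut T).

Lemma autM g h x : (g * h)%g x = g (h x). Proof. by []. Qed.
Lemma autVK g : cancel g (g^-1)%g. Proof. exact: aut_funK. Qed.
Lemma autKV g : cancel (g^-1)%g g. Proof. exact: aut_invK. Qed.
Lemma G1 : G 1%g. Proof. by have [] := G_subgroup. Qed.
Lemma GM g h : G g -> G h -> G (g * h)%g. Proof. by have [_ + _] := G_subgroup; exact. Qed.
Lemma GV g : G g -> G (g^-1)%g. Proof. by have [_ _] := G_subgroup; exact. Qed.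

(** Orientation matters: this is transitivity of the fixator of the edge on the geodesics of each
    length that leave through [b]. It propagates forward along geodesics only, hence the separate
    treatment of reversed edges below. *)
Definition good a b := forall p q, geod [:: a, b & p] -> geod [:: a, b & q] ->
  size p = size q -> exists2 g, G g & map g [:: a, b & p] = [:: a, b & q].

(** Both geodesics are prolonged backwards by the common one from [a] to [c]; the element found has
    to fix this common part. *)
Lemma good_forward a b s u c d : good a b -> geod (u ++ [:: c; d]) ->
  u ++ [:: c; d] = [:: a, b & s] -> good c d.
Proof.
move=> gab ug uE p q cp cq pq.
have E t : u ++ [:: c, d & t] = [:: a, b & s ++ t].
  by rewrite -[[:: c, d & t]]/([:: c; d] ++ t) catA uE.
have [||//|g Gg] := gab (s ++ p) (s ++ q); rewrite -?E ?size_cat ?pq//.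
- exact: geod_glue_edge.
- exact: geod_glue_edge.
rewrite map_cat => /eqP; rewrite eqseq_cat ?size_map// => /andP[_ /eqP ?].
by exists g.
Qed.

Lemma good_nth x0 s i j : geod s -> (i <= j)%N -> (j.+1 < size s)%N ->
  good (nth x0 s i) (nth x0 s i.+1) -> good (nth x0 s j) (nth x0 s j.+1).
Proof.
move=> sg ij js; have [k {ij}jE] : exists k, j = (i + k)%N by exists (j - i)%N; lia.
have : geod (drop i s) by move: sg; rewrite -{1}(cat_take_drop i s) => /geod_catr.
have st : size (drop i s) = (size s - i)%N by rewrite size_drop.
have n0 : nth x0 s i = nth x0 (drop i s) 0 by rewrite nth_drop addn0.
have n1 : nth x0 s i.+1 = nth x0 (drop i s) 1 by rewrite nth_drop addn1.
rewrite jE -addnS n0 n1 -!nth_drop; move: n0 n1 => _ _.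
case: (drop i s) st => [|a [|b t]] /= st tg; [lia..|].
have tk : (k <= size t)%N by lia.
move=> gab; apply: (@good_forward a b (take k t) (take k [:: a, b & t])) => //.
- have -> : take k [:: a, b & t] ++ [:: nth x0 [:: a, b & t] k; nth x0 (b :: t) k] =
      take k.+2 [:: a, b & t].
    rewrite (take_nth x0) ?(take_nth x0 (n := k)) //=; first by rewrite -!cats1 -catA.
    by lia.
  by apply: (@geod_catl _ _ (drop k.+2 [:: a, b & t])); rewrite cat_take_drop.
- have : [:: a, b & take k t] = take k.+2 [:: a, b & t] by [].
  by move=> ->; rewrite (take_nth x0) ?(take_nth x0 (n := k)) //=; [rewrite -!cats1 -catA|lia].
Qed.

Lemma good_aut a b g : G g -> good a b -> good (g a) (g b).
Proof.
move=> Gg gab p q ap aq pq.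
have E t : map (g^-1)%g [:: g a, g b & t] = [:: a, b & map (g^-1)%g t].
  by rewrite /= !aut_funK.
have [|||h Gh hE] := gab (map (g^-1)%g p) (map (g^-1)%g q).
- by rewrite -E geod_map.
- by rewrite -E geod_map.
- by rewrite !size_map.
exists (g * h * g^-1)%g; first by apply: GM; [exact: GM|exact: GV].
have -> : map (g * h * g^-1)%g [:: g a, g b & p] =
    map g (map h (map (g^-1)%g [:: g a, g b & p])) by rewrite -!map_comp.
by rewrite E hE -E -map_comp (eq_map (g:=id)) ?map_id// => x /=; rewrite aut_invK.
Qed.

Lemma ray_transfer (u v : nat -> T) : is_ray u -> is_ray v ->
  exists2 g, G g & exists n0, forall n, (n0 <= n)%N -> exists m,
    forall j, g (u (m + j)%N) = v (n + j)%N.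
Proof.
move=> ur vr; have [g Gg [t [n1 _ n1P]]] := G_transitive ur vr.
exists g => //; exists (n1 + 2 * `|t|)%N => n n0n.
pose m := `|(n%:Z - t)%R|%N; exists m => j.
have := n1P (m + j)%N; rewrite /= => ->; last by rewrite /m; lia.
by congr v; rewrite /m; lia.
Qed.

(** Baire argument on the boundary. Call [p] compatible with [(N, M)] when an element of [G] carries
    [w] from index [N] on to [p] from index [M] on. If every [p] had an incompatible extension for
    every pair, some ray would not be a translate of the end of [w]. So for some pair and some [p]
    all extensions are compatible; two of them through the same far edge are images of the same
    piece of [w], hence of each other. *)
Lemma exists_good : exists a b, adj a b /\ good a b.
Proof.
have [x] := tree_nonempty T.
have [w wr w0] := ray_extends T_degree (geod1 x).
pose compat N M p := exists2 g, G g &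
  forall j, (M + j <= size p)%N -> g (w (N + j)%N) = nth x (x :: p) (M + j).
apply: contrapT => nogood.
(* [unpickle] runs through all pairs of indices, so one ray defeats them all; the default value
   merely repeats a pair. *)
have [n p xp|r [rr _ rP]] := @ray_of_chain _ T_degree x [::]
  (fun n p => let NM := odflt (0, 0)%N (unpickle n) in ~ compat NM.1 NM.2 p)
  (geod1 x); last first.
  have [g Gg [n0 n0P]] := ray_transfer wr rr.
  have [m mP] := n0P _ (leqnn n0).
  have [p [k [kE]]] := rP (pickle (m, n0)); rewrite pickleK /=; apply.
  exists g => // j jp; rewrite mP -kE nth_mkseq//.
  by rewrite -[k.+1](size_mkseq r) kE.
case: (odflt _ _) => N M /=.
apply: contrapT => allc.
have {}allc q : geod (x :: p ++ q) -> compat N M (p ++ q).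
  by move=> xq; apply: contrapT => nc; apply: allc; exists q.
(* The length [M + 2] puts [c] and [d] past index [M], in the portion of the geodesic that comes
   from [w]. *)
have [q xq qs] := geod_long T_degree (M + 2) xp.
have : (1 < size q)%N by lia.
case/lastP: q qs xq => // q d; case/lastP: q => // q c.
rewrite -!cats1 -!catA /= => qs xq _; apply: nogood; exists c, d.
rewrite -cat_cons catA in xq.
have cg s1 : geod [:: c, d & s1] ->
    exists2 g, G g & forall j, (M + j <= size (p ++ q ++ [:: c, d & s1]))%N ->
      g (w (N + j)%N) = nth x ((x :: p ++ q) ++ [:: c, d & s1]) (M + j).
  move=> cs; have [|g Gg gP] := allc (q ++ [:: c, d & s1]).
    by rewrite catA -cat_cons; exact: geod_glue_edge.
  by exists g => // j jM; rewrite gP// catA.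
split; first by have := geod_catr xq; rewrite geod2.
move=> s1 s2 cs1 cs2 s12.
have [g1 Gg1 g1P] := cg s1 cs1; have [g2 Gg2 g2P] := cg s2 cs2.
exists (g2 * g1^-1)%g; first by apply: GM => //; exact: GV.
apply: (@eq_from_nth _ x); rewrite size_map; first by rewrite /= s12.
move=> i i2.
set L := size (x :: p ++ q).
have LM : (M <= L)%N by rewrite /L /= size_cat; move: qs; rewrite size_cat /=; lia.
have e t : nth x [:: c, d & t] i = nth x ((x :: p ++ q) ++ [:: c, d & t]) (M + (L - M + i)).
  rewrite addnA subnKC// nth_cat -/L ltnNge leq_addr /= addKn //.
rewrite (nth_map x)// autM !e -g1P; last by move: LM i2; rewrite /L /= !size_cat /=; lia.
rewrite autVK g2P//; move: LM i2; rewrite /L /= !size_cat /=; lia.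
Qed.

Lemma eventually_good (r : nat -> T) : is_ray r ->
  exists n0, forall n, (n0 <= n)%N -> good (r n) (r n.+1).
Proof.
move=> rr; have [a [b [ab gab]]] := exists_good.
have [w wr wE] : exists2 w, is_ray w & (forall i, (i <= 1)%N -> w i = nth a [:: a; b] i).
  by apply: (@ray_extends _ T_degree a [:: b]); rewrite geod2.
have gw n : good (w n) (w n.+1).
  have := @good_nth a (mkseq w n.+2) 0 n (ray_geod _ wr) (leq0n n).
  rewrite size_mkseq => /(_ (ltnSn _)); rewrite !nth_mkseq//; apply.
  by rewrite (wE 0%N)// (wE 1%N).
have [g Gg [n0 n0P]] := ray_transfer wr rr.
exists n0 => n /n0P[m mP].
have := mP 0%N; rewrite !addn0 => <-; have := mP 1%N; rewrite !addn1 => <-.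
exact: good_aut.
Qed.

(** On a ray [w] starting with [d], [c], a good reversed edge would propagate towards the origin of
    [w] and make [c d] good; so they are all bad, and [G] transfers this to any ray. *)
Lemma eventually_bad_back c d (r : nat -> T) : adj c d -> ~ good c d -> is_ray r ->
  exists n0, forall n, (n0 <= n)%N -> ~ good (r n.+1) (r n).
Proof.
move=> cd bad rr.
have [w wr wE] : exists2 w, is_ray w & (forall i, (i <= 1)%N -> w i = nth d [:: d; c] i).
  by apply: (@ray_extends _ T_degree d [:: c]); rewrite geod2 adjC.
have bw n : ~ good (w n.+1) (w n).
  move=> gn; apply: bad.
  have := @good_nth d (rev (mkseq w n.+2)) 0 n.
  rewrite geod_rev size_rev size_mkseq => /(_ (ray_geod _ wr) (leq0n n) (ltnSn _)).
  have e i : (i < n.+2)%N -> nth d (rev (mkseq w n.+2)) i = w (n.+1 - i)%N.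
    by move=> i2; rewrite nth_rev ?size_mkseq// nth_mkseq ?subSS//; lia.
  by rewrite !e// subn0 subSS subn0 subnn subSnn (wE 0%N)// (wE 1%N)//; apply.
have [g' Gg' [n1 n1P]] := ray_transfer wr rr.
exists n1 => n /n1P[m mP] gr; apply: (bw m).
have := good_aut (GV Gg') gr.
have := mP 0%N; rewrite !addn0 => <-; have := mP 1%N; rewrite !addn1 => <-.
by rewrite !autVK.
Qed.

Hypothesis G_unbounded : forall x n, exists g p,
  [/\ G g, geod (x :: p), last x p = g x & (n <= size p)%N].

(** A bad edge makes far reversed edges of every ray bad. Following a geodesic from [x] to [g x]
    backwards and translating by [g^-1] turns them into forward edges seen from [x], which gives
    arbitrarily long bad geodesics and, by compactness, a bad ray; but rays are eventually good. *)
Lemma all_good c d : adj c d -> good c d.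
Proof.
move=> cd; apply: contrapT => bad.
have [x] := tree_nonempty T.
(* Orbits are unbounded, so there is a ray all of whose initial segments lie on geodesics from [x]
   to translates of [x]. *)
have [|||r [rr r0 rQ]] := @konig _ T_lf x
  (fun p => exists g q, [/\ G g, geod (x :: p ++ q) & last x (p ++ q) = g x]).
- by move=> p q [g [s [Gg xs gx]]]; exists g, (q ++ s); rewrite catA.
- move=> p [g [q [_ + _]]]; rewrite -cat_cons; exact: geod_catl.
- move=> n; have [g [p [Gg xp px np]]] := G_unbounded x n.
  by exists p => //; exists g, [::]; rewrite cats0.
have [n0 /(_ _ (leqnn n0)) bn0] := eventually_bad_back cd bad rr.
have [|||r' [rr' r'0 r'Q]] := @konig _ T_lf x (fun p => geod (x :: p) /\
   forall i, (i < size p)%N -> ~ good (nth x (x :: p) i) (nth x p i)).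
- move=> p q [xpq pq]; split; first by move: xpq; rewrite -cat_cons; exact: geod_catl.
  move=> i ip; have := pq i; rewrite size_cat -cat_cons !nth_cat /= ltnS ip (ltnW ip).
  by apply; rewrite ltn_addr.
- by move=> p [].
- move=> n; have [p rp [g [q [Gg xq gx]]]] := rQ (n0 + n.+2)%N.
  have ps : size p = (n0 + n.+2)%N.
    by have := congr1 size rp; rewrite size_mkseq /= => -[].
  have rE i : (i <= size p)%N -> r i = nth x (x :: p) i.
    by move=> ip; rewrite -rp nth_mkseq// ltnS -ps.
  (* the geodesic from [x] to [g x], seen from [g x] *)
  pose s := map (g^-1)%g (rev (x :: p ++ q)).
  have sg : geod s by rewrite /s geod_map geod_rev.
  have sE : s = x :: behead s.
    rewrite /s; case/lastP: (p ++ q) gx => [/= gx|l y].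
      by congr cons; rewrite {1}gx aut_funK.
    by rewrite last_rcons -rcons_cons rev_rcons /= => ->; rewrite aut_funK.
  have ss : size s = (n0 + n + size q).+3.
    by rewrite size_map size_rev /= size_cat ps; lia.
  have e j : (j <= size p)%N -> nth x s (size s - j.+1) = (g^-1)%g (r j).
    move=> jp; rewrite /s (nth_map x) ?size_rev /= ?size_cat; last by rewrite size_map size_rev /= size_cat; lia.
    rewrite nth_rev /= ?size_cat; last by rewrite size_map size_rev /= size_cat; lia.
    rewrite size_map size_rev /= size_cat.
    have -> : ((size p + size q).+1 - ((size p + size q).+1 - j.+1).+1)%N = j by lia.
    by rewrite rE// -cat_cons nth_cat /= ltnS jp.
  (* A good edge early on [s] would propagate to the translate by [g^-1] of the reversed edge of [r]
     at index [n0]. *)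
  have bs i : (i <= n + size q)%N -> ~ good (nth x s i) (nth x s i.+1).
    move=> iN gi; apply: bn0.
    have := @good_nth x s i (n + size q).+1 sg (leqW iN).
    have -> : (n + size q).+1 = (size s - n0.+2)%N by lia.
    have -> : (size s - n0.+2).+1 = (size s - n0.+1)%N by lia.
    rewrite !e ?ps; [|lia..].
    move=> /(_ _ gi)/(good_aut Gg); rewrite !autKV; apply.
    by lia.
  have sz : size (take n (behead s)) = n by rewrite size_takel// size_behead; lia.
  exists (take n (behead s)); last by rewrite sz.
  split.
    by move: sg; rewrite {1}sE -{1}(cat_take_drop n (behead s)) -cat_cons => /geod_catl.
  rewrite sz => i iN; have := bs i (leq_trans (ltnW iN) (leq_addr _ _)).
  rewrite {1 2}sE nth_take//= => + gi; apply; move: gi.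
  case: i iN => //= i iN; rewrite nth_take//; exact: ltnW.
have [m mP] := eventually_good rr'.
have [p pE [_ bp]] := r'Q m.+1.
have ps : size p = m.+1 by have := congr1 size pE; rewrite size_mkseq /= => -[].
apply: (bp m); rewrite ?ps//; have := mP m (leqnn m).
rewrite -pE nth_mkseq//.
suff -> : nth x p m = r' m.+1 by [].
by rewrite -[nth x p m]/(nth x (x :: p) m.+1) -pE nth_mkseq.
Qed.

End GoodEdges.

(** * The topology of the automorphism group *)

Lemma within_subspace (X : topologicalType) (A P : set X) (a : X) :
  A a -> nbhs (a : subspace A) P -> within A (nbhs a) P.
Proof. by move=> Aa; rewrite (nbhs_subspace_in Aa). Qed.

Lemma nbhs_subspaceI (X : topologicalType) (A P : set X) (a : X) :
  (A a -> within A (nbhs a) P) -> (~ A a -> P a) -> nbhs (a : subspace A) P.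
Proof.
move=> inA outA; have [Aa|nAa] := pselect (A a).
  by have := inA Aa; rewrite (nbhs_subspace_in Aa).
have : globally [set a] P by move=> _ ->; exact: outA.
by rewrite (nbhs_subspace_out nAa).
Qed.

Section AutTopology.
Variable T : tree.
Implicit Types (x y z : T) (s t p q : seq T) (g h : aut T).

Definition agree s g : set (aut T) := [set h : aut T | {in s, forall z, h z = g z}].

Lemma agree_nbhs s g : nbhs g (agree s g).
Proof.
elim: s => [|z s IH]; first by apply: filterS filterT => h _ z; rewrite inE.
have : nbhs g [set h | h z = g z].
  have cz : continuous (fun h : aut T => (h z : discrete_topology T)).
    move=> h; apply: (@continuous_comp _ _ _ (fun h : aut T =>
      ((h : T -> T) : {ptws T -> discrete_topology T}))
      (fun f : {ptws T -> discrete_topology T} => f z)).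
      exact: initial_continuous.
    exact: proj_continuous.
  exact: (cz g [set g z] (discrete_set1 _)).
move=> zg; apply: filterS2 zg IH => h /= hz hs y; rewrite inE => /orP[/eqP->//|].
exact: hs.
Qed.

(** Agreement with [g] on finite lists is a base at [g]: the filter it generates converges to [g] in
    each coordinate, hence in the product topology. *)
Lemma nbhs_agree g (U : set (aut T)) : nbhs g U -> exists s, agree s g `<=` U.
Proof.
move=> [_ [[B Bop <-] Bg] BU].
pose F : set_system (T -> T) := filter_from setT
  (fun s : seq T => [set f : T -> T | {in s, forall z, f z = g z}]).
have FF : Filter F.
  apply: filter_from_filter; first by exists [::].
  move=> s t _ _; exists (s ++ t) => // f fst; split => z zs; apply: fst;
    by rewrite mem_cat zs ?orbT.
have : F --> ((g : T -> T) : {ptws T -> discrete_topology T}).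
  apply/cvg_sup => z; apply/cvg_image.
    rewrite predeqE => y; split => // _; by exists (fun=> y).
  move=> A /(@nbhs_singleton (discrete_topology T)) Az.
  exists (fun f : T -> T => A (f z)).
    by exists [:: z] => // f /(_ z); rewrite inE eqxx => /(_ isT) /= ->.
  rewrite predeqE => y; split => [[f] Af <-//|Ay]; by exists (fun=> y).
move=> /(_ B (open_nbhs_nbhs (conj Bop Bg))) [s _ sB].
by exists s => h hs; apply: BU; exact: sB.
Qed.

Lemma ultra_pigeonhole (F : set_system (aut T)) (FU : UltraFilter F) s
    (f : aut T -> T) : F [set g | f g \in s] -> exists y, F [set g | f g = y].
Proof.
elim: s => [|y s IH] Fs; first by have [g] := filter_ex Fs; rewrite /= in_nil.
have [?|nFy] := in_ultra_setVsetC [set g | f g = y] FU; first by exists y.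
apply: IH; apply: filterS2 Fs nFy => g /=.
by rewrite inE => /orP[/eqP|].
Qed.

(** By the pigeonhole principle each [g z] is constant along an ultrafilter. The same for inverses
    makes the limit map bijective, hence an automorphism. *)
Lemma compact_finite_orbits (S : set (aut T)) : closed S ->
  (forall z, exists s, forall g, S g -> g z \in s) ->
  (forall z, exists s, forall g, S g -> (g^-1)%g z \in s) -> compact S.
Proof.
move=> Scl So SVo; rewrite compact_ultra => F FU FS.
have limz z : exists y, F [set g : aut T | g z = y].
  have [s sP] := So z; apply: (@ultra_pigeonhole F FU s (fun g => g z)).
  by apply: filterS FS => g /sP.
have limVz z : exists y, F [set g : aut T | (g^-1)%g z = y].
  have [s sP] := SVo z; apply: (@ultra_pigeonhole F FU s (fun g : aut T => (g^-1)%g z)).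
  by apply: filterS FS => g /sP.
have [f fP] := choice limz; have [f' f'P] := choice limVz.
have fK : cancel f f'.
  move=> z; have [g [/= gz gfz]] := filter_ex (filterI (fP z) (f'P (f z))).
  by rewrite -gfz -gz aut_funK.
have f'K : cancel f' f.
  move=> z; have [g [/= gz gfz]] := filter_ex (filterI (fP (f' z)) (f'P z)).
  by rewrite -gz -gfz aut_invK.
have fadj x y : adj (f x) (f y) = adj x y.
  have [g [/= <- <-]] := filter_ex (filterI (fP x) (fP y)).
  exact: aut_adj.
pose h := Aut fK f'K fadj.
have Fh : F --> h.
  move=> U /nbhs_agree[s sU]; apply: filterS sU _.
  elim: s => [|z s IH]; first by apply: filterS filterT => g _ z; rewrite inE.
  apply: filterS2 (fP z) IH => g /= gz gs y.
  by rewrite inE => /orP[/eqP->|/gs].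
exists h; split => //; apply: Scl => U /Fh FU'.
exact: filter_ex (filterI FS FU').
Qed.

Lemma closed_stabilizer (G : set (aut T)) x : closed G ->
  closed [set g | G g /\ g x = x].
Proof.
move=> Gcl g gcl; split.
  apply: Gcl => U Ug; have [h [[Gh _] Uh]] := gcl U Ug; by exists h.
have [h [[_ hx]]] := gcl _ (agree_nbhs [:: x] g).
by move=> /(_ x); rewrite inE eqxx => /(_ isT) <-.
Qed.

Hypothesis T_lf : locally_finite T.

Lemma finite_ball x n : exists s, forall p, path (@adj T) x p -> (size p <= n)%N ->
  last x p \in s.
Proof.
elim: n => [|n [s sP]]; first by exists [:: x] => -[|//]; rewrite inE.
have [f fP] : exists f : T -> seq T, forall y z, adj y z -> z \in f y.
  have : forall y, exists s, forall z, adj y z -> z \in s.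
    move=> y; have /finite_seqP[u uE] := T_lf y.
    by exists u => z yz; have : neighbors y z by []; rewrite uE.
  by move=> /choice[f fP]; exists f.
exists (x :: flatten (map f s)) => p; case/lastP: p => [_ _|p w]; first by rewrite inE eqxx.
rewrite rcons_path size_rcons last_rcons inE => /andP[xp pw] pn.
apply/orP; right; apply/flattenP; exists (f (last x p)); last exact: fP.
by apply: map_f; exact: sP.
Qed.

Lemma bounded_orbit_finite x n z : exists s, forall g,
  (exists2 p, path (@adj T) x p /\ last x p = g x & (size p <= n)%N) -> g z \in s.
Proof.
have [q xq qz] := tree_connected x z.
have [s sP] := finite_ball x (n + size q); exists s => g [p [xp pg] pn].
have -> : g z = last x (p ++ map g q) by rewrite last_cat pg last_map qz.
apply: sP; last by rewrite size_cat size_map leq_add2r.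
rewrite cat_path xp pg (map_path (b := pred0) (e' := @adj T)) //.
  by move=> y w _ /=; rewrite aut_adj.
by apply/hasPn.
Qed.

Lemma unbounded_orbit (G : set (aut T)) x n : subgroup G -> closed G -> ~ compact G ->
  exists g p, [/\ G g, geod (x :: p), last x p = g x & (n <= size p)%N].
Proof.
move=> [G1 GM GV] Gcl Gnc; apply: contrapT => bounded; apply: Gnc.
have b g : G g -> exists2 p, path (@adj T) x p /\ last x p = g x & (size p <= n)%N.
  move=> Gg; have [p xp pg] := geod_exists x (g x).
  exists p; first by split=> //; move: xp => /andP[].
  by rewrite leqNgt; apply/negP => /ltnW np; apply: bounded; exists g, p.
apply: compact_finite_orbits => // z; have [s sP] := bounded_orbit_finite x n z.
  by exists s => g /b; exact: sP.
by exists s => g /GV /b; exact: sP.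
Qed.

Lemma compact_stabilizer (G : set (aut T)) x : subgroup G -> closed G ->
  compact [set g | G g /\ g x = x].
Proof.
move=> [G1 GM GV] Gcl; apply: compact_finite_orbits; first exact: closed_stabilizer.
  move=> z; have [s sP] := bounded_orbit_finite x 0 z.
  by exists s => g [_ gx]; apply: sP; exists [::].
move=> z; have [s sP] := bounded_orbit_finite x 0 z.
by exists s => g [_ gx]; apply: sP; exists [::]; rewrite //= -{2}gx aut_funK.
Qed.

(** Counterexamples indexed by the finite lists, ordered by inclusion, would cluster at a point of
    the compact stabilizer and contradict continuity of [f] there. *)
Lemma stabilizer_uniform_continuity (R : realType) (V : normedModType R)
    (G : set (aut T)) x (f : aut T -> V) (e : R) :
  subgroup G -> closed G -> {within G, continuous f} -> 0 < e ->
  exists s, forall g h, G g -> G h -> g x = x -> h x = x -> {in s, forall z, g z = h z} ->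
    `|f g - f h| < e.
Proof.
move=> sG Gcl fc e0; apply: contrapT => nu.
have {}nu s : exists gh : aut T * aut T, [/\ G gh.1 /\ G gh.2, gh.1 x = x /\ gh.2 x = x,
    {in s, forall z, gh.1 z = gh.2 z} & e <= `|f gh.1 - f gh.2|].
  apply: contrapT => ns; apply: nu; exists s => g h Gg Gh gx hx gh.
  by rewrite ltNge; apply/negP => ?; apply: ns; exists (g, h).
have [c cP] := choice nu.
pose F : set_system (aut T) := filter_from setT
  (fun s : seq T => [set g | exists2 t, {subset s <= t} & g = (c t).1]).
have FF : ProperFilter F.
  apply: filter_from_proper => [|s _]; last by exists (c s).1, s.
  apply: filter_from_filter; first by exists [::].
  move=> s t _ _; exists (s ++ t) => // g [u stu gu].
  by split; exists u => // z zs; apply: stu; rewrite mem_cat zs ?orbT.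
have FK : F [set g | G g /\ g x = x].
  by exists [::] => // g [t _ ->]; have [[? _] [? _]] := cP t.
have [g [[Gg gx] gF]] := compact_stabilizer (x := x) sG Gcl FF FK.
have e2 : 0 < e / 2 by rewrite divr_gt0.
have [s sP] : exists s, forall h, G h -> agree s g h -> `|f g - f h| < e / 2.
  have gnear : within G (nbhs g) [set h | `|f g - f h| < e / 2].
    by apply: (within_subspace Gg); have /cvgrPdist_lt/(_ _ e2) := fc g.
  have [s sU] := nbhs_agree gnear; exists s => h Gh /sU /=; exact.
have Fs : F [set h | exists2 t, {subset s <= t} & h = (c t).1] by exists s.
have [_ [[t st ->] tg]] := gF _ _ Fs (agree_nbhs s g).
have [[G1 G2] _ c12] := cP t; apply/negP; rewrite -ltNge.
rewrite [e]splitr -(subrKA (f g)) (le_lt_trans (ler_normD _ _))// ltrD//.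
  by rewrite distrC; exact: sP.
by apply: sP => // z zs; rewrite -c12; [exact: tg|exact: st].
Qed.

End AutTopology.

(** * Half trees and transitivity of vertex stabilizers *)

Section HalfTrees.
Variable T : tree.
Implicit Types (x y a b c d w z : T) (s t p q : seq T) (g h : aut T).

Lemma autV_fix g x : g x = x -> (g^-1)%g x = x.
Proof. by move=> gx; rewrite -{1}gx autVK. Qed.

Lemma half_treel a b : half_tree a b a.
Proof. by left; exists [::]. Qed.

Lemma half_treer a b : half_tree a b b.
Proof. by right. Qed.

Lemma half_tree_aut g a b z : g a = a -> g b = b -> half_tree a b z -> half_tree a b (g z).
Proof.
move=> ga gb [[p ap <-]|->]; last by right.
left; exists (map g p); last by rewrite -[X in last X _]ga last_map.
rewrite -[X in path _ X _]ga path_map; apply: sub_path ap => x y /=.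
rewrite /adj_minus aut_adj -{3 4}ga -{3 4}gb.
by rewrite !(inj_eq (can_inj (aut_funK g))).
Qed.

Lemma path_avoid a b x p : path (@adj T) x p -> x != b -> b \notin p ->
  path (adj_minus a b) x p.
Proof.
elim: p x => //= y p IH x /andP[xy yp] xb.
rewrite inE negb_or eq_sym => /andP[yb bp].
by rewrite IH// andbT /adj_minus xy (negbTE xb) (negbTE yb) andbF.
Qed.

Variable G : set (aut T).
Hypothesis G_subgroup : subgroup G.
Hypothesis T_degree : forall x : T, (`I_3 #<= neighbors x)%card.
Hypothesis G_good : forall a b, adj a b -> good G a b.

(** As the degree is at least 3, some neighbor [w] of [x] avoids both first steps; prolonging both
    geodesics back to [w] makes goodness of [w x] apply. *)
Lemma sphere_transitive x p q : geod (x :: p) -> geod (x :: q) -> size p = size q ->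
  exists2 g, G g & g x = x /\ map g p = q.
Proof.
case: p q => [|y p] [|z q] //.
  by move=> _ _ _; exists 1%g => //; exact: G1.
move=> xp xq [pq]; have [w [xw wy wz]] := third_neighbor T_degree x y z.
have wx : adj w x by rewrite adjC.
have wg u r : geod [:: x, u & r] -> w != u -> geod [:: w, x, u & r].
  by move=> xr wu; apply: (@geod_glue _ [::]); rewrite //= geod2.
have [|||g Gg /= [gw gx gy gp]] := G_good wx (p := y :: p) (q := z :: q).
- exact: wg.
- exact: wg.
- by rewrite /= pq.
by exists g => //=; rewrite gy gp.
Qed.

(** The vertices [g x] and [(g^-1) x] are equidistant from [x], so some [k] fixing [x] sends the
    first to the second; then [g k g] fixes [x]. *)
Lemma inv_double_coset x g : G g -> exists k k', [/\ G k, G k', k x = x, k' x = x &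
  (g^-1 = k * g * k')%g].
Proof.
move=> Gg; have [p xp pg] := geod_exists x (g x).
have ip : geod (x :: map (g^-1)%g (behead (rev (x :: p)))).
  have : geod (map (g^-1)%g (rev (x :: p))) by rewrite geod_map geod_rev.
  case/lastP: p xp pg => [|p y] _; first by rewrite /= => gx; rewrite {1}gx aut_funK.
  by rewrite last_rcons -rcons_cons rev_rcons /= => ->; rewrite aut_funK.
have [|k Gk [kx kp]] := sphere_transitive xp ip.
  by rewrite size_map size_behead size_rev.
have kg : k (g x) = (g^-1)%g x.
  rewrite -pg -last_map kx kp.
  case/lastP: p {xp ip kp} pg => [/= gx|p y _]; first by rewrite [in RHS]gx aut_funK.
  by rewrite -rcons_cons rev_rcons rev_cons /= map_rcons last_rcons.
have Gk' : G (g * k * g)%g by do 2!apply: GM => //.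
exists k, ((g * k * g)^-1)%g; split => //.
- exact: GV.
- by apply: autV_fix; rewrite !autM kg autKV.
- by rewrite !invgM !mulgA mulgK mulgV mul1g.
Qed.

Lemma neighbors_2transitive x a b c : adj x a -> adj x b -> adj x c -> b != a -> c != a ->
  exists2 g, G g & [/\ g x = x, g a = a & g b = c].
Proof.
move=> xa xb xc ba ca; have ax : adj a x by rewrite adjC.
have [|||g Gg /= [ga gx gb]] := G_good ax (p := [:: b]) (q := [:: c]) => //.
- by apply: (@geod_extend _ [::]); rewrite ?geod2.
- by apply: (@geod_extend _ [::]); rewrite ?geod2.
by exists g.
Qed.

Lemma neighbors_transitive x a b : adj x a -> adj x b ->
  exists2 g, G g & g x = x /\ g a = b.
Proof.
move=> xa xb; have [||//|g Gg [gx [ga]]] := @sphere_transitive x [:: a] [:: b].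
- by rewrite geod2.
- by rewrite geod2.
by exists g.
Qed.

Hypothesis G_unbounded : forall x n, exists g p,
  [/\ G g, geod (x :: p), last x p = g x & (n <= size p)%N].

(** The set [F] lies within [M] of [b]. An element moving [b] farther than [M], corrected by the
    stabilizer of [b] so that it moves [b] in the direction of [a], sends [F] too far from [b] to
    meet it. *)
Lemma push_into_half_tree a b (F : seq T) : adj a b ->
  exists2 g, G g & forall z, z \in F -> half_tree a b (g z).
Proof.
move=> ab; have [M MP] : exists M, forall z, z \in F ->
    exists p, [/\ geod (b :: p), last b p = z & (size p <= M)%N].
  elim: F => [|y F [M IH]]; first by exists 0%N.
  have [p bp py] := geod_exists b y; exists (maxn (size p) M) => z.
  rewrite inE => /orP[/eqP->|/IH[q [bq qz qM]]].
    by exists p; rewrite leq_maxl.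
  by exists q; rewrite leq_max qM orbT.
have [h [p [Gh bp ph Mp]]] := G_unbounded b M.+2.
have ba : geod (b :: [:: a]) by rewrite geod2 adjC.
have [q bq qs] := geod_long T_degree (size p).-1 ba.
have pq : size p = size ([:: a] ++ q) by rewrite size_cat qs /=; case: (p) Mp.
have [k Gk [kb kp]] := sphere_transitive bp bq pq.
have y'E : (k * h)%g b = last a q by rewrite autM -ph -(last_map k) kb kp.
exists (k * h)%g; first exact: GM.
move=> z /MP[s [bs sz sM]].
have bq' : b \notin a :: q by move: bq => /andP[_ /andP[]].
have ys : geod (last a q :: map (k * h)%g s).
  by rewrite -y'E -map_cons geod_map.
have bns : b \notin map (k * h)%g s.
  apply/negP => bs'; have s's : size (map (k * h)%g s) = size s by rewrite size_map.
  case/splitPr: bs' ys s's => s1 s2 ys s's.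
  have bs1 : geod (b :: rcons (rev s1) (last a q)).
    rewrite -geod_rev rev_cons rev_rcons revK -cats1.
    by move: ys; rewrite -[b :: s2]/([:: b] ++ s2) catA -cat_cons => /geod_catl.
  have := geod_unique bs1 bq; rewrite /= last_rcons => /(_ erefl)/(congr1 size).
  rewrite size_rcons size_rev /= qs; move: s's; rewrite size_cat /=.
  by lia.
left; exists (q ++ map (k * h)%g s).
  apply: path_avoid; rewrite ?(adj_neq ab)//.
    by move: bq ys => /andP[/= /andP[_ aq] _] /andP[/= qs' _]; rewrite cat_path aq.
  rewrite mem_cat negb_or bns andbT; by move: bq'; rewrite inE negb_or => /andP[].
by rewrite last_cat -y'E last_map sz.
Qed.

End HalfTrees.

(** * Scalars and closed real subspaces *)

Section Scalars.
Variables (R : realType) (k : scalar_kind).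
Implicit Types (a b : scalars R k) (r : R).

Lemma sreD a b : sre (a + b) = sre a + sre b.
Proof. by case: k a b => [? ?|[? ?] [? ?]|[? ? ? ?] [? ? ? ?]]. Qed.

Lemma sreN a : sre (- a) = - sre a.
Proof. by case: k a => [?|[? ?]|[? ? ? ?]]. Qed.

Lemma sre0 : sre (0 : scalars R k) = 0. Proof. by case: k. Qed.

Lemma sre_real r : sre (sreal k r) = r. Proof. by case: k. Qed.

Lemma sreZ r a : sre (sreal k r * a) = r * sre a.
Proof. by case: k a => [?|[? ?]|[? ? ? ?]] /=; rewrite ?mul0r ?subr0. Qed.

Lemma sre_conj a : sre (sconj a) = sre a.
Proof. by case: k a => [?|[? ?]|[? ? ? ?]]. Qed.

Lemma sre_mulC a b : sre (a * b) = sre (b * a).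
Proof.
case: k a b => /= [a b|[a1 a2] [b1 b2]|[a1 a2 a3 a4] [b1 b2 b3 b4]] /=; ring.
Qed.

Lemma scoord_sre a i : scoord a i = sre (sconj (sbasis R i) * a).
Proof.
case: k a i => /= [a i|[a1 a2] [[|[|]] //= ?]|[a1 a2 a3 a4] [[|[|[|[|]]]] //= ?]] /=; ring.
Qed.

Lemma scoord_eq0 a : (forall i, scoord a i = 0) -> a = 0.
Proof.
by move=> a0; rewrite (scoordE a) big1// => i _; rewrite a0 sreal0 mul0r.
Qed.

Definition unit_index : 'I_(sdim k) :=
  match k return 'I_(sdim k) with
  | Reals => ord0 | Complexes => ord0 | Quaternions => ord0
  end.

Lemma scoord_unit a : scoord a unit_index = sre a.
Proof. by rewrite /unit_index; case: k a. Qed.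

Lemma sbasis_unit : sbasis R unit_index = 1 :> scalars R k.
Proof. by rewrite /unit_index; case: k. Qed.

Lemma sreal_inj : injective (sreal k : R -> scalars R k).
Proof. by move=> r s; case: k => [//|[]|[]]. Qed.

Lemma sconj_fixed a : sconj a = a -> a = sreal k (sre a).
Proof.
by case: k a => [//|[x y] [y0]|[x y z t] [y0 z0 t0]] /=; [congr Complex|congr Quat]; lra.
Qed.

Lemma sre_conjM a : sre (sconj a * a) = \sum_i scoord a i ^+ 2.
Proof.
case: k a => /= [a|[x y]|[x y z t]] /=; rewrite !big_ord_recl ?big_ord0 /=; ring.
Qed.

Lemma scoord_conj_real r i : i != unit_index -> scoord (sreal k r) i = 0.
Proof.
by rewrite /unit_index; case: k i => /= [i|[[|[|]] //= ?]|[[|[|[|[|]]]] //= ?]]; rewrite ?ord1.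
Qed.

End Scalars.

(** The discriminant inequality, kept for semidefinite forms since both Cauchy-Schwarz inequalities
    below come from it. *)
Lemma square_le_mul (R : realType) (A C W : R) : 0 <= A -> 0 <= W ->
  (forall t, 0 <= A + 2 * t * C + t ^+ 2 * W) -> C ^+ 2 <= A * W.
Proof.
move=> A0 W0 quad; have [W1|W1] := eqVneq W 0.
  have [->|C0] := eqVneq C 0; first by rewrite W1 mulr0 expr0n.
  have := quad (- (A + 1) / (2 * C)); rewrite W1 mulr0 addr0.
  have -> : 2 * (- (A + 1) / (2 * C)) * C = - (A + 1) by field.
  by lra.
have {}W0 : 0 < W by rewrite lt_neqAle eq_sym W1.
have := quad (- C / W).
have -> : A + 2 * (- C / W) * C + (- C / W) ^+ 2 * W = (A * W - C ^+ 2) / W by field.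
by rewrite pmulr_lge0 ?invr_gt0// subr_ge0.
Qed.

(** * Closed real subspaces as real Hilbert spaces *)

Record closed_real_subspace (R : realType) (k : scalar_kind) (H : hilbertType R k) :=
  ClosedRealSubspace {
    crs_set :> set H;
    crs_zero : crs_set 0;
    crs_add : forall u v, crs_set u -> crs_set v -> crs_set (u + v);
    crs_scale : forall (r : R) u, crs_set u -> crs_set (r *: u);
    crs_closed : closed crs_set }.

Definition crs_pred (R : realType) (k : scalar_kind) (H : hilbertType R k)
  (W : closed_real_subspace H) : {pred H} := fun u => `[< crs_set W u >].

Definition subspace_type (R : realType) (k : scalar_kind) (H : hilbertType R k)
  (W : closed_real_subspace H) : Type := {u : H | crs_pred W u}.

Section SubspaceHilbert.
Variables (R : realType) (k : scalar_kind) (H : hilbertType R k).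
Variable W : closed_real_subspace H.
Local Notation U := (subspace_type W).
Implicit Types u v w : U.

HB.instance Definition _ := SubChoice.copy U {u : H | crs_pred W u}.

Lemma crs_submod_closed : submod_closed (crs_pred W).
Proof.
split; first exact/asboolP/crs_zero.
move=> r u v /asboolP Wu /asboolP Wv; apply/asboolP; apply: crs_add => //.
exact: crs_scale.
Qed.

HB.instance Definition _ := GRing.SubChoice_isSubLmodule.Build R H (crs_pred W) U
  crs_submod_closed.

Lemma sub_set u : crs_set W (val u).
Proof. exact/asboolP/(valP u). Qed.

Definition sub_norm u : R := `|val u|.

Lemma sub_normD u v : sub_norm (u + v) <= sub_norm u + sub_norm v.
Proof. exact: ler_normD. Qed.

Lemma sub_normZ (r : R) u : sub_norm (r *: u) = `|r| * sub_norm u.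
Proof. exact: normrZ. Qed.

Lemma sub_norm_eq0 u : sub_norm u = 0 -> u = 0.
Proof. by move=> /eqP; rewrite normr_eq0 => /eqP u0; apply: val_inj. Qed.

HB.instance Definition _ := Lmodule_isNormed.Build R U sub_normD sub_normZ sub_norm_eq0.

Lemma sub_complete (F : set_system U) : ProperFilter F -> cauchy F -> cvg F.
Proof.
move=> FF /cauchy_ballP Fc.
have cv : cvg ((fun u : U => val u) @ F).
  apply: cauchy_cvg; apply/cauchy_ballP => e e0.
  have [[A B] /= [FA FB] ABe] := Fc e e0.
  exists ((fun u : U => val u) @` A, (fun u : U => val u) @` B).
    by split; [apply: filterS FA|apply: filterS FB] => u Au; exists u.
  move=> [_ _] /= [[u Au <-] [v Bv <-]].
  by have := ABe (u, v) (conj Au Bv); rewrite /= -!ball_normE.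
have Wl : crs_pred W (lim ((fun u : U => val u) @ F)).
  apply/asboolP; have Wn : \forall u \near F, crs_set W (val u).
    by apply: nearW => u; exact: sub_set.
  exact: (@closed_cvg _ _ F FF _ (crs_set W) (crs_closed (c := W)) Wn _ cv).
apply/cvg_ex; exists (Sub _ Wl : U).
apply/cvgrPdist_le => e e0.
by have /cvgrPdist_le/(_ _ e0) := cv.
Qed.

HB.instance Definition _ := Uniform_isComplete.Build U sub_complete.

Definition sub_ract u (r : scalars R Reals) : U := (r : R) *: u.
Definition sub_inner u v : scalars R Reals := sre (inner (val u) (val v)) : R.

Lemma sub_ractDl u v r : sub_ract (u + v) r = sub_ract u r + sub_ract v r.
Proof. exact: scalerDr. Qed.

Lemma sub_ractDr u r s : sub_ract u (r + s) = sub_ract u r + sub_ract u s.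
Proof. exact: scalerDl. Qed.

Lemma sub_ractA u r s : sub_ract u (r * s) = sub_ract (sub_ract u r) s.
Proof. by rewrite /sub_ract scalerA mulrC. Qed.

Lemma sub_ract_real u (r : R) : sub_ract u (sreal Reals r) = r *: u.
Proof. by []. Qed.

Lemma sub_innerDr u v w : sub_inner u (v + w) = sub_inner u v + sub_inner u w.
Proof. by rewrite /sub_inner innerDr sreD. Qed.

Lemma sub_inner_ractr u v r : sub_inner u (sub_ract v r) = sub_inner u v * r.
Proof.
rewrite /sub_inner /sub_ract; have -> : val ((r : R) *: v) = ract (val v) (sreal k r).
  by rewrite ract_real.
by rewrite inner_ractr -sreal_comm sreZ mulrC.
Qed.

Lemma sub_inner_conj u v : sub_inner v u = sconj (sub_inner u v).
Proof. by rewrite /sub_inner inner_conj sre_conj. Qed.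

Lemma sub_inner_norm u : sub_inner u u = sreal Reals (`|u| ^+ 2).
Proof. by rewrite /sub_inner inner_norm sre_real. Qed.

HB.instance Definition _ := CompleteNormedModule_isHilbert.Build R Reals U
  sub_ractDl sub_ractDr sub_ractA sub_ract_real
  sub_innerDr sub_inner_ractr sub_inner_conj sub_inner_norm.

End SubspaceHilbert.

(** * Comparison of complete norms *)

Section ComparableCompleteNorms.
Variables (R : realType) (V : completeNormedModType R) (N : V -> R).
Hypothesis ND : forall u v, N (u + v) <= N u + N v.
Hypothesis NZ : forall (r : R) u, N (r *: u) = `|r| * N u.
Hypothesis N_eq0 : forall u, N u = 0 -> u = 0.
Variable C : R.
Hypothesis NC : forall u, N u <= C * `|u|.
Hypothesis N_complete : forall u : nat -> V,
  (forall e, 0 < e -> exists n0, forall m n,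
     (n0 <= m)%N -> (n0 <= n)%N -> N (u m - u n) < e) ->
  exists l, N (u n - l) @[n --> \oo] --> 0.

Let N0 : N 0 = 0. Proof. by rewrite -(scale0r 0) NZ normr0 mul0r. Qed.

Let NN u : N (- u) = N u. Proof. by rewrite -scaleN1r NZ normrN1 mul1r. Qed.

Let NB u v : N (u - v) = N (v - u). Proof. by rewrite -NN opprB. Qed.

Let N_ge0 u : 0 <= N u.
Proof. by have := ND u (- u); rewrite NN subrr N0 -mulr2n pmulrn_lge0. Qed.

Let N_triangle u v w : N (u - w) <= N (u - v) + N (v - w).
Proof. by rewrite -{1}(subrKA v). Qed.

(* Baire: one of the balls of the finer norm is dense in some ball of [N]. *)
Let somewhere_dense : exists n u (r : R), 0 < r /\ forall w, N (w - u) < r ->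
  forall d, 0 < d -> exists2 z, `|z| <= n%:R & N (w - z) < d.
Proof.
apply: contrapT => nd.
have step (nur : nat * (V * R)) : exists vs : V * R, 0 < nur.2.2 ->
    [/\ 0 < vs.2, vs.2 <= nur.2.2 / 2, N (vs.1 - nur.2.1) + vs.2 <= nur.2.2 &
      forall z, `|z| <= nur.1%:R -> vs.2 < N (vs.1 - z)].
  case: nur => n [u r] /=; have [r0|] := pselect (0 < r); last by exists (0, 0).
  have [w [wr [d d0 wd]]] : exists w, N (w - u) < r /\ exists2 d, 0 < d &
      forall z, `|z| <= n%:R -> d <= N (w - z).
    apply: contrapT => nw; apply: nd; exists n, u, r; split => // w wr d d0.
    apply: contrapT => nz; apply: nw; exists w; split => //; exists d => // z zn.
    by rewrite leNgt; apply/negP => zd; apply: nz; exists z.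
  (* Half of the available room keeps the new ball inside the old one and away from the vectors of
     norm at most [n]. *)
  exists (w, Num.min d (r - N (w - u)) / 2) => _ /=.
  have m0 : 0 < Num.min d (r - N (w - u)) by rewrite lt_min d0 subr_gt0.
  have mr : Num.min d (r - N (w - u)) <= r - N (w - u) by rewrite ge_min lexx orbT.
  have md : Num.min d (r - N (w - u)) <= d by rewrite ge_min lexx.
  have := N_ge0 (w - u); move: (Num.min _ _) m0 mr md => m m0 mr md Nw.
  split; [by lra|by lra|by lra|move=> z /wd; lra].
have [f fP] := choice step.
pose fix c n : V * R := if n is m.+1 then f (m, c m) else (0, 1).
have c0 n : 0 < (c n).2 by elim: n => [|n IH] /=; [exact: ltr01|have [] := fP (n, c n) IH].
have cS n := fP (n, c n) (c0 n).
have c2 n : (c n).2 <= (2^-1) ^+ n.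
  elim: n => [|n IH]; first by rewrite expr0.
  have [_ h _ _] := cS n; rewrite exprS; apply: le_trans h _.
  by rewrite mulrC ler_pM2l// invr_gt0.
have cN n m : N ((c (n + m)%N).1 - (c n).1) + (c (n + m)%N).2 <= (c n).2.
  elim: m => [|m IH]; first by rewrite addn0 subrr N0 add0r.
  have [_ _ h _] := cS (n + m)%N; rewrite addnS /=.
  rewrite /= in h.
  have := N_triangle (f ((n + m)%N, c (n + m)%N)).1 (c (n + m)%N).1 (c n).1.
  by move: IH h; lra.
have [|l lP] := N_complete (u := fun n => (c n).1).
  move=> e e0.
  have : \forall n \near \oo, (2^-1 : R) ^+ n < e / 2.
    have /cvgr_lt : (2^-1 : R) ^+ n @[n --> \oo] --> 0.
      by apply: cvg_expr; rewrite gtr0_norm ?invr_gt0// invf_lt1// ltr1n.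
    by apply; rewrite divr_gt0.
  move=> /filter_ex[n0 n0e]; exists n0 => m n /subnKC <- /subnKC <-.
  have := cN n0 (m - n0)%N; have := cN n0 (n - n0)%N.
  have := N_triangle (c (n0 + (m - n0))%N).1 (c n0).1 (c (n0 + (n - n0))%N).1.
  rewrite [N ((c n0).1 - _)]NB.
  have := c0 (n0 + (m - n0))%N; have := c0 (n0 + (n - n0))%N; have := c2 n0.
  by lra.
have cl n : N ((c n).1 - l) <= (c n).2.
  apply/ler_addgt0Pl => e e0.
  have : \forall m \near \oo, N ((c (n + m)%N).1 - l) < e.
    have [M _ MP] : \forall m \near \oo, N ((c m).1 - l) < e.
      by have /cvgr_lt/(_ _ e0) := lP.
    by exists M => // m /= Mm; apply: MP => /=; exact: leq_trans Mm (leq_addl _ _).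
  move=> /filter_ex[m me]; have := cN n m; have := c0 (n + m)%N.
  have := N_triangle (c n).1 (c (n + m)%N).1 l; rewrite [N ((c n).1 - (c _).1)]NB.
  by lra.
have [n ln] : exists n : nat, `|l| <= n%:R.
  by exists (Num.bound `|l|); rewrite ltW// archi_boundP.
have [_ _ _ /(_ l ln) far] := cS n.
by have := lt_le_trans far (cl n.+1); rewrite ltxx.
Qed.

(** The argument of the open mapping theorem: every vector is approximated in [N] by vectors of
    comparable norm, and the successive errors are corrected with tolerances [N w / 2 ^ n], so that
    the corrections are summable for the finer norm. *)
Lemma complete_norm_dominates : exists2 M, 0 < M & forall u, `|u| <= M * N u.
Proof.
have [K [u0 [r [r0 dense]]]] := somewhere_dense.
have [c c0 approx] : exists2 c, 0 < c & forall w d, 0 < d ->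
    exists2 z, `|z| <= c * N w & N (w - z) < d.
  (* After scaling [w] to [N]-length [r / 2], it is approximated by a difference of two vectors of
     norm at most [K]; scaling back multiplies [2 K] by [2 N w / r]. The added 1 keeps the constant
     positive when [K] is 0. *)
  exists (4 * K%:R / r + 1); first by rewrite ltr_wpDl// divr_ge0 ?mulr_ge0// ltW.
  move=> w d d0; have [->|w0] := eqVneq w 0.
    by exists 0; rewrite ?normr0 ?subr0 N0 ?mulr0.
  have Nw : 0 < N w by rewrite lt_neqAle N_ge0 andbT; apply: contra_neq w0 => /esym/N_eq0.
  pose t := r / (2 * N w); have t0 : 0 < t by rewrite divr_gt0// mulr_gt0.
  have td : 0 < t * d / 2 by rewrite divr_gt0// mulr_gt0.
  have [|z1 z1n wz1] := dense (t *: w + u0) _ _ td.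
    rewrite addrK NZ gtr0_norm// /t.
    have -> : r / (2 * N w) * N w = r / 2 by field; rewrite gt_eqF.
    by lra.
  have [|z2 z2n wz2] := dense u0 _ _ td; first by rewrite subrr N0.
  exists (t^-1 *: (z1 - z2)).
    rewrite normrZ gtr0_norm ?invr_gt0// ler_pdivrMl//.
    apply: (le_trans (ler_normB _ _)); apply: (@le_trans _ _ (2 * K%:R)); first by lra.
    have -> : t * ((4 * K%:R / r + 1) * N w) = 2 * K%:R + r / 2.
      by rewrite /t; field; rewrite !gt_eqF.
    by rewrite lerDl ltW// divr_gt0.
  have -> : w - t^-1 *: (z1 - z2) = t^-1 *: ((t *: w + u0 - z1) - (u0 - z2)).
    have -> : t *: w + u0 - z1 - (u0 - z2) = t *: w - (z1 - z2).
      by rewrite !opprB addrAC addrACA subrr addr0 addrA addrAC.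
    by rewrite [RHS]scalerBr scalerA mulVf ?gt_eqF// scale1r.
  rewrite NZ gtr0_norm ?invr_gt0// ltr_pdivrMl//.
  by have := ND (t *: w + u0 - z1) (- (u0 - z2)); rewrite NN; lra.
have /choice[f fP] : forall wd : V * R, exists z, 0 < wd.2 ->
    `|z| <= c * N wd.1 /\ N (wd.1 - z) < wd.2.
  move=> [w d] /=; have [d0|] := pselect (0 < d); last by exists 0.
  by have [z ? ?] := approx w d d0; exists z.
exists (2 * c) => [|w]; first by rewrite mulr_gt0.
have [->|w0] := eqVneq w 0; first by rewrite normr0 N0 mulr0.
have Nw : 0 < N w by rewrite lt_neqAle N_ge0 andbT; apply: contra_neq w0 => /esym/N_eq0.
pose h n : R := 2^-1 ^+ n.
have h0 n : 0 < h n by rewrite exprn_gt0// invr_gt0.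
have hS n : h n.+1 = h n / 2 by rewrite /h exprSr.
pose fix s n := if n is m.+1 then s m - f (s m, N w * h m.+1) else w.
have hw n : 0 < N w * h n by rewrite mulr_gt0.
have sN n : N (s n) <= N w * h n.
  case: n => [|n] /=; first by rewrite /h expr0 mulr1.
  by have [_ /ltW] := fP (s n, N w * h n.+1) (hw n.+1).
have sd n m : `|s n - s (n + m)%N| <= 2 * c * N w * (h n - h (n + m)%N).
  elim: m => [|m IH]; first by rewrite addn0 subrr normr0 subrr mulr0.
  rewrite addnS /= -[X in `|X|](subrKA (s (n + m)%N)) (le_trans (ler_normD _ _))//.
  have -> : s (n + m)%N - (s (n + m)%N - f (s (n + m)%N, N w * h (n + m).+1)) =
      f (s (n + m)%N, N w * h (n + m).+1) by rewrite subKr.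
  have [z1 _] := fP (s (n + m)%N, N w * h (n + m).+1) (hw _).
  rewrite /= in z1; have z2 := ler_wpM2l (ltW c0) (sN (n + m)%N).
  by move: (hS (n + m)%N) IH z1 z2 => ->; nra.
have hlim : h n @[n --> \oo] --> 0.
  by apply: cvg_expr; rewrite gtr0_norm ?invr_gt0// invf_lt1// ltr1n.
have hsmall e : 0 < e -> \forall n \near \oo, 2 * c * N w * h n < e.
  move=> e0; have k0 : 0 < 2 * c * N w by rewrite !mulr_gt0.
  have : 0 < e / (2 * c * N w) by rewrite divr_gt0.
  have /cvgr_lt := hlim; move=> /[apply]; apply: filterS => n.
  by rewrite ltr_pdivlMr// mulrC.
have sh n m : `|s n - s (n + m)%N| <= 2 * c * N w * h n.
  apply: le_trans (sd n m) _; rewrite ler_wpM2l ?lerBlDr ?lerDl ?ltW//.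
  by rewrite !mulr_gt0.
have [l lP] : exists l : V, s n @[n --> \oo] --> l.
  apply/cvg_ex/cauchy_cvgP/cauchyP => e e0.
  have [n0 ln] := filter_ex (hsmall e e0); exists (s n0).
  exists n0 => // n /= /subnKC <-; rewrite -ball_normE /=.
  exact: le_lt_trans (sh _ _) ln.
have C0 : 0 <= `|C| by [].
have l0 : l = 0.
  apply: N_eq0; apply/eqP; rewrite eq_le N_ge0 andbT.
  apply/ler_addgt0Pl => e e0; rewrite addr0.
  have d0 : 0 < e / 2 / (`|C| + 1) by rewrite !divr_gt0// ltr_wpDl.
  have : \forall n \near \oo, `|l - s n| < e / 2 / (`|C| + 1) /\ N w * h n < e / 2.
    apply: filterI; first by have /cvgrPdist_lt/(_ _ d0) := lP.
    have : 0 < e / 2 / N w by rewrite !divr_gt0.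
    have /cvgr_lt := hlim; move=> /[apply]; apply: filterS => n.
    by rewrite ltr_pdivlMr// mulrC.
  move=> /filter_ex[n [ln wn]].
  have h1 : N (l - s n) <= e / 2.
    apply: le_trans (NC _) _; apply: (@le_trans _ _ ((`|C| + 1) * `|l - s n|)).
      by rewrite ler_wpM2r// (le_trans (ler_norm C))// lerDl.
    by rewrite mulrC -ler_pdivlMr ?ltr_wpDl// ltW.
  have := ND (l - s n) (s n); rewrite subrK; have := sN n.
  by lra.
apply/ler_addgt0Pl => e e0.
have : \forall n \near \oo, `|s n| < e.
  by have /cvgrPdist_lt/(_ _ e0) := lP; apply: filterS => n; rewrite l0 sub0r normrN.
move=> /filter_ex[n ne]; have := sh 0%N n; rewrite add0n /h expr0 mulr1 /=.
have := ler_normD (w - s n) (s n); rewrite subrK; lra.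
Qed.

End ComparableCompleteNorms.

(** * Forms of finite index *)

Section Representation.
Variables (R : realType) (k : scalar_kind) (H : hilbertType R k).
Variable B : H -> H -> scalars R k.
Hypothesis B_sesquilinear : sesquilinear_form B.
Hypothesis B_hermitian : hermitian_form B.
Hypothesis B_continuous : continuous_form B.
Hypothesis B_nondegenerate : strongly_nondegenerate B.

Implicit Types (u v w : H) (a : scalars R k) (r : R).

Lemma ract1 v : ract v (1 : scalars R k) = v.
Proof. by rewrite -sreal1 ract_real scale1r. Qed.

Lemma ract0 v : ract v (0 : scalars R k) = 0.
Proof. by rewrite -sreal0 ract_real scale0r. Qed.

Lemma ract0l a : ract (0 : H) a = 0.
Proof. by apply: (@addrI _ (ract 0 a)); rewrite -ractDl !addr0. Qed.

Lemma ractNl v a : ract (- v) a = - ract v a.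
Proof. by apply: (@addrI _ (ract v a)); rewrite -ractDl !subrr ract0l. Qed.

Lemma ractNr v a : ract v (- a) = - ract v a.
Proof. by apply: (@addrI _ (ract v a)); rewrite -ractDr !subrr ract0. Qed.

Lemma ractBl v w a : ract (v - w) a = ract v a - ract w a.
Proof. by rewrite ractDl ractNl. Qed.

Lemma ractZl r v a : ract (r *: v) a = r *: ract v a.
Proof. by rewrite -!ract_real -!ractA sreal_comm. Qed.

Lemma ract_suml n (F : 'I_n -> H) a : ract (\sum_i F i) a = \sum_i ract (F i) a.
Proof. by apply: (big_morph (fun v => ract v a)) => [v w|]; rewrite (ractDl, ract0l). Qed.

Lemma ract_sumr n v (F : 'I_n -> scalars R k) : ract v (\sum_i F i) = \sum_i ract v (F i).
Proof. by apply: (big_morph (fun a => ract v a)) => [a c|]; rewrite (ractDr, ract0). Qed.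

Lemma ract_coord v a : ract v a = \sum_i scoord a i *: ract v (sbasis R i).
Proof.
rewrite {1}(scoordE a) ract_sumr; apply: eq_bigr => i _.
by rewrite ractA ract_real ractZl.
Qed.

Lemma norm_ract_basis v i : `|ract v (sbasis R i)| = `|v|.
Proof.
apply/eqP; rewrite -(@eqrXn2 _ 2)//; apply/eqP/(@sreal_inj R k).
rewrite -!inner_norm inner_ractr inner_conj inner_ractr sconjM inner_norm sconj_real.
by rewrite -mulrA sreal_comm mulrA sconj_basisM mul1r.
Qed.

Definition b u w : R := sre (B u w).

Lemma BDl u v w : B (u + v) w = B u w + B v w.
Proof. by have [+ _ _ _] := B_sesquilinear; exact. Qed.

Lemma BDr u v w : B u (v + w) = B u v + B u w.
Proof. by have [_ + _ _] := B_sesquilinear; exact. Qed.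

Lemma BMl v w a : B (ract v a) w = sconj a * B v w.
Proof. by have [_ _ + _] := B_sesquilinear; exact. Qed.

Lemma BMr v w a : B v (ract w a) = B v w * a.
Proof. by have [_ _ _] := B_sesquilinear; exact. Qed.

Lemma bC u w : b u w = b w u.
Proof. by rewrite /b B_hermitian sre_conj. Qed.

Lemma bDr u v w : b u (v + w) = b u v + b u w.
Proof. by rewrite /b BDr sreD. Qed.

Lemma bDl u v w : b (u + v) w = b u w + b v w.
Proof. by rewrite /b BDl sreD. Qed.

Lemma bZr u r w : b u (r *: w) = r * b u w.
Proof. by rewrite /b -ract_real BMr -sreal_comm sreZ. Qed.

Lemma bZl u r w : b (r *: u) w = r * b u w.
Proof. by rewrite bC bZr bC. Qed.

Lemma bNr u w : b u (- w) = - b u w.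
Proof. by rewrite -scaleN1r bZr mulN1r. Qed.

Lemma bNl u w : b (- u) w = - b u w.
Proof. by rewrite bC bNr bC. Qed.

Lemma bBr u v w : b u (v - w) = b u v - b u w.
Proof. by rewrite bDr bNr. Qed.

Lemma bBl u v w : b (u - v) w = b u w - b v w.
Proof. by rewrite bDl bNl. Qed.

Lemma b0r u : b u 0 = 0.
Proof. by rewrite -(scale0r 0) bZr mul0r. Qed.

Lemma b0l u : b 0 u = 0.
Proof. by rewrite bC b0r. Qed.

Lemma b_sumr I (s : seq I) (F : I -> H) u : b u (\sum_(i <- s) F i) = \sum_(i <- s) b u (F i).
Proof. by apply: (big_morph (b u)) => [v w|]; rewrite (bDr, b0r). Qed.

Lemma b_suml I (s : seq I) (F : I -> H) u : b (\sum_(i <- s) F i) u = \sum_(i <- s) b (F i) u.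
Proof. by apply: (big_morph (b^~ u)) => [v w|]; rewrite (bDl, b0l). Qed.

Lemma b_ract_basis u w i : b (ract u (sbasis R i)) w = scoord (B u w) i.
Proof. by rewrite /b BMl scoord_sre. Qed.

Lemma b_ractl u w a : b (ract u a) w = b u (ract w (sconj a)).
Proof. by rewrite /b BMl BMr sre_mulC. Qed.

Lemma B_eq0 u w : (forall a, b (ract u a) w = 0) -> B u w = 0.
Proof. by move=> h; apply: scoord_eq0 => i; rewrite -b_ract_basis. Qed.

Lemma B_self u : B u u = sreal k (b u u).
Proof. by apply: sconj_fixed; rewrite -B_hermitian. Qed.

(** Continuity at the origin bounds [b] on small vectors, and homogeneity spreads the bound. *)
Lemma b_bounded : exists2 C, 0 < C & forall u w, `|b u w| <= C * (`|u| * `|w|).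
Proof.
have bc : continuous (fun vw : H * H => b vw.1 vw.2 : R).
  have -> : (fun vw : H * H => b vw.1 vw.2) =
      (fun vw => scoord (B vw.1 vw.2) (unit_index k)).
    by apply/funext => vw; rewrite scoord_unit.
  exact: B_continuous.
have : \forall vw \near ((0, 0) : H * H), `|b vw.1 vw.2| < 1.
  have /cvgrPdist_lt/(_ 1 ltr01) := bc (0, 0); rewrite /= b0l.
  by apply: filterS => vw; rewrite sub0r normrN.
move=> [[U V] /= [/nbhs_norm0P[d d0 dU] /nbhs_norm0P[e e0 eV]] UV].
pose m : R := Num.min d e / 2.
have m0 : 0 < m by rewrite divr_gt0// lt_min d0.
have small u w : `|u| <= m -> `|w| <= m -> `|b u w| <= 1.
  move=> um wm; apply/ltW/(UV (u, w)); split; [apply: dU|apply: eV] => /=.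
    by rewrite (le_lt_trans um)// /m ltr_pdivrMr// gt_min ltr_pMr// ltr1n.
  by rewrite (le_lt_trans wm)// /m ltr_pdivrMr// gt_min ltr_pMr// ltr1n orbT.
clearbody m.
exists (m^-1 * m^-1) => [|u w]; first by rewrite mulr_gt0// invr_gt0.
have [->|u0] := eqVneq u 0; first by rewrite b0l !normr0 mul0r mulr0.
have [->|w0] := eqVneq w 0; first by rewrite b0r !normr0 !mulr0.
have nu : 0 < `|u| by rewrite normr_gt0.
have nw : 0 < `|w| by rewrite normr_gt0.
have := small ((m / `|u|) *: u) ((m / `|w|) *: w).
rewrite bZl bZr !normrZ !normfV !normr_id !(gtr0_norm m0).
rewrite !divfK ?gt_eqF// => /(_ (lexx _) (lexx _)) h.
have -> : `|b u w| = (m^-1 * m^-1) * (`|u| * `|w|) * (m / `|u| * (m / `|w| * `|b u w|)).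
  by field; rewrite !gt_eqF.
by rewrite ler_piMr// mulr_ge0 ?mulr_ge0 ?invr_ge0 ?ltW.
Qed.

Lemma b_nondegenerate u : (forall w, b u w = 0) -> u = 0.
Proof.
move=> u0; have Bu w : B u w = 0 by apply: B_eq0 => a; rewrite b_ractl u0.
have [Hp [Hm [pp [pm [[_ _ dec _ orth] [pos neg _]]]]]] := B_nondegenerate.
have [pu mu uE] := dec u.
have := Bu (pp u); rewrite {1}uE BDl [B (pm u) _]B_hermitian (orth (pp u) (pm u))// sconj0 addr0 => Bp.
have := Bu (pm u); rewrite {1}uE BDl (orth (pp u) (pm u))// add0r => Bm.
rewrite uE; have [->|/pos-/(_ pu)] := eqVneq (pp u) 0; last by rewrite Bp sre0 ltxx.
have [->|/neg-/(_ mu)] := eqVneq (pm u) 0; last by rewrite Bm sre0 ltxx.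
by rewrite addr0.
Qed.

(** * Orthonormal families of negative vectors *)

Lemma wide_kernel (m n : nat) (A : 'M[R]_(n, m)) : (m < n)%N ->
  exists2 x : 'rV_n, x != 0 & x *m A = 0.
Proof.
move=> mn; have /rowV0Pn[x xA x0] : kermx A != 0.
  rewrite kermx_eq0 /row_free neq_ltn; apply/orP; left.
  exact: leq_ltn_trans (rank_leq_col _) mn.
by exists x => //; apply/sub_kermxP.
Qed.

(** K may be noncommutative, so the system is read in coordinates: [j * d] real equations in [n * d]
    real unknowns. *)
Lemma homogeneous_system (j n : nat) (A : 'I_j -> 'I_n -> scalars R k) : (j < n)%N ->
  exists c : 'I_n -> scalars R k, (exists i, c i != 0) /\
    forall l, \sum_i A l i * c i = 0.
Proof.
move=> jn; pose d := sdim k.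
have d0 : (0 < d)%N by rewrite /d; case: k.
pose M : 'M[R]_(n * d, j * d) := \matrix_(y, z)
  let: (i, s) := enum_val (cast_ord (esym (mxvec_cast n d)) y) in
  let: (l, t) := enum_val (cast_ord (esym (mxvec_cast j d)) z) in
  scoord (A l i * sbasis R s) t.
have ME i s l t : M (mxvec_index i s) (mxvec_index l t) = scoord (A l i * sbasis R s) t.
  by rewrite mxE /mxvec_index !cast_ordK !enum_rankK.
have [|x x0 xM] := wide_kernel M; first by rewrite ltn_pmul2r.
pose c i := \sum_s sreal k (x 0 (mxvec_index i s)) * sbasis R s.
have cE i s : scoord (c i) s = x 0 (mxvec_index i s).
  rewrite scoord_sum (bigD1 s)//= big1 => [|t ts]; rewrite scoordM scoord_basis.
    by rewrite eqxx mulr1 addr0.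
  by rewrite (negbTE ts) mulr0.
exists c; split.
  apply: contrapT => c0; move/eqP: x0; apply; apply/rowP => y.
  case/mxvec_indexP: y => i s; rewrite mxE -cE.
  have -> : c i = 0 by apply/eqP/negP => /negP ci; apply: c0; exists i.
  exact: scoord0.
move=> l; apply: scoord_eq0 => t; rewrite scoord_sum.
have := congr1 (fun z : 'rV_(j * d) => z 0 (mxvec_index l t)) xM.
rewrite /= mxE [RHS]mxE => E0; rewrite -[RHS]E0.
have -> : \sum_y x 0 y * M y (mxvec_index l t) = \sum_i \sum_s
    x 0 (mxvec_index i s) * M (mxvec_index i s) (mxvec_index l t).
  rewrite pair_bigA (reindex _ (curry_mxvec_bij n d)) /=.
  by apply: eq_big => [[i s]|[i s] _].
apply: eq_bigr => i _; rewrite /c mulr_sumr scoord_sum; apply: eq_bigr => s _.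
by rewrite ME mulrA -sreal_comm -mulrA scoordM.
Qed.

Definition negfam n (u : 'I_n -> H) :=
  forall i l, B (u i) (u l) = if i == l then -1 else 0.

Definition kspan n (u : 'I_n -> H) (c : 'I_n -> scalars R k) := \sum_i ract (u i) (c i).

Lemma B_kspan n (u : 'I_n -> H) c w : B w (kspan u c) = \sum_i B w (u i) * c i.
Proof.
have B0 : B w 0 = 0 by rewrite -(ract0 0) BMr mulr0.
rewrite /kspan (big_morph (B w) (id1 := 0) (op1 := +%R)) ?B0//.
  by apply: eq_bigr => i _; rewrite BMr.
by move=> x y; rewrite BDr.
Qed.

Lemma negfam_coef n (u : 'I_n -> H) c i : negfam u -> B (u i) (kspan u c) = - c i.
Proof.
move=> un; rewrite B_kspan (bigD1 i)//= big1 => [|l li]; rewrite un.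
  by rewrite eqxx mulN1r addr0.
by rewrite eq_sym (negbTE li) mul0r.
Qed.

Lemma b_kspan n (u : 'I_n -> H) c w : b (kspan u c) w = \sum_i b (ract (u i) (c i)) w.
Proof. exact: b_suml. Qed.

Lemma kspan_subspace n (u : 'I_n -> H) : k_subspace [set v | exists c, v = kspan u c].
Proof.
split.
- by exists (fun=> 0); rewrite /kspan big1// => i _; rewrite ract0.
- move=> _ _ [c ->] [d ->]; exists (fun i => c i + d i).
  by rewrite -big_split; apply: eq_bigr => i _; rewrite ractDr.
- move=> _ a [c ->]; exists (fun i => c i * a).
  by rewrite ract_suml; apply: eq_bigr => i _; rewrite ractA.
Qed.

Variable p : nat.
Hypothesis B_index : form_index B p.

(** The span of [u] is negative definite, so it has a basis of some size [m <= p]; if [m < n],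
    elimination gives a nontrivial relation between the [u i], which orthonormality forbids. *)
Lemma negfam_le n (u : 'I_n -> H) : negfam u -> (n <= p)%N.
Proof.
move=> un; have [_ /(_ _ (kspan_subspace u))] := B_index.
case=> [_ [c ->] v0|m mp [e [_ We]]].
  have bE : b (kspan u c) (kspan u c) = - \sum_i \sum_s scoord (c i) s ^+ 2.
    rewrite b_kspan -sumrN; apply: eq_bigr => i _.
    by rewrite /b BMl negfam_coef// mulrN sreN sre_conjM.
  rewrite -[sre _]/(b _ _) bE oppr_lt0 lt_neqAle sumr_ge0 ?andbT; last first.
    by move=> i _; rewrite sumr_ge0// => s _; rewrite sqr_ge0.
  rewrite eq_sym; apply: contra v0 => /eqP s0; apply/eqP/big1 => i _.
  suff -> : c i = 0 by rewrite ract0.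
  apply: scoord_eq0 => s; apply/eqP; rewrite -sqrf_eq0; apply/eqP.
  have si0 i' : true -> 0 <= \sum_s scoord (c i') s ^+ 2.
    by move=> _; rewrite sumr_ge0// => ? _; rewrite sqr_ge0.
  have := psumr_eq0P si0 s0 (i := i) isT.
  by move=> /(psumr_eq0P (fun s _ => sqr_ge0 _))/(_ s isT).
rewrite leqNgt; apply/negP => pn.
have uW i : exists a : 'I_m -> scalars R k, u i = kspan e a.
  have : [set v | exists c, v = kspan u c] (u i).
    exists (fun l => (l == i)%:R); rewrite /kspan (bigD1 i)//= big1 => [|l /negbTE->].
      by rewrite eqxx ract1 addr0.
    exact: ract0.
  by rewrite We.
have [A AE] := choice uW.
have [c [[i ci] c0]] := homogeneous_system (fun l i => A i l) (leq_ltn_trans mp pn).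
have uc : kspan u c = 0.
  rewrite /kspan; under eq_bigr do rewrite AE ract_suml.
  rewrite exchange_big big1// => l _.
  by under eq_bigr do rewrite -ractA; rewrite -ract_sumr c0 ract0.
have := negfam_coef c i un; rewrite uc -(ract0 0) BMr mulr0 => /esym/eqP.
by rewrite oppr_eq0 (negbTE ci).
Qed.

(** A negative definite subspace of dimension [p] has a nonzero vector satisfying fewer than [p]
    linear conditions. *)
Lemma negfam_extend n (u : 'I_n -> H) : (n < p)%N ->
  exists2 w, b w w < 0 & forall i, B (u i) w = 0.
Proof.
move=> np; have [[W [[_ WD WM] Wneg [e [eind WE]]]] _] := B_index.
have [c [[i ci] c0]] := homogeneous_system (fun l i => B (u l) (e i)) np.
exists (kspan e c); last by move=> l; rewrite B_kspan.
apply: Wneg; first by rewrite WE; exists c.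
by apply: contraNneq ci => /eind ->.
Qed.

Definition adjoin n (u : 'I_n -> H) w (i : 'I_n.+1) :=
  if unlift ord_max i is Some j then u j else (Num.sqrt (- b w w))^-1 *: w.

Lemma negfam_adjoin n (u : 'I_n -> H) w : negfam u -> (forall i, B (u i) w = 0) ->
  b w w < 0 -> negfam (adjoin u w).
Proof.
move=> un uw w0; have r0 : 0 < - b w w by rewrite oppr_gt0.
have wu i : B w (u i) = 0 by rewrite B_hermitian uw sconj0.
move=> i l; rewrite /adjoin; case: unliftP => [i' ->|->]; case: unliftP => [l' ->|->].
- by rewrite (inj_eq lift_inj) un.
- by rewrite -ract_real BMr uw mul0r eq_sym (negbTE (neq_lift _ _)).
- by rewrite -ract_real BMl wu mulr0 (negbTE (neq_lift _ _)).
- rewrite eqxx B_self bZl bZr mulrA -expr2 exprVn sqr_sqrtr ?ltW//.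
  rewrite -[b w w in X in _ * X]opprK mulrN mulVf ?gt_eqF//.
  by apply: (@addrI _ (sreal k 1)); rewrite -srealD subrr sreal0 sreal1 subrr.
Qed.

Lemma negfam_perp (u : 'I_p -> H) w : negfam u -> (forall i, B (u i) w = 0) -> 0 <= b w w.
Proof.
move=> un uw; rewrite leNgt; apply/negP => /(negfam_adjoin un uw)/negfam_le.
by rewrite ltnn.
Qed.

(** This is the orthogonal projection to the complement of the family; the plus sign comes from
    [B (u i) (u i) = -1]. *)
Definition negproj n (u : 'I_n -> H) w := w + kspan u (fun i => B (u i) w).

Lemma negprojP n (u : 'I_n -> H) w i : negfam u -> B (u i) (negproj u w) = 0.
Proof. by move=> un; rewrite BDr negfam_coef// subrr. Qed.

(** The value of [b] at [negproj u w], written as a continuous function of [w]; its positivity for a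
    maximal family is a reverse Cauchy-Schwarz inequality. *)
Definition negform n (u : 'I_n -> H) w :=
  b w w + \sum_i \sum_s b (ract (u i) (sbasis R s)) w ^+ 2.

Lemma b_negproj n (u : 'I_n -> H) w : negfam u ->
  b (negproj u w) (negproj u w) = negform u w.
Proof.
move=> un; rewrite {1}/negproj bDl [X in _ + X]b_kspan [X in _ + X]big1 => [|i _]; last first.
  by rewrite /b BMl negprojP// mulr0 sre0.
rewrite addr0 bDr; congr (_ + _); rewrite bC b_kspan; apply: eq_bigr => i _.
rewrite /b BMl sre_conjM; apply: eq_bigr => s _.
by rewrite -b_ract_basis.
Qed.

Lemma negform_ge0 (u : 'I_p -> H) w : negfam u -> 0 <= negform u w.
Proof. by move=> un; rewrite -b_negproj//; apply: (negfam_perp un) => i; exact: negprojP. Qed.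

Lemma b_diag_continuous : continuous (fun w => b w w : R).
Proof.
move=> w; have [C C0 bC'] := b_bounded; apply/cvgrPdist_lt => e e0.
have d0 : 0 < e / (C * (`|w| + `|w| + 1)).
  by rewrite divr_gt0// mulr_gt0// ltr_wpDl.
near=> v.
have -> : b w w - b v v = b (w - v) w + b v (w - v).
  by rewrite bBl bBr [b v w]bC; ring.
have vw : `|w - v| < e / (C * (`|w| + `|w| + 1)) by near: v; exact: cvgr_dist_lt.
have vw1 : `|w - v| < 1 by near: v; exact: cvgr_dist_lt.
have vn : `|v| <= `|w| + 1.
  by rewrite -[v](subKr w) (le_trans (ler_normB _ _))// lerD2l ltW.
rewrite (le_lt_trans (ler_normD _ _))//.
apply: (@le_lt_trans _ _ (C * (`|w| + `|w| + 1) * `|w - v|)).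
  rewrite (le_trans (lerD (bC' _ _) (bC' _ _)))// -!mulrA -mulrDr ler_pM2l//.
  by rewrite [_ * `|w|]mulrC -mulrDl ler_wpM2r// -addrA lerD2l.
by rewrite mulrC -ltr_pdivlMr// mulr_gt0// ltr_wpDl.
Unshelve. all: by end_near. Qed.

Lemma b_continuous u : continuous (fun w => b u w : R).
Proof.
move=> w; have [C C0 bC'] := b_bounded; apply/cvgrPdist_lt => e e0.
have d0 : 0 < C * (`|u| + 1) by rewrite mulr_gt0// ltr_wpDl.
near=> v; rewrite -bBr (le_lt_trans (bC' _ _))//.
apply: (@le_lt_trans _ _ (C * (`|u| + 1) * `|w - v|)).
  by rewrite -mulrA ler_pM2l// ler_wpM2r// lerDl.
by rewrite mulrC -ltr_pdivlMr//; near: v; apply: cvgr_dist_lt => //; exact: divr_gt0.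
Unshelve. all: by end_near. Qed.

Definition dense_in_norm (V : set H) := forall u e, 0 < e -> exists2 v, V v & `|u - v| < e.

(** Orthogonality to the family is lost by approximation, but [negform u w < 0] is an open
    condition. So [w] is first moved into [V] and then projected, which stays in [V] because the
    family does. *)
Lemma negfam_dense (V : set H) n : k_subspace V -> dense_in_norm V -> (n <= p)%N ->
  exists2 u : 'I_n -> H, negfam u & forall i, V (u i).
Proof.
move=> [V0 VD VM] Vd; elim: n => [_|n IH np].
  by exists (fun=> 0) => -[].
have [u un uV] := IH (ltnW np).
have [w w0 uw] := negfam_extend u np.
have cF : continuous (negform u : H -> R).
  move=> x; apply: cvgD; first exact: b_diag_continuous.
  apply: (continuous_big (@add_continuous R)) => i _.
  apply: (continuous_big (@add_continuous R)) => s _ y.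
  by apply: cvgM; exact: b_continuous.
have Fw : negform u w < 0.
  rewrite /negform big1 ?addr0// => i _; apply: big1 => s _.
  by rewrite b_ract_basis uw scoord0 expr0n.
have : \forall x \near w, negform u x < 0 by have /cvgr_lt/(_ _ Fw) := cF w.
move=> /nbhs_normP[d d0 dF]; have [v Vv vw] := Vd w d d0.
have Fv : negform u v < 0.
  exact: dF.
pose x := negproj u v.
have ux i : B (u i) x = 0 by exact: negprojP.
have xx : b x x < 0 by rewrite b_negproj.
have Vx : V x.
  apply: (VD) => //; rewrite /kspan; apply: (big_ind V) => [//|y z|i _]; [exact: VD|exact: VM].
exists (adjoin u x); first exact: negfam_adjoin.
move=> i; rewrite /adjoin; case: unliftP => // _; rewrite -ract_real; exact: VM.
Qed.

(** * Averages over compact subgroups *)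

Definition mean (I : Type) (s : seq I) (F : I -> H) : H :=
  (size s)%:R^-1 *: \sum_(i <- s) F i.

Lemma mean_dist (I : eqType) (s : seq I) (F F' : I -> H) (e : R) : s != [::] ->
  (forall i, i \in s -> `|F i - F' i| <= e) -> `|mean s F - mean s F'| <= e.
Proof.
move=> s0 FF'; have n0 : 0 < (size s)%:R :> R by rewrite ltr0n lt0n size_eq0.
rewrite /mean -scalerBr -sumrB normrZ gtr0_norm ?invr_gt0//.
rewrite ler_pdivrMl// (le_trans (ler_norm_sum _ _ _))//.
rewrite big_seq (le_trans (ler_sum _ FF'))// -big_seq.
by rewrite big_const_seq count_predT iter_addr addr0 mulr_natl.
Qed.

Lemma mean_const (I : eqType) (s : seq I) w : s != [::] -> mean s (fun=> w) = w.
Proof.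
move=> s0; have n0 : (size s)%:R != 0 :> R by rewrite pnatr_eq0 size_eq0.
rewrite /mean big_const_seq count_predT iter_addr addr0 -[w *+ _]scaler_nat scalerA.
by rewrite mulVf// scale1r.
Qed.

Lemma mean_map (I J : Type) (s : seq I) (f : I -> J) F : mean (map f s) F = mean s (F \o f).
Proof. by rewrite /mean size_map big_map. Qed.

Lemma mean_perm (I : eqType) (s t : seq I) F : perm_eq s t -> mean s F = mean t F.
Proof. by move=> st; rewrite /mean (perm_size st) (perm_big _ st). Qed.

Lemma mean_exchange (I J : Type) (s : seq I) (t : seq J) F :
  mean s (fun i => mean t (F i)) = mean t (fun j => mean s (F^~ j)).
Proof.
rewrite /mean (eq_bigr (fun i => (size t)%:R^-1 *: \sum_(j <- t) F i j)) => [|//].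
rewrite -scaler_sumr exchange_big /= !scaler_sumr; apply: eq_bigr => j _.
by rewrite !scalerA mulrC.
Qed.

Variable T : tree.
Hypothesis T_locally_finite : locally_finite T.
Variable G : set (aut T).
Hypothesis G_subgroup : subgroup G.
Hypothesis G_closed : closed G.
Variable pi : aut T -> H -> H.
Hypothesis pi_continuous : continuous_rep G pi.
Hypothesis B_preserved : preserves_form G pi B.
Implicit Types (g : aut T) (x y : T) (L : set (aut T)).

Lemma piD g u v : G g -> pi g (u + v) = pi g u + pi g v.
Proof. by move=> Gg; have [+ _] := rep_linear pi_continuous Gg; exact. Qed.

Lemma pi_ract g v a : G g -> pi g (ract v a) = ract (pi g v) a.
Proof. by move=> Gg; have [_] := rep_linear pi_continuous Gg; exact. Qed.

Lemma piZ g r v : G g -> pi g (r *: v) = r *: pi g v.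
Proof. by move=> Gg; rewrite -!ract_real pi_ract. Qed.

Lemma pi_0 g : G g -> pi g 0 = 0.
Proof. by move=> Gg; rewrite -(scale0r 0) piZ// !scale0r. Qed.

Lemma piN g v : G g -> pi g (- v) = - pi g v.
Proof. by move=> Gg; rewrite -[- v]scaleN1r piZ// scaleN1r. Qed.

Lemma piB g u v : G g -> pi g (u - v) = pi g u - pi g v.
Proof. by move=> Gg; rewrite piD// piN. Qed.

Lemma pi_sum g I (s : seq I) (F : I -> H) : G g ->
  pi g (\sum_(i <- s) F i) = \sum_(i <- s) pi g (F i).
Proof. by move=> Gg; apply: (big_morph (pi g)) => [v w|]; rewrite (piD, pi_0). Qed.

Lemma piM g h v : G g -> G h -> pi (g * h)%g v = pi g (pi h v).
Proof. by move=> Gg Gh; rewrite (rep_mul pi_continuous). Qed.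

Lemma pi1 v : pi 1%g v = v.
Proof. exact: (rep_one pi_continuous). Qed.

Lemma piKV g : G g -> cancel (pi (g^-1)%g) (pi g).
Proof. by move=> Gg v; rewrite -piM ?mulgV ?pi1//; exact: GV. Qed.

Lemma b_pi g u w : G g -> b (pi g u) (pi g w) = b u w.
Proof. by move=> Gg; rewrite /b B_preserved. Qed.

Lemma b_pil g u w : G g -> b (pi g u) w = b u (pi (g^-1)%g w).
Proof. by move=> Gg; rewrite -{1}(piKV Gg w) b_pi. Qed.

Lemma pi_dist g : G g -> exists2 M, 0 < M & forall u v, `|pi g u - pi g v| <= M * `|u - v|.
Proof.
move=> Gg; have [M MP] := rep_bounded pi_continuous Gg.
exists (`|M| + 1) => [|u v]; first by rewrite ltr_wpDl.
by rewrite -piB// (le_trans (MP _))// ler_wpM2r// (le_trans (ler_norm M))// lerDl.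
Qed.

Definition fixed L v := forall g, L g -> pi g v = v.

(* The subgroups of the compact open subgroups of [G]. *)
Definition elliptic L :=
  [/\ subgroup L, L `<=` G & exists x, forall g, L g -> g x = x].

Lemma fixedD L u v : elliptic L -> fixed L u -> fixed L v -> fixed L (u + v).
Proof. by move=> [_ LG _] Lu Lv g Lg; rewrite piD ?Lu ?Lv//; exact: LG. Qed.

Lemma fixed_ract L v a : elliptic L -> fixed L v -> fixed L (ract v a).
Proof. by move=> [_ LG _] Lv g Lg; rewrite pi_ract ?Lv//; exact: LG. Qed.

Lemma fixedZ L r v : elliptic L -> fixed L v -> fixed L (r *: v).
Proof. by rewrite -ract_real; exact: fixed_ract. Qed.

Lemma fixedB L u v : elliptic L -> fixed L u -> fixed L v -> fixed L (u - v).
Proof.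
by move=> eL Lu Lv; apply: fixedD => //; rewrite -scaleN1r; exact: fixedZ.
Qed.

Lemma ball_seq x n : exists A : seq T, forall z,
  (z \in A) <-> (exists2 q, path (@adj T) x q /\ last x q = z & (size q <= n)%N).
Proof.
have [s sP] := finite_ball T_locally_finite x n.
exists [seq z <- s | `[< exists2 q, path (@adj T) x q /\ last x q = z & (size q <= n)%N >]].
move=> z; rewrite mem_filter; split => [/andP[/asboolP]//|zn].
by apply/andP; split; [exact/asboolP|have [q [xq <-] qn] := zn; exact: sP].
Qed.

Lemma finite_images L (s : seq T) :
  (forall z, z \in s -> exists u : seq T, forall g, L g -> g z \in u) ->
  exists U : seq (seq T), forall g, L g -> map g s \in U.
Proof.
elim: s => [_|z s IH sL]; first by exists [:: [::]].
have [|U UP] := IH; first by move=> y ys; apply: sL; rewrite inE ys orbT.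
have [u uP] := sL z (mem_head _ _).
exists [seq y :: t | y <- u, t <- U] => g Lg /=.
by apply: allpairs_f; [exact: uP|exact: UP].
Qed.

Section Average.
Variables (L : set (aut T)) (x : T).
Hypothesis L_subgroup : subgroup L.
Hypothesis L_sub : L `<=` G.
Hypothesis Lx : forall g, L g -> g x = x.

Let L1 : L 1%g. Proof. exact: G1. Qed.
Let LM g h : L g -> L h -> L (g * h)%g. Proof. exact: GM. Qed.
Let LV g : L g -> L (g^-1)%g. Proof. exact: GV. Qed.

Definition invariant_seq (A : seq T) := forall g z, L g -> z \in A -> g z \in A.

(** Representatives of the left cosets in [L] of the elements fixing [A]: two elements lie in the
    same coset exactly when they agree on [A]. *)
Definition transversal (A : seq T) (s : seq (aut T)) :=
  [/\ s != [::], (forall g, g \in s -> L g),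
      uniq [seq map g A | g <- s] &
      forall g, L g -> exists2 h, h \in s & map h A = map g A].

Lemma transversal_exists A : invariant_seq A -> exists s, transversal A s.
Proof.
move=> AL.
have [U UP] : exists U : seq (seq T), forall g, L g -> map g A \in U.
  by apply: finite_images => z zA; exists A => g Lg; exact: AL.
pose E := [seq t <- undup U | `[< exists2 g, L g & map g A = t >]].
have EP t : t \in E <-> exists2 g, L g & map g A = t.
  rewrite mem_filter mem_undup; split => [/andP[/asboolP]//|h].
  by apply/andP; split; [exact/asboolP|have [g Lg <-] := h; exact: UP].
have /choice[f fP] : forall t, exists g, t \in E -> L g /\ map g A = t.
  move=> t; have [/EP[g Lg gt]|tE] := boolP (t \in E); first by exists g.
  by exists 1%g.
have imE : [seq map g A | g <- map f E] = E.
  rewrite -map_comp -[RHS]map_id; by apply/eq_in_map => t /fP[].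
exists (map f E); split.
- have : map (1%g : aut T) A \in E by apply/EP; exists 1%g.
  by case: (E).
- by move=> _ /mapP[t /fP[Lf _] ->].
- by rewrite imE filter_uniq// undup_uniq.
- move=> g Lg; have gE : map g A \in E by apply/EP; exists g.
  by exists (f (map g A)); [exact: map_f|have [] := fP _ gE].
Qed.

Definition small_oscillation (A : seq T) v (e : R) := forall g h, L g -> L h ->
  {in A, forall z, g z = h z} -> `|pi g v - pi h v| <= e.

(** Both lists represent the same cosets, so a permutation pairs elements agreeing on [A]. *)
Lemma mean_transversal A s t v e : transversal A s -> transversal A t ->
  small_oscillation A v e -> `|mean s (pi^~ v) - mean t (pi^~ v)| <= e.
Proof.
move=> [s0 sL su sc] [t0 tL tu tc] osc.
have /choice[f fP] : forall g, exists h, g \in s -> h \in t /\ map h A = map g A.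
  move=> g; have [/sL/tc[h ht hg]|gs] := boolP (g \in s); first by exists h.
  by exists g.
have ps : perm_eq (map f s) t.
  have imf : [seq map g A | g <- map f s] = [seq map g A | g <- s].
    by rewrite -map_comp; apply/eq_in_map => g /fP[].
  apply: uniq_perm; first by apply: (@map_uniq _ _ (fun g : aut T => map g A)); rewrite imf.
    exact: map_uniq tu.
  move=> h; apply/idP/idP => [/mapP[g gs ->]|ht]; first by have [] := fP g gs.
  have [g gs gh] := sc h (tL h ht); have [fgt fg] := fP g gs.
  suff -> : h = f g by exact: map_f.
  rewrite gh in fg; rewrite -(nth_index h ht) -(nth_index h fgt); congr nth.
  apply/eqP; rewrite -(nth_uniq (map h A) _ _ tu) ?size_map ?index_mem//.
  by rewrite !(nth_map h) ?index_mem// !nth_index// fg.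
rewrite -(mean_perm _ ps) mean_map; apply: mean_dist => // g gs /=.
have [fgt fg] := fP g gs; apply: osc; [exact: sL|exact: tL|].
by move=> z zA; have /eq_in_map := fg => /(_ z zA).
Qed.

Lemma transversal_translate A s g : transversal A s -> L g ->
  transversal A [seq (g * h)%g | h <- s].
Proof.
move=> [s0 sL su sc] Lg; split.
- by case: (s) s0.
- by move=> _ /mapP[h /sL Lh ->]; exact: LM.
- rewrite -map_comp; have -> : [seq map (g * h)%g A | h <- s] = map (map g) [seq map (h : aut T) A | h <- s].
    by rewrite -map_comp; apply: eq_map => h /=; rewrite -map_comp.
  by rewrite map_inj_uniq//; apply: inj_map; exact: can_inj (autVK g).
- move=> h Lh; have [h' h's h'E] := sc _ (LM (LV Lg) Lh).
  exists (g * h')%g; first exact: map_f.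
  have -> : map (g * h')%g A = map g (map h' A) by rewrite -map_comp.
  rewrite h'E -map_comp; apply: eq_map => z /=; by rewrite aut_invK.
Qed.

(** By invariance of [A], [h g] and [h' g] agree on [A] exactly when [h] and [h'] do. *)
Lemma transversal_translater A s g : invariant_seq A -> transversal A s -> L g ->
  transversal A [seq (h * g)%g | h <- s].
Proof.
move=> AL [s0 sL su sc] Lg.
have key h h' : map (h * g)%g A = map (h' * g)%g A <-> map h A = map h' A.
  split=> /eq_in_map hh'; apply/eq_in_map => z zA.
    have := hh' ((g^-1)%g z) (AL _ _ (LV Lg) zA).
    by rewrite !autM !autKV.
  by rewrite !autM hh'//; exact: AL.
split.
- by case: (s) s0.
- by move=> _ /mapP[h /sL Lh ->]; exact: LM.
- rewrite -map_comp map_inj_in_uniq ?(map_uniq su)// => h h' hs h's /= /key hh'.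
  rewrite -(nth_index h hs) -(nth_index h h's); congr nth.
  apply/eqP; rewrite -(nth_uniq (map h A) _ _ su) ?size_map ?index_mem//.
  by rewrite !(nth_map h) ?index_mem// !nth_index// hh'.
- move=> h Lh; have [h' h's h'E] := sc _ (LM Lh (LV Lg)).
  exists (h' * g)%g; first exact: map_f.
  have -> : h = (h * g^-1 * g)%g by rewrite -mulgA mulVg mulg1.
  exact/key.
Qed.

Lemma transversal_mean_fixed A s v e g : transversal A s -> small_oscillation A v e ->
  L g -> `|pi g (mean s (pi^~ v)) - mean s (pi^~ v)| <= e.
Proof.
move=> As osc Lg.
have -> : pi g (mean s (pi^~ v)) = mean [seq (g * h)%g | h <- s] (pi^~ v).
  rewrite mean_map /mean piZ ?pi_sum; [|exact: L_sub..].
  congr (_ *: _); apply: eq_big_seq => h hs /=; rewrite piM//; apply: L_sub => //.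
  by have [_ + _ _] := As; exact.
by apply: mean_transversal osc => //; exact: transversal_translate.
Qed.

(** Both means are close to the double mean over [s'] and [s]: left translates of [s] and right
    translates of [s'] are again transversals. *)
Lemma transversal_mean_cauchy A A' s s' v e : invariant_seq A' ->
  transversal A s -> transversal A' s' ->
  small_oscillation A v e -> small_oscillation A' v e ->
  `|mean s (pi^~ v) - mean s' (pi^~ v)| <= e + e.
Proof.
move=> A'L As A's' osc osc'.
have [s0 sL _ _] := As; have [s'0 s'L _ _] := A's'.
set m := mean s _; set m' := mean s' _.
have D1 : `|mean s' (fun g => mean s (fun h => pi g (pi h v))) - m| <= e.
  rewrite -(mean_const m s'0); apply: mean_dist => // g gs' /=.
  have -> : mean s (fun h => pi g (pi h v)) = pi g m.
    by rewrite /m /mean piZ ?pi_sum//; exact/L_sub/s'L.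
  by apply: transversal_mean_fixed As osc _; exact: s'L.
have D2 : `|mean s' (fun g => mean s (fun h => pi g (pi h v))) - m'| <= e.
  rewrite mean_exchange -(mean_const m' s0); apply: mean_dist => // h hs /=.
  have -> : mean s' (fun g => pi g (pi h v)) = mean [seq (g * h)%g | g <- s'] (pi^~ v).
    rewrite mean_map /mean; congr (_ *: _); apply: eq_big_seq => g gs' /=.
    by rewrite piM//; apply: L_sub; [exact: s'L|exact: sL].
  apply: mean_transversal osc' => //; apply: transversal_translater => //; exact: sL.
rewrite -(subrKA (mean s' (fun g => mean s (fun h => pi g (pi h v))))).
by rewrite (le_trans (ler_normD _ _))// lerD// distrC.
Qed.

(** Finite means over transversals for the balls centered at [x] converge; their limit plays the
    role of the Haar integral of [pi g v] over [L]. *)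
Lemma haar : exists s : nat -> seq (aut T), exists P : H -> H,
  [/\ forall n, s n != [::], forall n g, g \in s n -> L g &
      forall v, fixed L (P v) /\ mean (s n) (pi^~ v) @[n --> \oo] --> P v].
Proof.
have [A AP] := choice (ball_seq x).
have AL n : invariant_seq (A n).
  move=> g z Lg /AP[q [xq <-] qn]; apply/AP; exists (map g q); last by rewrite size_map.
  split; last by rewrite -{1}(Lx Lg) last_map.
  by rewrite -{1}(Lx Lg) path_map; apply: sub_path xq => y w /=; rewrite aut_adj.
have [s sP] := choice (fun n => transversal_exists (AL n)).
have osc v e : 0 < e -> exists N, forall n, (N <= n)%N -> small_oscillation (A n) v e.
  move=> e0; have [t tP] := @stabilizer_uniform_continuity T T_locally_finite R H G x
    (pi^~ v) e G_subgroup G_closed (@rep_continuous _ _ _ _ _ _ pi_continuous v) e0.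
  have [N NP] : exists N, forall z, z \in t -> z \in A N.
    elim: t {tP} => [|z t [N IH]]; first by exists 0%N.
    have [q xq qz] := tree_connected x z; exists (N + size q)%N => y.
    rewrite inE => /orP[/eqP->|/IH/AP[r xr rN]].
      by apply/AP; exists q => //; exact: leq_addl.
    by apply/AP; exists r => //; exact: leq_trans (leq_addr _ _).
  exists N => n Nn g h Lg Lh gh; apply/ltW/tP.
  - exact: L_sub.
  - exact: L_sub.
  - exact: Lx.
  - exact: Lx.
  - move=> z /NP /AP[q xq qN]; apply: gh; apply/AP; exists q => //.
    exact: leq_trans Nn.
have lim v : exists m : H, mean (s n) (pi^~ v) @[n --> \oo] --> m.
  apply/cvg_ex/cauchy_cvgP/cauchyP => e e0.
  have e3 : 0 < e / 3 by rewrite divr_gt0.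
  have [N NP] := osc v _ e3; exists (mean (s N) (pi^~ v)).
  exists N => // n /= Nn; rewrite -ball_normE /=.
  apply: le_lt_trans (transversal_mean_cauchy (AL n) (sP N) (sP n) (NP N (leqnn N)) (NP n Nn)) _.
  by rewrite -mulrDl; lra.
have [P PP] := choice lim.
exists s, P; split.
- by move=> n; have [] := sP n.
- by move=> n; have [] := sP n.
move=> v; split => // g Lg; have Gg := L_sub Lg.
have [M M0 MP] := pi_dist Gg.
apply/eqP; rewrite -subr_eq0 -normr_le0; apply/ler_addgt0Pl => e e0; rewrite addr0.
have e3 : 0 < e / 3 by rewrite divr_gt0.
have [N NP] := osc v _ e3.
have M3 : 0 < e / 3 / (M + 1) by rewrite divr_gt0// addr_gt0.
have : \forall n \near \oo, (N <= n)%N /\ `|P v - mean (s n) (pi^~ v)| < e / 3 / (M + 1).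
  apply: filterI; first exact: nbhs_infty_ge.
  by have /cvgrPdist_lt/(_ _ M3) := PP v.
move=> /filter_ex[n [Nn dn]]; set m := mean (s n) _ in dn.
rewrite -(subrKA (pi g m)) -[pi g m - P v](subrKA m).
have h1 : `|pi g (P v) - pi g m| <= e / 3.
  rewrite (le_trans (MP _ _))// (le_trans (ler_wpM2l (ltW M0) (ltW dn)))//.
  rewrite mulrCA ler_piMr ?(ltW e3)// ler_pdivrMr ?addr_gt0// mul1r lerDl//.
have h2 : `|pi g m - m| <= e / 3 by apply: transversal_mean_fixed (sP n) (NP n Nn) Lg.
have h3 : `|m - P v| <= e / 3.
  rewrite distrC (le_trans (ltW dn))// ler_piMr ?(ltW e3)// invf_le1 ?addr_gt0//.
  by rewrite lerDr ltW.
rewrite (le_trans (ler_normD _ _))// (le_trans (lerD h1 (le_trans (ler_normD _ _) (lerD h2 h3))))//.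
by lra.
Qed.

End Average.

(** The last clause passes to the averages any relation between matrix coefficients valid for each
    [g]. With [u' = 0] it gives [b_proj]; with [c = 0] it gives the symmetry of products of Hecke
    operators. *)
Lemma haar_proj L : elliptic L -> exists P : H -> H,
  [/\ forall v, fixed L (P v),
      forall v (e : R), (forall g, L g -> `|pi g v - v| <= e) -> `|P v - v| <= e &
      forall u w u' w' (c : R), (forall g, L g -> b (pi g u) w = b (pi g u') w' + c) ->
        b (P u) w = b (P u') w' + c].
Proof.
move=> [sL LG [x Lx]]; have [s [P [s0 sLn PP]]] := haar sL LG Lx.
exists P; split => [v|v e ve|u w u' w' c E]; first by have [] := PP v.
  have [_ Pv] := PP v.
  apply/ler_addgt0Pl => d d0.
  have /cvgrPdist_lt/(_ _ d0) := Pv.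
  move=> /filter_ex[n /= dn]; set m := mean (s n) _ in dn.
  rewrite -(subrKA m) (le_trans (ler_normD _ _))// lerD//; first exact: ltW.
  by rewrite -(mean_const v (s0 n)); apply: mean_dist => // g /sLn; exact: ve.
have bm n v z : b (mean (s n) (pi^~ v)) z = (size (s n))%:R^-1 * \sum_(g <- s n) b (pi g v) z.
  by rewrite /mean bZl b_suml.
have lim v z : b (mean (s n) (pi^~ v)) z @[n --> \oo] --> b (P v) z.
  have [_ Pv] := PP v; rewrite bC.
  under eq_cvg do rewrite bC.
  by apply: (@cvg_comp _ _ _ _ (b z) _ _ _ Pv); exact: b_continuous.
apply: (@cvg_unique _ _ (b (mean (s n) (pi^~ u)) w @[n --> \oo])) => //.
  exact: lim.
have -> : (fun n => b (mean (s n) (pi^~ u)) w) = (fun n => b (mean (s n) (pi^~ u')) w' + c).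
  apply/funext => n; rewrite !bm.
  have n0 : (size (s n))%:R != 0 :> R by rewrite pnatr_eq0 size_eq0.
  rewrite (eq_big_seq (fun g => b (pi g u') w' + c)) => [|g /sLn /E//].
  by rewrite big_split /= big_const_seq count_predT iter_addr addr0 -[c *+ _]mulr_natl mulrDr mulKf.
by apply: cvgD; [exact: lim|exact: cvg_cst].
Qed.

(** * Projections onto fixed vectors *)

Definition proj L : H -> H :=
  if pselect (elliptic L) is left eL then sval (cid (haar_proj eL)) else id.

Lemma proj_fixed L v : elliptic L -> fixed L (proj L v).
Proof. by rewrite /proj => eL; case: pselect => // ?; case: cid => P [] /=. Qed.

Lemma proj_dist L v (e : R) : elliptic L -> (forall g, L g -> `|pi g v - v| <= e) ->
  `|proj L v - v| <= e.
Proof.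
by rewrite /proj => eL; case: pselect => // ?; case: cid => P [] /= _ + _; exact.
Qed.

Lemma proj_average L u w u' w' (c : R) : elliptic L ->
  (forall g, L g -> b (pi g u) w = b (pi g u') w' + c) ->
  b (proj L u) w = b (proj L u') w' + c.
Proof.
by rewrite /proj => eL; case: pselect => // ?; case: cid => P [] /= _ _; exact.
Qed.

Lemma b_proj L v w : elliptic L -> fixed L w -> b (proj L v) w = b v w.
Proof.
move=> eL Lw; have [_ LG _] := eL.
have -> : b v w = b (proj L 0) w + b v w.
  suff -> : proj L 0 = 0 by rewrite b0l add0r.
  apply/eqP; rewrite -normr_le0 -[proj L 0]subr0; apply: proj_dist => // g /LG Gg.
  by rewrite pi_0// subrr normr0.
apply: proj_average => // g Lg; have Gg := LG g Lg.
by rewrite pi_0// b0l add0r -{1}(Lw g Lg) b_pi.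
Qed.

Definition perp L v := forall w, fixed L w -> b v w = 0.

(** Pairing a fixed vector with [w] or with [proj L w] is the same, so [b] stays nondegenerate on
    the fixed vectors although it is indefinite. *)
Lemma fixed_perp0 L v : elliptic L -> fixed L v -> perp L v -> v = 0.
Proof.
move=> eL Lv Pv; apply: b_nondegenerate => w.
by rewrite bC -(b_proj w eL Lv) bC Pv//; exact: proj_fixed.
Qed.

Lemma perp_proj L v : elliptic L -> perp L (v - proj L v).
Proof. by move=> eL w Lw; rewrite bBl b_proj// subrr. Qed.

Lemma proj_unique L v m : elliptic L -> fixed L m -> (forall w, fixed L w -> b m w = b v w) ->
  proj L v = m.
Proof.
move=> eL Lm mv; apply/eqP; rewrite -subr_eq0; apply/eqP.
apply: (fixed_perp0 eL); first by apply: fixedB => //; exact: proj_fixed.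
by move=> w Lw; rewrite bBl b_proj// mv// subrr.
Qed.

Lemma b_split L v : elliptic L ->
  b v v = b (v - proj L v) (v - proj L v) + b (proj L v) (proj L v).
Proof.
move=> eL; have Pf := proj_fixed v eL.
by rewrite bBr (perp_proj v eL Pf) subr0 [b (proj L v) (proj L v)]b_proj// bBl [b (proj L v) v]bC subrK.
Qed.

Lemma fixedS L L' v : L' `<=` L -> fixed L v -> fixed L' v.
Proof. by move=> LL Lv g /LL /Lv. Qed.

Lemma fixed_conj L L' g v : G g -> L' `<=` G ->
  (forall h, L h -> L' (g^-1 * h * g)%g) -> fixed L' v -> fixed L (pi g v).
Proof.
move=> Gg LG LL' Lv h Lh; have Gh' := LG _ (LL' h Lh).
have Gh : G h.
  have -> : h = (g * (g^-1 * h * g) * g^-1)%g by rewrite !mulgA mulgV mul1g mulgK.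
  by apply: (GM G_subgroup); [exact: (GM G_subgroup)|exact: (GV G_subgroup)].
rewrite -piM// -[RHS](congr1 (pi g) (Lv _ (LL' h Lh))) -piM//.
by rewrite !mulgA mulgV mul1g.
Qed.

(** An element normalizing [L] commutes with the projection; this is derived from the
    characterization in [proj_unique]. *)
Lemma proj_conj L g w : elliptic L -> G g -> (forall h, L h <-> L (g^-1 * h * g)%g) ->
  pi g w = w -> pi g (proj L w) = proj L w.
Proof.
move=> eL Gg Lg gw; have [_ LG _] := eL.
symmetry; apply: proj_unique => //.
  apply: (@fixed_conj L L) => //; [by move=> h /Lg|exact: proj_fixed].
move=> z Lz; rewrite b_pil// b_proj//; last first.
  apply: (@fixed_conj L L) => //; first exact: GV.
  by move=> h Lh; rewrite invgK; apply/Lg; rewrite !mulgA mulVg mul1g -mulgA mulVg mulg1.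
by rewrite -b_pil// gw.
Qed.

Lemma elliptic_fixator (S : set T) x : S x -> elliptic (fixator G S).
Proof.
have [G1' GM' GV'] := G_subgroup.
move=> Sx; split; [split|by move=> g []|by exists x => g [_]; exact].
- by split.
- move=> g h [Gg gS] [Gh hS]; split; first exact: GM'.
  by move=> z Sz; rewrite autM hS// gS.
- move=> g [Gg gS]; split; first exact: GV'.
  by move=> z Sz; apply: autV_fix; exact: gS.
Qed.

Hypothesis G_good : forall x y : T, adj x y -> good G x y.
Hypothesis T_degree : forall x : T, (`I_3 #<= neighbors x)%card.
Hypothesis G_unbounded : forall x n, exists g q,
  [/\ G g, geod (x :: q), last x q = g x & (n <= size q)%N].
Hypothesis G_property_P : Tits_property_P G.

(** * Localization of the negative vectors *)

(** Each new element is the inverse of one pushing all earlier translates of [A] into the half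
    tree. *)
Lemma far_translates x y (A : seq T) n : adj x y -> exists s : nat -> aut T,
  (forall i, G (s i)) /\ forall i j, (i < j < n)%N -> forall z, z \in A ->
    half_tree x y ((s j)^-1%g (s i z)).
Proof.
move=> xy; elim: n => [|n [s [sG sP]]].
  by exists (fun=> 1%g); split => [_|i j]; [exact: G1|rewrite ltn0 andbF].
have [g Gg gP] := push_into_half_tree G_subgroup T_degree G_good G_unbounded
  [seq s i z | i <- iota 0 n, z <- A] xy.
exists (fun i => if (i < n)%N then s i else (g^-1)%g); split.
  by move=> i; case: ifP => // _; exact: GV.
move=> i j /andP[ij]; rewrite ltnS leq_eqVlt => /orP[/eqP jn|jn] z zA; last first.
  by rewrite jn (ltn_trans ij jn); apply: sP => //; rewrite ij.
rewrite jn ltnn -jn ij invgK; apply: gP; apply: allpairs_f => //.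
by rewrite mem_iota add0n -jn.
Qed.

(* If [b v v < 0], then suitable translates of [v] span a negative definite
   subspace of dimension [p + 1]. *)
Lemma positive_smooth x y (A : seq T) v : adj x y ->
  perp (fixator G (half_tree x y)) v -> fixed (fixator G [set z | z \in A]) v ->
  0 <= b v v.
Proof.
move=> xy vp vA; rewrite leNgt; apply/negP => v0.
have [s [sG sP]] := far_translates A p.+1 xy.
pose r := (Num.sqrt (- b v v))^-1.
have r0 : 0 < - b v v by rewrite oppr_gt0.
have orth i j c d : (i < j < p.+1)%N -> B (ract (pi (s i) v) c) (ract (pi (s j) v) d) = 0.
  move=> ijp; rewrite BMl BMr; suff -> : B (pi (s i) v) (pi (s j) v) = 0 by rewrite mul0r mulr0.
  (* This element carries [A] into the half tree, so the translate of [v] is fixed by the fixator of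
     the half tree, to whose fixed vectors [v] is orthogonal. *)
  pose g := ((s j)^-1 * s i)%g.
  have Gg : G g by apply: (GM G_subgroup) => //; exact: (GV G_subgroup).
  have GVj : G ((s j)^-1)%g by exact: (GV G_subgroup).
  apply: B_eq0 => a; rewrite bC b_pil//; apply: vp; rewrite pi_ract//.
  apply: fixed_ract; first exact: (elliptic_fixator (half_treel x y)).
  rewrite -piM//; apply: (@fixed_conj _ (fixator G [set z | z \in A])) => //.
    by move=> h [].
  move=> h [Gh hx]; split.
    by apply: (GM G_subgroup) => //; apply: (GM G_subgroup) => //; exact: (GV G_subgroup).
  move=> z zA; have hg : h (g z) = g z by apply: hx; exact: sP.
  by rewrite -[LHS]/((g^-1)%g (h (g z))) hg autVK.
pose u (i : 'I_p.+1) := r *: pi (s i) v.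
suff /negfam_le : negfam u by rewrite ltnn.
move=> i j; rewrite /u -!ract_real; have [->|ij] := eqVneq i j.
  rewrite B_self !ract_real bZl bZr b_pi// mulrA -expr2 exprVn sqr_sqrtr ?ltW//.
  rewrite -[b v v in X in _ * X]opprK mulrN mulVf ?gt_eqF//.
  by apply: (@addrI _ (sreal k 1)); rewrite -srealD subrr sreal0 sreal1 subrr.
have [lt|lt|/val_inj/eqP] := ltngtP i j; last by rewrite (negbTE ij).
  by apply: orth; rewrite lt ltn_ord.
by rewrite B_hermitian orth ?sconj0// lt ltn_ord.
Qed.

(** Averaging over the fixator of a large ball replaces [v] by a nearby vector to which
    [positive_smooth] applies. It remains orthogonal to the vectors fixed by [L], because [L] fixes
    the center [x], so preserves the ball and normalizes its fixator. *)
Lemma positive_half_tree x y v : adj x y -> perp (fixator G (half_tree x y)) v ->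
  0 <= b v v.
Proof.
move=> xy vp; rewrite leNgt; apply/negP => v0.
have : \forall w \near v, b w w < 0.
  by have /cvgr_lt/(_ _ v0) := @b_diag_continuous v.
move=> /nbhs_normP[d d0 dv].
have d2 : 0 < d / 2 by rewrite divr_gt0.
have [t tP] : exists t : seq T, forall g, G g -> {in t, forall z, g z = z} ->
    `|pi g v - v| < d / 2.
  have [t tP] := @stabilizer_uniform_continuity T T_locally_finite R H G x
    (pi^~ v) (d / 2) G_subgroup G_closed (@rep_continuous _ _ _ _ _ _ pi_continuous v) d2.
  exists (x :: t) => g Gg gt; rewrite -{2}(pi1 v); apply: tP => //.
  - exact: (G1 G_subgroup).
  - by apply: gt; rewrite mem_head.
  - by move=> z zt; apply: gt; rewrite inE zt orbT.
have [N NP] : exists N, forall z, z \in t ->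
    exists2 q, path (@adj T) x q /\ last x q = z & (size q <= N)%N.
  elim: t {tP} => [|z t [N IH]]; first by exists 0%N.
  have [q xq qz] := tree_connected x z; exists (N + size q)%N => w.
  rewrite inE => /orP[/eqP->|/IH[r xr rN]]; first by exists q => //; exact: leq_addl.
  by exists r => //; exact: leq_trans (leq_addr _ _).
have [A AP] := ball_seq x N.
set L := fixator G (half_tree x y) in vp *; set L' := fixator G [set z | z \in A].
have eL : elliptic L := elliptic_fixator (half_treel x y).
have xA : x \in A by apply/AP; exists [::].
have eL' : elliptic L' by apply: (@elliptic_fixator _ x).
have AL g z : G g -> g x = x -> z \in A -> g z \in A.
  move=> Gg gx /AP[q [xq <-] qN]; apply/AP; exists (map g q); last by rewrite size_map.
  split; last by rewrite -[X in last X _]gx last_map.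
  by rewrite -[X in path _ X _]gx path_map; apply: sub_path xq => ? w /=; rewrite aut_adj.
have Pv : `|v - proj L' v| < d.
  rewrite distrC; apply: (@le_lt_trans _ _ (d / 2)); last by rewrite ltr_pdivrMr// ltr_pMr// ltr1n.
  apply: proj_dist => // g [Gg gA]; apply/ltW/tP => // z /NP zN.
  by apply: gA; apply/AP.
have := dv _ Pv; rewrite /= ltNge => /negP; apply.
apply: (positive_smooth xy); last exact: proj_fixed.
move=> w Lw; rewrite bC -(b_proj w eL' (proj_fixed v eL')) bC b_proj//; last exact: proj_fixed.
apply: vp => g Lg; have [Gg gx] := Lg.
apply: proj_conj => //; last exact: Lw.
have gA z : z \in A -> g z \in A by apply: AL => //; apply: gx; exact: half_treel.
have gVA z : z \in A -> (g^-1)%g z \in A.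
  apply: AL; first exact: (GV G_subgroup).
  by apply: autV_fix; apply: gx; exact: half_treel.
move=> h; split=> -[Gh hA]; split.
- by apply: (GM G_subgroup) => //; apply: (GM G_subgroup) => //; exact: (GV G_subgroup).
- by move=> z zA; rewrite -[LHS]/((g^-1)%g (h (g z))) hA ?autVK//; exact: gA.
- have -> : h = (g * (g^-1 * h * g) * g^-1)%g by rewrite !mulgA mulgV mul1g mulgK.
  by apply: (GM G_subgroup); [exact: (GM G_subgroup)|exact: (GV G_subgroup)].
- move=> z zA; have := hA _ (gVA z zA); rewrite -[LHS]/((g^-1)%g (h (g ((g^-1)%g z)))).
  by rewrite autKV => /(congr1 g); rewrite !autKV.
Qed.

(** The two fixators normalize each other, so projecting for one and then the other gives a vector
    fixed by both, hence by the fixator of the edge thanks to Property (P). Being also orthogonal to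
    the vectors fixed there, it vanishes; so [v] splits into two parts, each covered by one half
    tree. *)
Lemma positive_edge x y v : adj x y -> perp (fixator G [set x; y]) v -> 0 <= b v v.
Proof.
move=> xy vp; have yx : adj y x by rewrite adjC.
set L := fixator G (half_tree x y); set L' := fixator G (half_tree y x).
have eL : elliptic L := elliptic_fixator (half_treel x y).
have eL' : elliptic L' := elliptic_fixator (half_treel y x).
have eLe : elliptic (fixator G [set x; y]) by apply: (@elliptic_fixator _ x); left.
rewrite (b_split v eL) addr_ge0//; first by apply: (positive_half_tree xy); exact: perp_proj.
set m := proj L v.
apply: (positive_half_tree yx) => w L'w.
pose m' := proj L' m.
suff m'0 : m' = 0.
  by rewrite -(b_proj m eL' L'w) -/m' m'0 b0l.
have Lm' : fixed L m'.
  move=> g Lg; have [Gg gx] := Lg; apply: proj_conj => //; last exact: proj_fixed.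
  have gxx : g x = x by apply: gx; exact: half_treel.
  have gyy : g y = y by apply: gx; exact: half_treer.
  move=> h; split=> -[Gh hA]; split.
  - by apply: (GM G_subgroup) => //; apply: (GM G_subgroup) => //; exact: (GV G_subgroup).
  - move=> z zA; rewrite -[LHS]/((g^-1)%g (h (g z))) hA ?autVK//.
    exact: half_tree_aut.
  - have -> : h = (g * (g^-1 * h * g) * g^-1)%g by rewrite !mulgA mulgV mul1g mulgK.
    by apply: (GM G_subgroup); [exact: (GM G_subgroup)|exact: (GV G_subgroup)].
  - move=> z zA; have := hA _ (half_tree_aut (autV_fix gyy) (autV_fix gxx) zA).
    rewrite -[LHS]/((g^-1)%g (h (g ((g^-1)%g z)))).
    by rewrite autKV => /(congr1 g); rewrite !autKV.
have L'm' : fixed L' m' by exact: proj_fixed.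
apply: (fixed_perp0 eLe).
  move=> g; rewrite (G_property_P xy) => -[h Lh [h' L'h' <-]].
  by have [Gh _] := Lh; have [Gh' _] := L'h'; rewrite piM// L'm'// Lm'.
move=> z ez; have Lz : fixed L z.
  by apply: fixedS ez => g [Gg gS]; split => // _ [->|->]; apply: gS; [exact: half_treel|exact: half_treer].
have L'z : fixed L' z.
  by apply: fixedS ez => g [Gg gS]; split => // _ [->|->]; apply: gS; [exact: half_treer|exact: half_treel].
by rewrite /m' b_proj// /m b_proj// vp.
Qed.

Definition stab x := fixator G [set x].

Lemma elliptic_stab x : elliptic (stab x).
Proof. exact: (@elliptic_fixator _ x). Qed.

Lemma elliptic_edge x y : elliptic (fixator G [set x; y]).
Proof. by apply: (@elliptic_fixator _ x); left. Qed.

Lemma stabP x g : stab x g <-> G g /\ g x = x.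
Proof. by split=> -[Gg gx]; split => //; [exact: gx|move=> _ ->]. Qed.

Lemma edgeP x y g : fixator G [set x; y] g <-> [/\ G g, g x = x & g y = y].
Proof.
split=> [[Gg gx]|[Gg gx gy]]; first by split => //; apply: gx; [left|right].
by split => // _ [->|->].
Qed.

Lemma fixed_edge_stab x y v : fixed (stab x) v -> fixed (fixator G [set x; y]) v.
Proof. by apply: fixedS => g /edgeP[Gg gx _]; apply/stabP. Qed.

Lemma perp_edge_stab_eq x y v g h : adj x y -> G g -> G h -> g x = x -> h x = x ->
  g y = h y -> fixed (fixator G [set x; y]) v -> pi g v = pi h v.
Proof.
move=> xy Gg Gh gx hx gy vf.
have GVh := GV G_subgroup Gh.
have e : pi (h^-1 * g)%g v = v.
  apply: vf; apply/edgeP; split; first exact: (GM G_subgroup).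
    by rewrite autM gx; exact: autV_fix.
  by rewrite autM gy autVK.
by rewrite -{2}e -piM ?mulgA ?mulgV ?mul1g//; exact: (GM G_subgroup).
Qed.

(** The translates [F z] of [m], one per neighbor [z], sum to 0 and behave like the vertices of a
    regular simplex. Removing from [m] its component fixed at another edge multiplies [b m m] by
    [1 - q^-2], where [q >= 2] is the degree minus 1; this factor is positive. *)
Lemma positive_vertex x v : perp (stab x) v -> 0 <= b v v.
Proof.
move=> vp; have [y [xy _ _]] := third_neighbor T_degree x x x.
have [y1 [xy1 y1y _]] := third_neighbor T_degree x y y.
have [y2 [xy2 y2y y2y1]] := third_neighbor T_degree x y y1.
have eL := elliptic_edge x y; set L := fixator G _ in eL.
rewrite (b_split v eL) addr_ge0//; first by apply: (positive_edge xy); exact: perp_proj.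
set m := proj L v; have Lm : fixed L m := proj_fixed v eL.
have mp : perp (stab x) m.
  by move=> w xw; rewrite b_proj ?vp//; exact: fixed_edge_stab.
have /finite_seqP[N0 N0E] := T_locally_finite x; pose N := undup N0.
have NE z : (z \in N) = adj x z.
  rewrite mem_undup; apply/idP/idP => [zN|xz].
    by have : [set` N0] z by []; rewrite -N0E.
  by have : neighbors x z by []; rewrite N0E.
have /choice[g gP] : forall z, exists g, z \in N -> [/\ G g, g x = x & g y = z].
  move=> z; have [zN|//] := boolP (z \in N); last by exists 1%g.
  have [|g Gg [gx gy]] := neighbors_transitive G_subgroup T_degree G_good xy (b := z).
    by rewrite -NE.
  by exists g.
pose F z := pi (g z) m.
have FE h z : z \in N -> G h -> h x = x -> h y = z -> pi h m = F z.
  move=> zN Gh hx hy; have [Gg gx gy] := gP z zN.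
  by apply: (perp_edge_stab_eq xy) => //; rewrite hy.
pose S := \sum_(z <- N) F z.
have S0 : S = 0.
  apply: (fixed_perp0 (elliptic_stab x)) => [h /stabP[Gh hx]|w xw].
    rewrite pi_sum// /S (eq_big_seq (F \o h)) => [|z zN]; last first.
      have [Gg gx gy] := gP z zN; rewrite -piM//=; apply: FE.
      - by rewrite NE -{1}hx aut_adj -NE.
      - exact: (GM G_subgroup).
      - by rewrite autM gx.
      - by rewrite autM gy.
    rewrite -(big_map h xpredT F); apply: perm_big; apply: uniq_perm.
    - by rewrite map_inj_uniq ?undup_uniq//; exact: can_inj (autVK h).
    - exact: undup_uniq.
    - move=> z; rewrite NE; apply/mapP/idP => [[z' + ->]|xz].
        by rewrite NE -{2}hx aut_adj.
      by exists ((h^-1)%g z); rewrite ?autKV// NE -(aut_adj h) hx autKV.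
  rewrite b_suml big1_seq// => z /andP[_ /gP[Gg gx gy]].
  by rewrite /F b_pil// xw ?mp//; apply/stabP; split; [exact: (GV G_subgroup)|exact: autV_fix].
have y1N : y1 \in N by rewrite NE.
pose q : R := (size N).-1%:R.
have szN : (2 <= (size N).-1)%N.
  have : (size [:: y; y1; y2] <= size N)%N.
    apply: uniq_leq_size; first by rewrite /= !inE negb_or ![_ == y2]eq_sym (eq_sym y) y1y y2y y2y1.
    by move=> z; rewrite !inE NE => /or3P[] /eqP->.
  by rewrite /=; lia.
have q2 : 2 <= q by rewrite /q ler_nat.
have q0 : 0 < q by lra.
(* By 2-transitivity, the fixator of [y1] in the stabilizer permutes the other neighbors
   transitively, so all other [F z] pair equally with [w]. *)
have F1 w : fixed (fixator G [set x; y1]) w -> b (F y1) w + q * b m w = 0.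
  move=> ew; have := congr1 (b^~ w) S0; rewrite b0l b_suml (bigD1_seq y1) ?undup_uniq//= => <-.
  congr (_ + _); have Fw z : z \in N -> z != y1 -> b (F z) w = b m w.
    move=> zN zy1; have xz : adj x z by rewrite -NE.
    have [||h Gh [hx hy1 hy]] := neighbors_2transitive G_good xy1 xy xz.
    - by rewrite eq_sym.
    - by [].
    rewrite -(FE h)// b_pil// ew//; apply/edgeP.
    by split; [exact: (GV G_subgroup)|exact: autV_fix|exact: autV_fix].
  rewrite big_seq_cond (eq_bigr (fun=> b m w)) => [|z /andP[]]; last exact: Fw.
  rewrite -big_seq_cond; apply: (@addrI _ (b m w)).
  rewrite -(bigD1_seq y1 y1N (undup_uniq _) (F := fun=> b m w)) /=.
  rewrite big_const_seq count_predT iter_addr addr0 /q.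
  have -> : size N = (size N).-1.+1 by case: (N) szN.
  by rewrite mulrS mulr_natl.
pose u := m + q^-1 *: F y1.
have up : perp (fixator G [set x; y1]) u.
  move=> w /F1; rewrite bDl bZl => E.
  have -> : b (F y1) w = - (q * b m w) by lra.
  by rewrite mulrN mulKf ?subrr// gt_eqF.
have F1f : fixed (fixator G [set x; y1]) (F y1).
  have [Gg gx gy] := gP y1 y1N.
  apply: (@fixed_conj _ L) => //; first by move=> ? [].
  move=> h /edgeP[Gh hx hy]; apply/edgeP; split.
  - by apply: (GM G_subgroup) => //; apply: (GM G_subgroup) => //; exact: (GV G_subgroup).
  - by rewrite -[LHS]/(((g y1)^-1)%g (h (g y1 x))) gx hx; exact: autV_fix.
  - rewrite -[LHS]/(((g y1)^-1)%g (h (g y1 y))) gy hy.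
    by have := autVK (g y1) y; rewrite gy.
have := positive_edge xy1 up.
have := up _ F1f.
have bF : b (F y1) (F y1) = b m m by have [Gg _ _] := gP y1 y1N; rewrite /F b_pi.
rewrite !bDl !bDr !bZl !bZr bF [b (F y1) m]bC => e1.
have e2 : b m (F y1) = - (q^-1 * b m m) by lra.
rewrite e2 => h.
have qi0 : 0 < q^-1 by rewrite invr_gt0.
have qi1 : q^-1 <= 2^-1 by rewrite lef_pV2// posrE.
have h' : 0 <= b m m * (1 - q^-1 * q^-1) by lra.
by move: h'; rewrite pmulr_lge0//; nra.
Qed.

Lemma b_negative_proj x v : b v v < 0 -> b (proj (stab x) v) (proj (stab x) v) < 0.
Proof.
have eL := elliptic_stab x.
have := positive_vertex (perp_proj v eL); rewrite (b_split v eL).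
by set X := b _ _; set Y := b _ _; lra.
Qed.

(** * Irreducibility and Hecke operators *)

Hypothesis pi_irreducible : irreducible_rep G pi.

(** The K-span of the orbit, as an intersection: membership is then an induction principle for the
    estimates below. *)
Definition orbit_span w : set H :=
  [set u | forall W, k_subspace W -> (forall g, G g -> W (pi g w)) -> W u].

Lemma orbit_span_subspace w : k_subspace (orbit_span w).
Proof.
split.
- by move=> W [].
- move=> u v uw vw W sW gW; have [_ WD _] := sW.
  by apply: WD; [exact: uw|exact: vw].
- move=> u a uw W sW gW; have [_ _ WM] := sW.
  by apply: WM; exact: uw.
Qed.

Lemma orbit_span_pi w g : G g -> orbit_span w (pi g w).
Proof. by move=> Gg W _; exact. Qed.

Lemma orbit_span_invariant w g u : G g -> orbit_span w u -> orbit_span w (pi g u).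
Proof.
move=> Gg uw W [W0 WD WM] gW; apply: (uw [set v | W (pi g v)]).
  split => /=; first by rewrite pi_0.
    by move=> v v' ? ?; rewrite piD//; exact: WD.
  by move=> v a ?; rewrite pi_ract//; exact: WM.
by move=> h Gh /=; rewrite -piM//; apply: gW; exact: (GM G_subgroup).
Qed.

Lemma norm_ract_le a : exists2 M, 0 < M & forall v, `|ract v a| <= M * `|v|.
Proof.
exists (1 + \sum_i `|scoord a i|) => [|v].
  by rewrite ltr_pwDl// sumr_ge0.
rewrite ract_coord (le_trans (ler_norm_sum _ _ _))//.
rewrite mulrDl mul1r ler_wpDl// mulr_suml ler_sum// => i _.
by rewrite normrZ norm_ract_basis.
Qed.

Lemma orbit_span_dense w : w != 0 -> dense_in_norm (orbit_span w).
Proof.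
move=> w0; have [S0 SD SM] := orbit_span_subspace w.
pose W : set H := [set u | forall e, 0 < e -> exists2 v, orbit_span w v & `|u - v| < e].
have subW u : orbit_span w u -> W u by move=> uw e e0; exists u; rewrite ?subrr ?normr0.
suff WT : W = setT by move=> u; have : setT u by []; rewrite -WT.
have [|||W0|//] := pi_irreducible.2 W.
- split; first exact: subW.
    move=> u v Wu Wv e e0; have e2 : 0 < e / 2 by rewrite divr_gt0.
    have [u' Su' uu'] := Wu _ e2; have [v' Sv' vv'] := Wv _ e2.
    exists (u' + v'); first exact: SD.
    by rewrite opprD addrACA (le_lt_trans (ler_normD _ _))// [e]splitr ltrD.
  move=> u a Wu e e0; have [M M0 MP] := norm_ract_le a.
  have [v Sv uv] := Wu (e / M) (divr_gt0 e0 M0).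
  exists (ract v a); first exact: SM.
  by rewrite -ractBl (le_lt_trans (MP _))// mulrC -ltr_pdivlMr.
- move=> u uW e e0; have e2 : 0 < e / 2 by rewrite divr_gt0.
  have [v [Wv]] := uW _ (nbhsx_ballx u _ e2).
  rewrite -ball_normE /= => uv; have [v' Sv' vv'] := Wv _ e2.
  exists v' => //; rewrite -(subrKA v) (le_lt_trans (ler_normD _ _))//.
  by rewrite [e]splitr ltrD.
- move=> g u Gg Wu e e0; have [M M0 MP] := pi_dist Gg.
  have [v Sv uv] := Wu (e / M) (divr_gt0 e0 M0).
  exists (pi g v); first exact: orbit_span_invariant.
  by rewrite (le_lt_trans (MP _ _))// mulrC -ltr_pdivlMr.
have : W w by apply: subW; have := @orbit_span_pi w _ (G1 G_subgroup); rewrite pi1.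
by rewrite W0 => /eqP; rewrite (negbTE w0).
Qed.

Lemma orbit_total w u : w != 0 -> (forall g a, G g -> b (ract (pi g w) a) u = 0) -> u = 0.
Proof.
move=> w0 wu; apply: b_nondegenerate => v.
have Su z : orbit_span w z -> forall a, b (ract z a) u = 0.
  move=> zw; apply: (zw [set z | forall a, b (ract z a) u = 0]).
    split => [a|y1 y2 h1 h2 a|y1 c h1 a] /=; rewrite ?ract0l ?b0l// ?ractDl ?bDl ?h1 ?h2 ?addr0//.
    by rewrite -ractA h1.
  by move=> g Gg a; exact: wu.
have [C C0 bC'] := b_bounded.
apply/eqP; rewrite -normr_le0; apply/ler_addgt0Pl => e e0; rewrite addr0.
have d0 : 0 < e / (C * (`|u| + 1)) by rewrite divr_gt0// mulr_gt0// ltr_wpDl.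
have [z Sz vz] := orbit_span_dense w0 v d0.
have -> : b u v = b u (v - z).
  have uz : b u z = 0 by rewrite bC -[z]ract1 Su.
  by rewrite bBr uz subr0.
rewrite (le_trans (bC' _ _))// (le_trans (ler_wpM2l (ltW C0) (ler_wpM2l (normr_ge0 u) (ltW vz))))//.
rewrite mulrA mulrCA ler_piMr ?(ltW e0)// ler_pdivrMr ?mulr_gt0 ?ltr_wpDl// mul1r.
by rewrite ler_pM2l// lerDl.
Qed.

(** On the vectors fixed by the stabilizer of [x], the Hecke operator of the double coset of [g]. *)
Definition hecke x g u := proj (stab x) (pi g u).

Section Hecke.
Variable x : T.
Local Notation K := (stab x).
Local Notation D := (fixed (stab x)).
Local Notation "'T_ g" := (hecke x g) (at level 8, g at level 2).
Let eK := elliptic_stab x.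

Lemma hecke_fixed g u : D ('T_g u). Proof. exact: proj_fixed. Qed.

Lemma b_hecke g u w : D w -> b ('T_g u) w = b (pi g u) w.
Proof. exact: b_proj. Qed.

Lemma heckeD g u w : G g -> 'T_g (u + w) = 'T_g u + 'T_g w.
Proof.
move=> Gg; apply: proj_unique => //; first by apply: fixedD => //; exact: hecke_fixed.
by move=> z Dz; rewrite bDl !b_hecke// piD// bDl.
Qed.

Lemma hecke_ract g u a : G g -> 'T_g (ract u a) = ract ('T_g u) a.
Proof.
move=> Gg; apply: proj_unique => //; first by apply: fixed_ract => //; exact: hecke_fixed.
move=> z Dz; rewrite b_ractl b_hecke//; last exact: fixed_ract.
by rewrite -b_ractl pi_ract.
Qed.

Lemma heckeZ g r u : G g -> 'T_g (r *: u) = r *: 'T_g u.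
Proof. by move=> Gg; rewrite -!ract_real hecke_ract. Qed.

Lemma heckeB g u w : G g -> 'T_g (u - w) = 'T_g u - 'T_g w.
Proof. by move=> Gg; rewrite heckeD// -[- w]scaleN1r heckeZ// scaleN1r. Qed.

Lemma b_pi_sym g u w : G g -> D u -> D w -> b (pi g u) w = b u (pi g w).
Proof.
move=> Gg Du Dw.
have [h [h' [Gh Gh' hx h'x gE]]] := inv_double_coset G_subgroup T_degree G_good x Gg.
rewrite b_pil// gE !piM//; last exact: (GM G_subgroup).
have -> : pi h' w = w by apply: Dw; apply/stabP.
rewrite bC b_pil// bC; congr b; apply: Du; apply/stabP.
by split; [exact: (GV G_subgroup)|exact: autV_fix].
Qed.

Lemma hecke_sym g u w : G g -> D u -> D w -> b ('T_g u) w = b u ('T_g w).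
Proof. by move=> Gg Du Dw; rewrite b_hecke// b_pi_sym// bC [RHS]bC b_hecke. Qed.

Lemma hecke_ext u w : D u -> D w -> (forall z, D z -> b u z = b w z) -> u = w.
Proof.
move=> Du Dw uw; apply/eqP; rewrite -subr_eq0; apply/eqP.
by apply: (fixed_perp0 eK); [exact: fixedB|move=> z Dz; rewrite bBl uw// subrr].
Qed.

(* Gelfand's trick: the products of the self-adjoint operators ['T_g] are
   self-adjoint, hence these operators commute. *)
Lemma hecke_comm g h u : G g -> G h -> D u -> 'T_g ('T_h u) = 'T_h ('T_g u).
Proof.
move=> Gg Gh Du; apply: hecke_ext; [exact: hecke_fixed..|move=> w Dw].
(* The product is an average over [k'] of the operators of [g k' h], and each of these is symmetric
   on fixed vectors. *)
have sym u' w' : D u' -> D w' -> b ('T_g ('T_h u')) w' = b u' ('T_g ('T_h w')).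
  move=> Du' Dw'; rewrite b_hecke// b_pil// [RHS]bC [RHS]b_hecke// [RHS]b_pil//.
  rewrite /hecke -[RHS]addr0; apply: proj_average => // k' /stabP[Gk kx].
  have Ggk : G (g * k')%g by exact: (GM G_subgroup).
  have Ggkh : G (g * k' * h)%g by exact: (GM G_subgroup).
  by rewrite addr0 -!b_pil// -!piM// b_pi_sym// bC.
rewrite sym//; rewrite [RHS]hecke_sym//; last exact: hecke_fixed.
by rewrite hecke_sym//; exact: hecke_fixed.
Qed.

(** Projecting [pi g u] only discards a vector orthogonal to the fixed ones, on which [b] is
    nonnegative. *)
Lemma hecke_le g u : G g -> D u -> b ('T_g u) ('T_g u) <= b u u.
Proof.
move=> Gg Du; rewrite -(b_pi u u Gg) (b_split (pi g u) eK) lerDr.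
by apply: positive_vertex; exact: perp_proj.
Qed.

Section Scalar.
Variable g : aut T.
Hypothesis Gg : G g.
Local Notation S := 'T_g.

Let energy (r0 : R) u w := b ((1 + r0) *: u - S (S u)) w.

Let energyE r0 u w : D u -> D w -> energy r0 u w = (1 + r0) * b u w - b (S u) (S w).
Proof.
move=> Du Dw; rewrite /energy bBl bZl; congr (_ - _).
by rewrite hecke_sym//; exact: hecke_fixed.
Qed.

Let energy_cauchy r0 u w : (forall z, D z -> 0 <= energy r0 z z) -> D u -> D w ->
  energy r0 u w ^+ 2 <= energy r0 u u * energy r0 w w.
Proof.
move=> E0 Du Dw.
apply: square_le_mul; [exact: E0..|move=> t].
have Dz : fixed (stab x) (u + t *: w) by apply: fixedD => //; exact: fixedZ.
have := E0 _ Dz; rewrite !energyE//.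
rewrite heckeD// heckeZ// !bDl !bDr !bZl !bZr [b w u]bC [b (S w) (S u)]bC.
by lra.
Qed.

(* The smallest value [r0] of the quotient of [b u u - b (S u) (S u)] by
   [- b u u] on negative vectors makes [energy r0] positive, and then its
   kernel is everything: otherwise the orbit of some [energy]-gradient would
   span a dense subspace, containing a maximal negative family, so that the
   energy would control the negative part of [b]. *)
Lemma hecke_square v : D v -> b v v < 0 ->
  exists2 r0, 0 <= r0 & forall u, D u -> S (S u) = (1 + r0) *: u.
Proof.
move=> Dv v0.
pose E : set R := [set r | exists u, [/\ D u, b u u < 0 &
  r = (b u u - b (S u) (S u)) / - b u u]].
have E0 r : E r -> 0 <= r.
  move=> [u [Du u0 ->]]; rewrite divr_ge0 ?oppr_ge0 ?(ltW u0)// subr_ge0.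
  exact: hecke_le.
have Eq : has_inf E.
  split; first by exists ((b v v - b (S v) (S v)) / - b v v), v.
  by exists 0 => r /E0.
pose r0 := inf E.
have r00 : 0 <= r0 by apply: lb_le_inf; [exact: Eq.1|exact: E0].
have energy_ge0 u : D u -> 0 <= energy r0 u u.
  move=> Du; rewrite energyE//; have := hecke_le Gg Du.
  have [u0|u0] := leP 0 (b u u); first by have := mulr_ge0 r00 u0; lra.
  move=> h; have : r0 <= (b u u - b (S u) (S u)) / - b u u.
    by apply: ge_inf; [exact: Eq.2|exists u].
  by rewrite ler_pdivlMr ?oppr_gt0//; lra.
exists r0 => // w Dw; apply: contrapT => Sw.
pose grad u := (1 + r0) *: u - S (S u).
have Dgrad u : D u -> D (grad u).
  by move=> Du; apply: fixedB => //; [exact: fixedZ|exact: hecke_fixed].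
have gw0 : grad w != 0 by rewrite subr_eq0; apply/eqP => /esym.
have gradT h u : G h -> D u -> 'T_h (grad u) = grad ('T_h u).
  move=> Gh Du; rewrite heckeB// heckeZ// /grad; congr (_ - _).
  have e : 'T_h (S (S u)) = S ('T_h (S u)) := hecke_comm Gh Gg (hecke_fixed g u).
  by rewrite e; congr hecke; exact: (hecke_comm Gh Gg Du).
have grad_ract u a : ract (grad u) a = grad (ract u a).
  by rewrite ractBl ractZl -!hecke_ract.
(* For [z] in the orbit of [grad w], pairing with [u] is the energy pairing of a Hecke image of [w]
   with [u], so Cauchy-Schwarz applies. Quantifying over [a] keeps the property stable under
   scalars. *)
have control z : orbit_span (grad w) z -> forall a, exists2 M, 0 <= M &
    forall u, D u -> b (ract z a) u ^+ 2 <= M * energy r0 u u.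
  move=> zw; apply: (zw [set z | forall a, exists2 M, 0 <= M &
    forall u, D u -> b (ract z a) u ^+ 2 <= M * energy r0 u u]).
    split => [a|z1 z2 h1 h2 a|z1 c h1 a] /=.
    - by exists 0 => // u Du; rewrite ract0l b0l expr0n mul0r.
    - have [M1 M10 M1P] := h1 a; have [M2 M20 M2P] := h2 a.
      exists (2 * M1 + 2 * M2) => [|u Du]; first by lra.
      rewrite ractDl bDl; have := M1P u Du; have := M2P u Du.
      by have := sqr_ge0 (b (ract z1 a) u - b (ract z2 a) u); nra.
    - by have [M M0 MP] := h1 (c * a); exists M => // u Du; rewrite -ractA MP.
  move=> h Gh a; have Dwa : D ('T_h (ract w a)) := hecke_fixed h _.
  exists (energy r0 ('T_h (ract w a)) ('T_h (ract w a))) => [|u Du].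
    exact: energy_ge0.
  rewrite -pi_ract// grad_ract -b_hecke// gradT//; last exact: fixed_ract.
  exact: (energy_cauchy energy_ge0 Dwa Du).
have [U Un US] := negfam_dense (orbit_span_subspace (grad w)) (orbit_span_dense gw0) (leqnn p).
have [M M0 MP] : exists2 M, 0 < M & forall u, D u ->
    \sum_i \sum_s b (ract (U i) (sbasis R s)) u ^+ 2 <= M * energy r0 u u.
  have /choice[f fP] : forall l : 'I_p * 'I_(sdim k), exists M, 0 <= M /\ forall u, D u ->
      b (ract (U l.1) (sbasis R l.2)) u ^+ 2 <= M * energy r0 u u.
    by move=> [i s]; have [M] := control _ (US i) (sbasis R s); exists M.
  exists (1 + \sum_i \sum_s f (i, s)) => [|u Du].
    by rewrite ltr_pwDl// sumr_ge0// => i _; rewrite sumr_ge0// => s _; have [] := fP (i, s).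
  rewrite mulrDl mul1r ler_wpDl ?energy_ge0// mulr_suml ler_sum// => i _.
  by rewrite mulr_suml ler_sum// => s _; have [_ +] := fP (i, s); exact.
(* A quotient below [r0 + M^-1] means an energy below [M^-1 * - b u u]. The squared coefficients of
   [u] on the maximal family then sum to less than [- b u u], contradicting [negform_ge0]. *)
have Mi : 0 < M^-1 by rewrite invr_gt0.
have [_ [u [Du u0 ->]]] := inf_adherent Mi Eq.
rewrite ltr_pdivrMr ?oppr_gt0// -/r0 => lt.
have := negform_ge0 u Un; rewrite /negform => ge.
have := MP u Du; rewrite energyE// => le.
have : M * ((1 + r0) * b u u - b (S u) (S u)) < M * (M^-1 * - b u u).
  by rewrite ltr_pM2l//; lra.
by rewrite mulrA mulfV ?gt_eqF// mul1r; lra.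
Qed.

End Scalar.
End Hecke.

(** On fixed vectors the operator [S] satisfies [(S - r) (S + r) = 0]. If [S - r] has a nonzero
    value [y], the orbit of [y] is total and, by symmetry and commutation, orthogonal to every value
    of [S + r], so [S = - r]. *)
Lemma hecke_scalar x g v : G g -> fixed (stab x) v -> b v v < 0 ->
  exists r, forall u, fixed (stab x) u -> hecke x g u = r *: u.
Proof.
move=> Gg Dv v0; have [r0 r00 sq] := hecke_square Gg Dv v0.
have eK := elliptic_stab x.
pose r := Num.sqrt (1 + r0).
have rr : r ^+ 2 = 1 + r0 by rewrite sqr_sqrtr// addr_ge0.
have [scal|] := pselect (forall u, fixed (stab x) u -> hecke x g u = r *: u).
  by exists r.
move=> /existsNP[w /not_implyP[Dw Sw]]; exists (- r) => u Du.
pose y := hecke x g w - r *: w.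
have y0 : y != 0 by rewrite subr_eq0; exact/eqP.
apply/eqP; rewrite scaleNr -addr_eq0; apply/eqP.
apply: (orbit_total y0) => h a Gh.
have Dz := @hecke_fixed x h (ract w a).
set z := hecke x h (ract w a) in Dz.
have Du' : fixed (stab x) (hecke x g u + r *: u).
  by apply: fixedD => //; [exact: hecke_fixed|exact: fixedZ].
rewrite -pi_ract// -(b_hecke _ _ Du').
have -> : hecke x h (ract y a) = hecke x g z - r *: z.
  have -> : ract y a = hecke x g (ract w a) - r *: ract w a.
    by rewrite ractBl ractZl hecke_ract.
  rewrite heckeB// heckeZ// (hecke_comm Gh Gg)//; exact: fixed_ract.
rewrite bBl bZl !bDr !bZr hecke_sym//; last exact: hecke_fixed.
rewrite sq// bZr (hecke_sym Gg Dz Du) -rr; ring.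
Qed.

(** The part [w] of [u] orthogonal to [v] pairs to 0 with the whole orbit of [v], since the Hecke
    operators only rescale [v]. *)
Lemma fixed_line x v u : fixed (stab x) v -> b v v < 0 -> fixed (stab x) u ->
  exists a, u = ract v a.
Proof.
move=> Dv v0 Du; have eK := elliptic_stab x.
have vn0 : v != 0 by apply: contraTneq v0 => ->; rewrite b0l ltxx.
exists (sreal k (b v v)^-1 * B v u); apply/eqP; rewrite -subr_eq0; apply/eqP.
set w := u - _.
have Dw : fixed (stab x) w by apply: fixedB => //; exact: fixed_ract.
have Bw : B v w = 0.
  rewrite /w BDr -ractNr BMr B_self mulrN mulrA -srealM mulfV ?lt_eqF//.
  by rewrite sreal1 mul1r subrr.
apply: (orbit_total vn0) => g a Gg.
rewrite -pi_ract// -(b_hecke _ _ Dw).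
have [r scal] := hecke_scalar Gg Dv v0.
by rewrite scal; [rewrite bZl /b BMl Bw mulr0 sre0 mulr0|exact: fixed_ract].
Qed.

Lemma orthogonal_ge0 x v u : fixed (stab x) v -> b v v < 0 -> B v u = 0 -> 0 <= b u u.
Proof.
move=> Dv v0 Bu; apply: (@positive_vertex x) => w Dw.
by have [a ->] := fixed_line Dv v0 Dw; rewrite bC b_ractl /b BMr Bu mul0r sre0.
Qed.

Lemma fixed_negative x : (0 < p)%N ->
  exists2 v, fixed (stab x) v & b v v = -1.
Proof.
move=> p0; have [w w0 _] := @negfam_extend 0 (fun=> 0) p0.
have eK := elliptic_stab x.
have v0 := b_negative_proj x w0; set v := proj _ w in v0.
exists ((Num.sqrt (- b v v))^-1 *: v); first by apply: fixedZ => //; exact: proj_fixed.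
rewrite bZl bZr mulrA -expr2 exprVn sqr_sqrtr ?oppr_ge0 ?ltW//.
by rewrite -[X in _ * X]opprK mulrN mulVf// oppr_eq0 lt_eqF.
Qed.

Lemma index_le1 : (p <= 1)%N.
Proof.
have [x] := tree_nonempty T.
rewrite leqNgt; apply/negP => p2.
have [v Dv v1] := fixed_negative x (ltnW p2).
have v0 : b v v < 0 by rewrite v1 oppr_lt0.
have [w w0 /(_ ord0) Bw] := @negfam_extend 1 (fun=> v) p2.
by have := orthogonal_ge0 Dv v0 Bw; rewrite leNgt w0.
Qed.

(** * The real form in index one *)

Hypothesis p_eq1 : p = 1%N.

(** For [b f f = -1] this reverses the sign of [b] on the K-line of [f]: one copy of the sum cancels
    the negative part, the other restores it with positive sign. *)
Definition lorentz f u := b u u + 2 * \sum_s b (ract f (sbasis R s)) u ^+ 2.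

Definition lorentz_form f u w :=
  b u w + 2 * \sum_s b (ract f (sbasis R s)) u * b (ract f (sbasis R s)) w.

Lemma reverse_cauchy f u : b f f = -1 ->
  0 <= b u u + \sum_s b (ract f (sbasis R s)) u ^+ 2.
Proof.
move=> f1; have fneg : negfam (fun _ : 'I_p => f).
  move=> i l; have -> : i = l.
    have i1 := ltn_ord i; have l1 := ltn_ord l.
    by apply: val_inj => /=; move: i1 l1; move: (val i) (val l) => m n; lia.
  rewrite eqxx B_self f1.
  by apply: (@addrI _ (sreal k 1)); rewrite -srealD subrr sreal0 sreal1 subrr.
have := negform_ge0 u fneg.
by rewrite /negform sumr_const card_ord [in X in _ *+ X]p_eq1.
Qed.

Lemma sum_sq_le_lorentz f u : b f f = -1 ->
  \sum_s b (ract f (sbasis R s)) u ^+ 2 <= lorentz f u.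
Proof. by move=> /reverse_cauchy - /(_ u); rewrite /lorentz; lra. Qed.

Lemma b_le_lorentz f u : b u u <= lorentz f u.
Proof.
rewrite /lorentz lerDl mulr_ge0// sumr_ge0// => s _; exact: sqr_ge0.
Qed.

Lemma lorentz_ge0 f u : b f f = -1 -> 0 <= lorentz f u.
Proof.
move=> f1; apply: le_trans (sum_sq_le_lorentz u f1).
by apply: sumr_ge0 => s _; exact: sqr_ge0.
Qed.

Lemma lorentzD f u w : lorentz f (u + w) = lorentz f u + 2 * lorentz_form f u w + lorentz f w.
Proof.
rewrite /lorentz /lorentz_form bDl !bDr [b w u]bC.
have -> : \sum_s b (ract f (sbasis R s)) (u + w) ^+ 2 =
    \sum_s b (ract f (sbasis R s)) u ^+ 2 +
    2 * \sum_s b (ract f (sbasis R s)) u * b (ract f (sbasis R s)) w +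
    \sum_s b (ract f (sbasis R s)) w ^+ 2.
  rewrite mulr_sumr -!big_split; apply: eq_bigr => s _ /=; rewrite bDr; ring.
ring.
Qed.

Lemma lorentzZ f r u : lorentz f (r *: u) = r ^+ 2 * lorentz f u.
Proof.
rewrite /lorentz bZl bZr.
have -> : \sum_s b (ract f (sbasis R s)) (r *: u) ^+ 2 =
    r ^+ 2 * \sum_s b (ract f (sbasis R s)) u ^+ 2.
  by rewrite mulr_sumr; apply: eq_bigr => s _; rewrite bZr exprMn.
ring.
Qed.

Lemma lorentz_formZr f u r w : lorentz_form f u (r *: w) = r * lorentz_form f u w.
Proof.
rewrite /lorentz_form bZr [RHS]mulrDr; congr (_ + _).
rewrite mulrCA; congr (2 * _); rewrite mulr_sumr.
by apply: eq_bigr => s _; rewrite bZr mulrCA.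
Qed.

Lemma lorentz_cauchy f u w : b f f = -1 ->
  lorentz_form f u w ^+ 2 <= lorentz f u * lorentz f w.
Proof.
move=> f1; apply: square_le_mul; [exact: lorentz_ge0..|move=> t].
have := lorentz_ge0 (u + t *: w) f1.
by rewrite lorentzD lorentzZ lorentz_formZr; lra.
Qed.

Lemma lorentz_bounded f : exists2 C, 0 < C & forall u, lorentz f u <= C * `|u| ^+ 2.
Proof.
have [C C0 bC'] := b_bounded.
exists (C + 2 * \sum_(s < sdim k) (C * `|f|) ^+ 2) => [|u].
  rewrite ltr_pwDl// mulr_ge0// sumr_ge0// => s _; exact: sqr_ge0.
rewrite mulrDl lerD//.
  by rewrite (le_trans (ler_norm _))// (le_trans (bC' _ _))// expr2.
rewrite -mulrA ler_pM2l// mulr_suml ler_sum// => s _.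
rewrite -exprMn -[leLHS]real_normK ?num_real// lerXn2r ?nnegrE ?mulr_ge0 ?(ltW C0)//.
by rewrite (le_trans (bC' _ _))// norm_ract_basis mulrA.
Qed.

Lemma lorentz_comparable f v : b f f = -1 -> b v v = -1 ->
  exists2 M, 0 < M & forall u, lorentz f u <= M * lorentz v u.
Proof.
move=> f1 v1.
(* The constants come from [(F - 2 Z) ^ 2 <= 2 F ^ 2 + 8 Z ^ 2], with [F] and [Z] bounded by
   Cauchy-Schwarz. *)
pose a s := 2 * lorentz v (ract f (sbasis R s)) +
  8 * \sum_t b (ract v (sbasis R t)) (ract f (sbasis R s)) ^+ 2.
have a0 s : 0 <= a s.
  by rewrite addr_ge0// mulr_ge0// ?lorentz_ge0// sumr_ge0// => t _; exact: sqr_ge0.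
exists (1 + 2 * \sum_s a s) => [|u].
  by rewrite ltr_pwDl// mulr_ge0// sumr_ge0.
rewrite mulrDl mul1r lerD ?b_le_lorentz// -mulrA ler_pM2l// mulr_suml ler_sum// => s _.
set y := ract f _.
have e : b y u = lorentz_form v y u -
    2 * \sum_t b (ract v (sbasis R t)) y * b (ract v (sbasis R t)) u.
  by rewrite /lorentz_form addrK.
have c1 := lorentz_cauchy y u v1.
have c2 := sum_cauchy_schwarz (fun t => b (ract v (sbasis R t)) y) (fun t => b (ract v (sbasis R t)) u).
rewrite /= in c2.
have c3 := sum_sq_le_lorentz u v1.
have c4 : 0 <= \sum_t b (ract v (sbasis R t)) y ^+ 2.
  by rewrite sumr_ge0// => t _; exact: sqr_ge0.
rewrite e /a -/y; move: c1 c2 c3 c4.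
move: (lorentz_form v y u) (\sum_t b _ y * b _ u) (lorentz v y) (lorentz v u)
  (\sum_t b _ y ^+ 2) (\sum_t b _ u ^+ 2) => F Z A L S U c1 c2 c3 c4.
have c5 : Z ^+ 2 <= S * L by apply: le_trans c2 _; rewrite ler_wpM2l.
by have := sqr_ge0 (F + 2 * Z); nra.
Qed.

(** With [f] taken in [Hm], the complete norm provided by strong nondegeneracy is exactly the one
    deduced from [lorentz f]. *)
Lemma lorentz_complete : exists2 f, b f f = -1 & exists2 M, 0 < M & forall u,
  `|u| ^+ 2 <= M * lorentz f u.
Proof.
have [Hp [Hm [pp [pm [[[_ HpD HpM] [Hm0 HmD HmM] dec _ orth] [pos neg cpl]]]]]] :=
  B_nondegenerate.
have p0 : (0 < p)%N by rewrite p_eq1.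
have [w w0 _] := @negfam_extend 0 (fun=> 0) p0.
have orth' v u : Hp v -> Hm u -> b v u = 0 by move=> hv hu; rewrite /b orth// sre0.
have bsplit u : b u u = b (pp u) (pp u) + b (pm u) (pm u).
  have [pu mu uE] := dec u; rewrite {1 2}uE !bDl !bDr [b (pm u) (pp u)]bC.
  by rewrite (orth' _ _ pu mu) addr0 add0r.
have pp0 u : 0 <= b (pp u) (pp u).
  have [pu _ _] := dec u; have [->|/pos-/(_ pu)/ltW//] := eqVneq (pp u) 0.
  by rewrite b0l.
have pm0 u : Hm u -> b u u <= 0.
  by move=> mu; have [->|/neg-/(_ mu)/ltW//] := eqVneq u 0; rewrite b0l.
have [f Hf f1] : exists2 f, Hm f & b f f = -1.
  have [_ mw _] := dec w.
  have e0 : b (pm w) (pm w) < 0 by have := bsplit w; have := pp0 w; lra.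
  exists ((Num.sqrt (- b (pm w) (pm w)))^-1 *: pm w); first by rewrite -ract_real; exact: HmM.
  rewrite bZl bZr mulrA -expr2 exprVn sqr_sqrtr ?oppr_ge0 ?ltW//.
  by rewrite -[X in _ * X]opprK mulrN mulVf// oppr_eq0 lt_eqF.
(* [Hm] is the line of [f], as a vector of [Hm] orthogonal to [f] would be a second negative
   direction. *)
have pmE u : pm u = - ract f (B f u).
  have [pu mu uE] := dec u.
  apply/eqP; rewrite -addr_eq0; apply/eqP; set h := _ + _.
  have Hh : Hm h by apply: HmD => //; exact: HmM.
  have Bfh : B f h = 0.
    have Bff : B f f = -1.
      rewrite B_self f1; apply: (@addrI _ (sreal k 1)).
      by rewrite -srealD subrr sreal0 sreal1 subrr.
    rewrite /h BDr BMr Bff mulN1r {2}uE BDr [B f (pp u)]B_hermitian (orth (pp u) f)// sconj0 add0r.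
    exact: subrr.
  have h0 : 0 <= b h h.
    have := reverse_cauchy h f1; rewrite big1 ?addr0// => s _.
    by rewrite b_ract_basis Bfh scoord0 expr0n.
  by apply/eqP; apply: contraTT h0 => /neg-/(_ Hh); rewrite ltNge.
have NE u : b (pp u) (pp u) - b (pm u) (pm u) = lorentz f u.
  have e : b (pm u) (pm u) = - \sum_s b (ract f (sbasis R s)) u ^+ 2.
    rewrite pmE bNl bNr opprK b_ractl -!b_ractl /b BMl BMr.
    have Bff : B f f = -1.
      rewrite B_self f1; apply: (@addrI _ (sreal k 1)).
      by rewrite -srealD subrr sreal0 sreal1 subrr.
    rewrite Bff mulN1r mulrN sreN sre_conjM; congr (- _).
    by apply: eq_bigr => s _; rewrite -b_ract_basis.
  by rewrite /lorentz (bsplit u) e; ring.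
exists f => //.
pose N u := Num.sqrt (lorentz f u).
have N2 u : N u ^+ 2 = lorentz f u by rewrite sqr_sqrtr// lorentz_ge0.
have N0 u : 0 <= N u by exact: sqrtr_ge0.
have [C C0 CP] := lorentz_bounded f.
have [M M0 MP] : exists2 M, 0 < M & forall u, `|u| <= M * N u.
  apply: (@complete_norm_dominates R H N _ _ _ (Num.sqrt C)).
  - move=> u v; rewrite -(@ler_pXn2r _ 2) ?nnegrE ?addr_ge0//.
    rewrite sqrrD !N2 lorentzD lerD2r lerD2l -[leRHS]mulr_natl ler_pM2l//.
    rewrite (le_trans (ler_norm _))// -(@ler_pXn2r _ 2) ?nnegrE ?mulr_ge0//.
    by rewrite real_normK ?num_real// exprMn !N2; exact: lorentz_cauchy.
  - by move=> r u; rewrite /N lorentzZ sqrtrM ?sqr_ge0// sqrtr_sqr.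
  - move=> u /eqP; rewrite sqrtr_eq0 -NE => le0; have [pu mu uE] := dec u.
    have := pp0 u; have := pm0 _ mu => h1 h2.
    rewrite uE; have [->|/pos-/(_ pu)] := eqVneq (pp u) 0; last first.
      by move=> h3; exfalso; move: h1 h2 h3 le0; rewrite /b; lra.
    have [->|/neg-/(_ mu)] := eqVneq (pm u) 0; first by rewrite addr0.
    by move=> h3; exfalso; move: h1 h2 h3 le0; rewrite /b; lra.
  - move=> u; rewrite -(@ler_pXn2r _ 2) ?nnegrE ?mulr_ge0 ?sqrtr_ge0//.
    by rewrite exprMn N2 sqr_sqrtr ?(ltW C0).
  - have -> : N = (fun v => Num.sqrt (sre (B (pp v) (pp v) - B (pm v) (pm v)))).
      by apply/funext => u; rewrite /N -NE sreD sreN.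
    exact: cpl.
exists (M ^+ 2) => [|u]; first by rewrite exprn_gt0.
by rewrite -N2 -exprMn lerXn2r ?nnegrE ?mulr_ge0// ltW.
Qed.

Lemma lorentz_dominates v : b v v = -1 ->
  exists2 M, 0 < M & forall u, `|u| ^+ 2 <= M * lorentz v u.
Proof.
move=> v1; have [f f1 [M M0 MP]] := lorentz_complete.
have [M' M'0 M'P] := lorentz_comparable f1 v1.
exists (M * M') => [|u]; first by rewrite mulr_gt0.
by rewrite (le_trans (MP u))// -mulrA ler_pM2l.
Qed.

(** * Coordinates over a real form *)

Definition rsum (h : 'I_(sdim k) -> H) := \sum_i ract (h i) (sbasis R i).

(** In view of [b_ract_basis], this says that [B u w] is a real scalar. *)
Definition real_pair u w :=
  forall s, s != unit_index k -> b (ract u (sbasis R s)) w = 0.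

Lemma b_real_pair u w i j : real_pair u w ->
  b (ract u (sbasis R i)) (ract w (sbasis R j)) = (i == j)%:R * b u w.
Proof.
move=> uw; have -> : b (ract u (sbasis R i)) (ract w (sbasis R j)) =
    scoord (sreal k (b u w) * sbasis R j) i.
  rewrite b_ract_basis BMr; congr (scoord (_ * _) i).
  rewrite [LHS]scoordE [RHS]scoordE; apply: eq_bigr => s _; congr (sreal k _ * _).
  rewrite -b_ract_basis; have [->|s0] := eqVneq s (unit_index k).
    by rewrite sbasis_unit ract1 scoord_unit sre_real.
  by rewrite uw// scoord_conj_real.
by rewrite scoordM scoord_basis eq_sym mulrC.
Qed.

Lemma b_rsum u (h : 'I_(sdim k) -> H) s : (forall i, real_pair u (h i)) ->
  b (ract u (sbasis R s)) (rsum h) = b u (h s).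
Proof.
move=> uh; rewrite b_sumr (bigD1 s)//= big1 ?addr0 => [|i si]; rewrite b_real_pair//.
  by rewrite eqxx mul1r.
by rewrite eq_sym (negbTE si) mul0r.
Qed.

Section RealStructure.
Variables (x : T) (v : H).
Hypothesis Dv : fixed (stab x) v.
Hypothesis v1 : b v v = -1.

Let v_neg : b v v < 0. Proof. by rewrite v1 oppr_lt0. Qed.

Let v_neq0 : v != 0.
Proof. by apply: contraTneq v_neg => ->; rewrite b0l ltxx. Qed.

(** The pairing reduces to that of a Hecke image of [v] with [v], and this image is a real multiple
    of [v]. *)
Lemma real_orbit g (h : aut T) : G g -> G h -> real_pair (pi g v) (pi h v).
Proof.
move=> Gg Gh s s0; have GVh := GV G_subgroup Gh.
have Ghg : G (h^-1 * g)%g by exact: (GM G_subgroup).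
rewrite bC b_pil// bC -pi_ract// -piM//.
rewrite -(b_hecke _ _ Dv); have [r scal] := hecke_scalar Ghg Dv v_neg.
rewrite scal; last by apply: fixed_ract => //; exact: elliptic_stab.
by rewrite bZl b_ract_basis B_self scoord_conj_real// mulr0.
Qed.

Definition real_span : set H := [set u | forall W : set H, W 0 ->
  (forall u w, W u -> W w -> W (u + w)) -> (forall r u, W u -> W (r *: u)) ->
  (forall g, G g -> W (pi g v)) -> W u].

Lemma real_span0 : real_span 0. Proof. by move=> W. Qed.

Lemma real_spanD u w : real_span u -> real_span w -> real_span (u + w).
Proof. by move=> Su Sw W W0 WD WZ Wg; apply: (WD); [exact: Su|exact: Sw]. Qed.

Lemma real_spanZ r u : real_span u -> real_span (r *: u).
Proof. by move=> Su W W0 WD WZ Wg; apply: (WZ); exact: Su. Qed.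

Lemma real_span_pi g : G g -> real_span (pi g v).
Proof. by move=> Gg W W0 WD WZ; exact. Qed.

Lemma real_span_pair u w : real_span u -> real_span w -> real_pair u w.
Proof.
move=> Su Sw; apply: (Su [set u | real_pair u w]) => /=.
- by move=> s _; rewrite ract0l b0l.
- by move=> u1 u2 h1 h2 s s0; rewrite ractDl bDl h1// h2// addr0.
- by move=> r u1 h1 s s0; rewrite ractZl bZl h1// mulr0.
move=> g Gg; apply: (Sw [set w | real_pair (pi g v) w]) => /=.
- by move=> s _; rewrite b0r.
- by move=> u1 u2 h1 h2 s s0; rewrite bDr h1// h2// addr0.
- by move=> r u1 h1 s s0; rewrite bZr h1// mulr0.
by move=> h Gh; exact: real_orbit.
Qed.

Lemma real_span_sum n (F : 'I_n -> H) : (forall i, real_span (F i)) ->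
  real_span (\sum_i F i).
Proof.
by move=> SF; apply: (big_ind real_span) => [|u w|//]; [exact: real_span0|exact: real_spanD].
Qed.

Lemma rsum_ract (h : 'I_(sdim k) -> H) a :
  ract (rsum h) a = rsum (fun j => \sum_i scoord (sbasis R i * a) j *: h i).
Proof.
rewrite /rsum ract_suml; under [RHS]eq_bigr do rewrite ract_suml.
rewrite exchange_big /=; apply: eq_bigr => i _.
rewrite -ractA ract_coord; apply: eq_bigr => j _; by rewrite ractZl.
Qed.

Lemma span_coordinates u : orbit_span v u ->
  exists2 h, (forall i, real_span (h i)) & u = rsum h.
Proof.
move=> Su; apply: (Su [set u | exists2 h, (forall i, real_span (h i)) & u = rsum h]).
  split => /=.
  - exists (fun=> 0) => [i|]; first exact: real_span0.
    by rewrite /rsum big1// => i _; rewrite ract0l.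
  - move=> _ _ [h Sh ->] [h' Sh' ->]; exists (fun i => h i + h' i) => [i|].
      exact: real_spanD.
    by rewrite /rsum -big_split; apply: eq_bigr => i _; rewrite ractDl.
  - move=> _ a [h Sh ->]; exists (fun j => \sum_i scoord (sbasis R i * a) j *: h i).
      by move=> j; apply: real_span_sum => i; exact: real_spanZ.
    exact: rsum_ract.
move=> g Gg /=; exists (fun i => if i == unit_index k then pi g v else 0) => [i|].
  by case: ifP => _; [exact: real_span_pi|exact: real_span0].
rewrite /rsum (bigD1 (unit_index k))//= big1 => [|i /negbTE->]; last exact: ract0l.
by rewrite eqxx sbasis_unit ract1 addr0.
Qed.

(** Pairings inside [real_span] are real, so the terms of [rsum h] are orthogonal for [b] and only
    the real coordinate of each pairing with [v] survives. *)
Lemma lorentz_rsum (h : 'I_(sdim k) -> H) : (forall i, real_span (h i)) ->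
  lorentz v (rsum h) = \sum_i lorentz v (h i).
Proof.
move=> Sh; have Sv : real_span v.
  by have := real_span_pi (G1 G_subgroup); rewrite pi1.
have vh i : real_pair v (h i) by exact: real_span_pair.
rewrite /lorentz big_split /= -mulr_sumr; congr (_ + 2 * _).
  rewrite b_suml; apply: eq_bigr => i _; rewrite b_rsum// => j.
  exact: real_span_pair.
apply: eq_bigr => s _; rewrite b_rsum// (bigD1 (unit_index k))//= big1 => [|t t0].
  by rewrite sbasis_unit ract1 addr0.
by rewrite vh// expr0n.
Qed.

Lemma coordinates_bound : exists2 M, 0 < M & forall h, (forall i, real_span (h i)) ->
  forall i, `|h i| <= M * `|rsum h|.
Proof.
have [M M0 MP] := lorentz_dominates v1; have [C C0 CP] := lorentz_bounded v.
exists (Num.sqrt (M * C)) => [|h Sh i]; first by rewrite sqrtr_gt0 mulr_gt0.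
rewrite -(@ler_pXn2r _ 2) ?nnegrE ?mulr_ge0 ?sqrtr_ge0//.
rewrite exprMn sqr_sqrtr ?mulr_ge0 ?(ltW M0) ?(ltW C0)//.
apply: le_trans (MP _) _; rewrite -mulrA ler_pM2l//; apply: le_trans (CP _).
by rewrite lorentz_rsum// (bigD1 i)//= lerDl sumr_ge0// => j _; exact: lorentz_ge0.
Qed.

(** [real_span] carries the estimates but need not be closed; this closed set receives the limits of
    coordinates. *)
Definition real_part : set H := [set u | forall g, G g -> real_pair (pi g v) u].

Lemma real_span_part : real_span `<=` real_part.
Proof. by move=> u Su g Gg; apply: real_span_pair => //; exact: real_span_pi. Qed.

Lemma closed_real_part : closed real_part.
Proof.
have -> : real_part = \bigcap_(gs in [set gs : aut T * 'I_(sdim k) |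
    G gs.1 /\ gs.2 != unit_index k])
    (b (ract (pi gs.1 v) (sbasis R gs.2)) @^-1` [set 0]).
  apply/seteqP; split => [u Wu [g s] [/= Gg s0]|u Wu g Gg s s0]; first exact: Wu.
  exact: (Wu (g, s)).
apply: closed_bigI => -[g s] _; apply: closed_comp; last exact: closed_eq.
by move=> u _; exact: b_continuous.
Qed.

Lemma real_part0 : real_part 0.
Proof. by move=> g Gg s _; rewrite b0r. Qed.

Lemma real_partD u w : real_part u -> real_part w -> real_part (u + w).
Proof. by move=> Wu Ww g Gg s s0; rewrite bDr Wu// Ww// addr0. Qed.

Lemma real_partZ r u : real_part u -> real_part (r *: u).
Proof. by move=> Wu g Gg s s0; rewrite bZr Wu// mulr0. Qed.

Lemma real_part_pi g u : G g -> real_part u -> real_part (pi g u).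
Proof.
move=> Gg Wu h Gh s s0; have GVg := GV G_subgroup Gg.
rewrite bC b_pil// bC -pi_ract// -piM// pi_ract//; last exact: (GM G_subgroup).
  by apply: Wu => //; exact: (GM G_subgroup).
Qed.

(** Pairing with the orbit of [v], multiplied by basis elements of K, isolates each coordinate, and
    this orbit is total. *)
Lemma coordinates_unique (h : 'I_(sdim k) -> H) : (forall i, real_part (h i)) -> rsum h = 0 ->
  forall i, h i = 0.
Proof.
move=> Wh h0 s; apply: (orbit_total v_neq0) => g a Gg.
have gh : b (pi g v) (h s) = 0.
  by rewrite -(@b_rsum _ h) ?h0 ?b0r// => i; exact: Wh.
rewrite ract_coord b_suml big1// => i _; rewrite bZl.
have [->|i0] := eqVneq i (unit_index k); first by rewrite sbasis_unit ract1 gh mulr0.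
by rewrite (Wh s g Gg i i0) mulr0.
Qed.

Lemma rsum_cvg (h : nat -> 'I_(sdim k) -> H) l :
  (forall i, h n i @[n --> \oo] --> l i) -> rsum (h n) @[n --> \oo] --> rsum l.
Proof.
move=> hl; apply: (@cvg_big _ _ _ _ _ (@add_continuous H)) => i _.
apply/cvgrPdist_lt => e e0; have /cvgrPdist_lt/(_ _ e0) := hl i.
by apply: filterS => n; rewrite -ractBl norm_ract_basis.
Qed.

(** The span of the orbit is dense and has coordinates there; by [coordinates_bound] those of an
    approximating sequence are Cauchy, and their limits inherit the bound. *)
Lemma coordinates : exists2 M, 0 < M & forall u, exists h,
  [/\ forall i, real_part (h i), u = rsum h & forall i, `|h i| <= M * `|u|].
Proof.
have [M M0 MP] := coordinates_bound; exists M => // u.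
have /choice[y yP] : forall n : nat, exists y : H, orbit_span v y /\ `|u - y| < n.+1%:R^-1.
  by move=> n; have [|y Sy yu] := orbit_span_dense v_neq0 u (e := n.+1%:R^-1);
    [rewrite invr_gt0|exists y].
have yu : y n @[n --> \oo] --> u.
  apply/cvgrPdist_lt => e e0.
  have := near_infty_natSinv_lt (PosNum e0); apply: filterS => n /=.
  by apply: lt_trans; have [] := yP n.
have /choice[h hP] : forall n, exists h, (forall i, real_span (h i)) /\ y n = rsum h.
  by move=> n; have [Sy _] := yP n; have [h] := span_coordinates Sy; exists h.
have hd n m i : `|h n i - h m i| <= M * `|y n - y m|.
  have [Sn yn] := hP n; have [Sm ym] := hP m.
  have := MP (fun i => h n i - h m i) _ i.
  have -> : rsum (fun i => h n i - h m i) = y n - y m.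
    by rewrite yn ym /rsum -sumrB; apply: eq_bigr => j _; rewrite ractBl.
  apply => j; apply: real_spanD => //; rewrite -scaleN1r; exact: real_spanZ.
have /choice[l lP] : forall i, exists l : H, h n i @[n --> \oo] --> l.
  move=> i; apply/cvg_ex/cauchy_cvgP/cauchyP => e e0.
  have eM : 0 < e / M / 2 by rewrite !divr_gt0.
  have [n0 _ n0P] : \forall n \near \oo, `|u - y n| < e / M / 2.
    by have /cvgrPdist_lt/(_ _ eM) := yu.
  exists (h n0 i); exists n0 => // n /= n0n; rewrite -ball_normE /=.
  apply: le_lt_trans (hd _ _ _) _; rewrite mulrC -ltr_pdivlMr//.
  rewrite -(subrKA u) (le_lt_trans (ler_normD _ _))// [e / M]splitr ltrD//.
    by rewrite distrC; apply: n0P => /=.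
  exact: n0P.
exists l; split.
- move=> i; have Wn : \forall n \near \oo, real_part (h n i).
    by apply: nearW => n; apply: real_span_part; have [] := hP n.
  exact: (@closed_cvg _ _ \oo _ _ real_part closed_real_part Wn _ (lP i)).
- apply: (@cvg_unique _ _ (y n @[n --> \oo])) => //.
  have -> : y = (fun n => rsum (h n)) by apply/funext => n; have [] := hP n.
  exact: rsum_cvg.
move=> i; apply/ler_addgt0Pl => e e0.
have eM : 0 < e / M / 2 by rewrite !divr_gt0.
have e2 : 0 < e / 2 by rewrite divr_gt0.
have : \forall n \near \oo, `|u - y n| < e / M / 2 /\ `|l i - h n i| < e / 2.
  apply: filterI; first by have /cvgrPdist_lt/(_ _ eM) := yu.
  by have /cvgrPdist_lt/(_ _ e2) := lP i.
move=> /filter_ex[n [un ln]]; have [Sn yn] := hP n.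
have := MP _ Sn i; rewrite -yn => h1.
have h2 : M * `|y n| <= M * `|u| + e / 2.
  rewrite -[y n](subKr u) (le_trans (ler_wpM2l (ltW M0) (ler_normB _ _)))//.
  rewrite mulrDr lerD2l mulrC -ler_pdivlMr// ltW//.
  by rewrite mulrAC in un.
have := ler_normD (l i - h n i) (h n i); rewrite subrK.
by move: ln h1 h2; lra.
Qed.

End RealStructure.

Lemma real_form x v : fixed (stab x) v -> b v v = -1 ->
  exists (H0 : hilbertType R Reals) (pi0 : aut T -> H0 -> H0),
    continuous_rep G pi0 /\ rep_isomorphic G pi (tensor_rep (k := k) pi0).
Proof.
move=> Dv v1.
pose W := ClosedRealSubspace (@real_part0 v) (@real_partD v) (@real_partZ v)
  (@closed_real_part v).
pose U : hilbertType R Reals := subspace_type W.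
pose emb (u : U) : H := val u.
(* The value outside the subspace is the default 0; [subK] concerns vectors inside it only. *)
pose sub (w : H) : U := insubd 0 w.
have Wemb (u : U) : real_part v (emb u) by exact: (@sub_set _ _ _ W).
have subK w : real_part v w -> emb (sub w) = w.
  by move=> Ww; rewrite /emb /sub /insubd insubT //; apply/asboolP.
have embI : injective emb by exact: val_inj.
have embD (u w : U) : emb (u + w) = emb u + emb w by [].
have emb_norm (u : U) : `|u| = `|emb u| by [].
have embB (u w : U) : emb (u - w) = emb u - emb w by [].
pose pi0 g (u : U) : U := sub (pi g (emb u)).
have pi0E g (u : U) : G g -> emb (pi0 g u) = pi g (emb u).
  by move=> Gg; rewrite subK//; exact: real_part_pi.
exists U, pi0; split.
  split.
  - move=> g Gg; split => [u w|u r]; apply: embI.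
      by rewrite pi0E// !embD !pi0E// piD.
    have e (w : U) : emb (ract w r) = (r : R) *: emb w by [].
    by rewrite pi0E// !e pi0E// piZ.
  - move=> g Gg; have [M MP] := rep_bounded pi_continuous Gg; exists M => u.
    by rewrite !emb_norm pi0E.
  - by move=> u; apply: embI; rewrite pi0E ?pi1//; exact: (G1 G_subgroup).
  - move=> g h Gg Gh u; apply: embI; rewrite !pi0E//; first exact: piM.
    exact: (GM G_subgroup).
  - move=> u g; apply/cvgrPdist_lt => e e0.
    apply: nbhs_subspaceI => [Gg|_]; last by rewrite subrr normr0.
    have near_g : within G (nbhs (g : aut T)) [set h | `|pi g (emb u) - pi h (emb u)| < e].
      apply: (within_subspace Gg); have := @rep_continuous _ _ _ _ _ _ pi_continuous (emb u) g.
      by move=> /cvgrPdist_lt/(_ _ e0).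
    apply: (@filterS _ (nbhs (g : aut T)) _ _ _ _ near_g) => h hP Gh.
    have dE : `|pi0 g u - pi0 h u| = `|pi g (emb u) - pi h (emb u)|.
      by rewrite emb_norm embB !pi0E.
    suff lt : `|pi0 g u - pi0 h u| < e by exact: lt.
    by rewrite dE; exact: (hP Gh).
have [M M0 /choice[c cP]] := coordinates Dv v1.
(* On pure tensors this is the multiplication map sending [u] tensor [a] to [u a]. *)
pose F' (h : tensor k U) : H := rsum (fun i => emb (h i)).
pose F (u : H) : tensor k U := [ffun i => sub (c u i)].
have F'D (h h' : tensor k U) : F' (h + h') = F' h + F' h'.
  rewrite /F' /rsum -big_split; apply: eq_bigr => i _.
  by rewrite ffunE embD ractDl.
have F'M (h : tensor k U) a : F' (ract h a) = ract (F' h) a.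
  rewrite rsum_ract; apply: eq_bigr => j _; congr ract.
  rewrite [ract h a]/(tensor_ract h a) ffunE.
  by rewrite (big_morph emb embD (erefl _)).
have FK : cancel F F'.
  move=> u; have [Wc uE _] := cP u; rewrite {2}uE; apply: eq_bigr => i _.
  by rewrite ffunE subK.
have F'I : injective F'.
  move=> h h' hh'; apply/ffunP => i; apply: embI; apply/eqP.
  rewrite -subr_eq0; apply/eqP.
 apply: (@coordinates_unique _ v1 (fun i => emb (h i) - emb (h' i))).
    by move=> j; rewrite -embB.
  have := subrr (F' h); rewrite {2}hh' -sumrB => e; rewrite -[RHS]e.
  by apply: eq_bigr => j _; rewrite ractBl.
have F'K : cancel F' F by move=> h; apply: F'I; rewrite FK.
exists F, F'; split; first split=> //.
- by split => [u w|u a]; apply: F'I; rewrite ?F'D ?F'M !FK.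
- exists ((sdim k)%:R * M) => u; rewrite -mulrA; apply: tensor_norm_le => i.
  by have [Wc _ cM] := cP u; rewrite ffunE emb_norm subK.
- exists (sdim k)%:R => h; rewrite (le_trans (ler_norm_sum _ _ _))//.
  rewrite -[X in _ <= X%:R * _]card_ord mulr_natl -sumr_const ler_sum// => i _.
  by rewrite norm_ract_basis -emb_norm; exact: tensor_norm_comp.
move=> g u Gg; apply: F'I; rewrite FK -{1}(FK u) /F' /rsum pi_sum//.
apply: eq_bigr => i _; rewrite pi_ract//.
have -> : tensor_rep (k := k) pi0 g (F u) i = pi0 g (F u i) by exact: ffunE.
by rewrite pi0E.
Qed.

End Representation.

Theorem theorem1p2 (T : tree)
  (T_locally_finite : locally_finite T)
  (T_degree : forall x : T, (`I_3 #<= neighbors x)%card)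
  (G : set (aut T))
  (G_subgroup : subgroup G)
  (G_closed : closed G)
  (G_noncompact : ~ compact G)
  (G_property_P : Tits_property_P G)
  (G_transitive : boundary_transitive G)
  (R : realType) (k : scalar_kind) (H : hilbertType R k)
  (pi : aut T -> H -> H)
  (pi_continuous : continuous_rep G pi)
  (pi_irreducible : irreducible_rep G pi)
  (B : H -> H -> scalars R k)
  (B_sesquilinear : sesquilinear_form B)
  (B_hermitian : hermitian_form B)
  (B_continuous : continuous_form B)
  (B_nondegenerate : strongly_nondegenerate B)
  (B_preserved : preserves_form G pi B)
  (p : nat)
  (B_index : form_index B p) :
  (p = 0%N \/ p = 1%N) /\
  (p = 1%N ->
     exists (H0 : hilbertType R Reals) (pi0 : aut T -> H0 -> H0),
       continuous_rep G pi0 /\ rep_isomorphic G pi (tensor_rep (k := k) pi0)).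
Proof.
have G_unbounded x n := unbounded_orbit T_locally_finite x n G_subgroup G_closed G_noncompact.
have G_good : forall x y : T, adj x y -> good G x y.
  exact: (all_good T_degree T_locally_finite G_subgroup G_transitive G_unbounded).
split.
  have p1 : (p <= 1)%N by apply: (@index_le1 R k H B _ _ _ _ p _ T _ G _ _ pi).
  by move: p1; case: (p) => [|[|]]; [left|right|].
move=> p_eq1; have p0 : (0 < p)%N by rewrite p_eq1.
have [x] := tree_nonempty T.
have [v Dv v1] : exists2 v, fixed pi (stab G x) v & b B v v = -1.
  by apply: (@fixed_negative R k H B _ _ _ _ p _ T _ G _ _ pi).
by apply: (@real_form R k H B _ _ _ _ p _ T _ G _ _ pi) Dv v1.
Qed.
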